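(* Let $\mathscr{M}=\{m_j\}_{j\in\mathbb{N}_0}$ be a weight sequence, let $A,B\in\mathbb{C}$, let $L=\sum_{0<|\alpha|\le m}c_\alpha\partial^\alpha$ with $c_\alpha\in\mathbb{C}$ be a constant-coefficient differential operator on $\mathbb{T}^n$, and let $Pu=Lu-Au-B\bar u$. Then $P$ is $\mathscr{M}$-solvable if and only if $P$ is $\mathscr{M}$-globally hypoelliptic.
   Context: $\mathbb{T}^n\simeq\mathbb{R}^n/2\pi\mathbb{Z}^n$; $\mathbb{N}_0=\{0,1,2,\dots\}$. A weight sequence is a sequence $\mathscr{M}=\{m_j\}_{j\in\mathbb{N}_0}$ of positive reals such that (i) $m_0=m_1=1$; (ii) $m_j^2\le m_{j-1}m_{j+1}$ for all $j\ge 1$; (iii) there is $H\ge1$ with $m_{j+k}\le H^{j+k}m_jm_k$ for all $j,k\in\mathbb{N}_0$. For $h>0$, $\mathcal{E}_{\mathscr{M},h}(\mathbb{T}^n)$ is the Banach space of smooth $f:\mathbb{T}^n\to\mathbb{C}$ with $\|f\|_{\mathscr{M},h}=\sup_{\alpha\in\mathbb{N}_0^n}\sup_{x\in\mathbb{T}^n}\frac{|\partial^\alpha f(x)|}{h^{|\alpha|}m_{|\alpha|}|\alpha|!}<\infty$, and $\mathcal{E}_{\mathscr{M}}(\mathbb{T}^n)=\bigcup_{h>0}\mathcal{E}_{\mathscr{M},h}(\mathbb{T}^n)$ with the inductive limit topology as $h\to+\infty$. $\mathscr{D}'_{\mathscr{M}}(\mathbb{T}^n)$ is its topological dual (periodic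 $\mathscr{M}$-ultradistributions). $P$ acts on $\mathscr{D}'_{\mathscr{M}}(\mathbb{T}^n)$ in the usual way: derivatives are defined by duality and $\langle\bar u,f\rangle=\overline{\langle u,\bar f\rangle}$; functions in $\mathcal{E}_{\mathscr{M}}(\mathbb{T}^n)$ are identified with ultradistributions by integration. $P$ is $\mathscr{M}$-solvable if there exists a subspace $\mathcal{F}\subset\mathcal{E}_{\mathscr{M}}(\mathbb{T}^n)$ of finite codimension such that for all $f\in\mathcal{F}$ there exists $u\in\mathcal{E}_{\mathscr{M}}(\mathbb{T}^n)$ with $Pu=f$. $P$ is $\mathscr{M}$-globally hypoelliptic if the conditions $u\in\mathscr{D}'_{\mathscr{M}}(\mathbb{T}^n)$ and $Pu\in\mathcal{E}_{\mathscr{M}}(\mathbb{T}^n)$ imply $u\in\mathcal{E}_{\mathscr{M}}(\mathbb{T}^n)$. *)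

(* Defs.v *)
From HB Require Import structures.
From mathcomp Require Import all_boot all_order all_algebra.
From mathcomp Require Import complex.
From mathcomp Require Import all_classical all_reals all_analysis.
Import Order.TTheory GRing.Theory Num.Theory numFieldNormedType.Exports.

Set Implicit Arguments.
Unset Strict Implicit.
Unset Printing Implicit Defensive.

Local Open Scope classical_set_scope.
Local Open Scope ring_scope.

Local Notation normc := ComplexField.Normc.normc.

(* The condition m_j ^ 2 <= m_(j-1) m_(j+1) for j >= 1 is shifted by one to
   avoid predecessors. *)
Record weight_sequence (R : realType) (M : nat -> R) : Prop := WeightSequence {
  weight_gt0 : forall j, 0 < M j;
  weight_0 : M 0%N = 1;
  weight_1 : M 1%N = 1;
  weight_logconvex : forall j, M j.+1 ^+ 2 <= M j * M j.+2;
  weight_stable : exists2 H : R, 1 <= H &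
    forall j k, M (j + k)%N <= H ^+ (j + k) * M j * M k }.

Section Torus.
Variables (R : realType) (n : nat).

(* Functions on R^n / 2 pi Z^n are 2 pi-periodic functions on R^n. *)
Local Notation fct := ('rV[R]_n -> R[i]).

Definition periodic (f : fct) : Prop :=
  forall (x : 'rV[R]_n) (i : 'I_n), f (x + (2 * pi) *: delta_mx 0 i) = f x.

Definition fRe (f : fct) : 'rV[R]_n -> R := fun x => complex.Re (f x).
Definition fIm (f : fct) : 'rV[R]_n -> R := fun x => complex.Im (f x).

Definition fconj (f : fct) : fct := fun x => conjc (f x).

(* Partial derivatives of complex-valued functions are taken componentwise:
   'D_v is defined for maps between normed modules over the same field. *)
Definition partial (i : 'I_n) (f : fct) : fct := fun x =>
  Complex ('D_(delta_mx 0 i) (fRe f) x) ('D_(delta_mx 0 i) (fIm f) x).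

Definition is_C1 (f : fct) : Prop :=
  [/\ continuous (fRe f), continuous (fIm f) &
    forall i : 'I_n,
      [/\ forall x, derivable (fRe f) x (delta_mx 0 i),
          forall x, derivable (fIm f) x (delta_mx 0 i),
          continuous (fRe (partial i f)) & continuous (fIm (partial i f))]].

Definition smooth (f : fct) : Prop :=
  forall s : seq 'I_n, is_C1 (foldr partial f s).

Definition mabs (a : 'I_n -> nat) : nat := (\sum_(i < n) a i)%N.

Definition mderiv (a : 'I_n -> nat) (f : fct) : fct :=
  foldr (fun i g => iter (a i) (partial i) g) f (enum 'I_n).

(* With x = (t, y), the integral over [0, 2 pi]^k.+1 is the iterated one,
   \int_t \int_y f (t, y). *)
Fixpoint cube_int (k : nat) : ('rV[R]_k -> R) -> R :=
  match k return ('rV[R]_k -> R) -> R with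
  | 0 => fun f => f 0
  | k'.+1 => fun f =>
      \int[lebesgue_measure]_(t in `[0, 2 * pi])
        cube_int (fun y : 'rV[R]_k' =>
          f (row_mx (const_mx t : 'rV[R]_1) y : 'rV[R]_(1 + k')))
  end.

Definition torus_int (f : fct) : R[i] :=
  Complex (cube_int (fRe f)) (cube_int (fIm f)).

Section Ultra.
Variable M : nat -> R.

(* Valued in \bar R, so that it is also meaningful when infinite. *)
Definition Mnorm (h : R) (f : fct) : \bar R :=
  ereal_sup [set (normc (mderiv p.1 f p.2) /
      (h ^+ mabs p.1 * M (mabs p.1) * (mabs p.1)`!%:R))%:E
    | p in [set: ('I_n -> nat) * 'rV[R]_n]].

Definition EMh (h : R) : set fct :=
  [set f | [/\ periodic f, smooth f & (Mnorm h f < +oo)%E]].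

Definition EM : set fct := [set f | exists2 h : R, 0 < h & EMh h f].

(* The absolutely convex neighbourhoods of 0 in the locally convex inductive
   limit of the normed spaces (EMh h, Mnorm h). *)
Definition indlim_nbhs0 (V : set fct) : Prop :=
  [/\ V `<=` EM,
      forall (a b : R[i]) (f g : fct), V f -> V g -> normc a + normc b <= 1 ->
        V (fun x => a * f x + b * g x) &
      forall h : R, 0 < h -> exists2 r : R, 0 < r &
        forall f, EMh h f -> (Mnorm h f < r%:E)%E -> V f].

Definition indlim_continuous (u : fct -> R[i]) : Prop :=
  forall f, EM f -> forall e : R, 0 < e ->
    exists2 V, indlim_nbhs0 V &
      forall g, EM g -> V (fun x => g x - f x) -> normc (u g - u f) < e.

(* Ultradistributions are functionals on all functions of which only the
   restriction to EM is relevant; see ultra_eq. *)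
Definition ultradistribution (u : fct -> R[i]) : Prop :=
  (forall (a b : R[i]) (f g : fct), EM f -> EM g ->
     u (fun x => a * f x + b * g x) = a * u f + b * u g) /\
  indlim_continuous u.

Definition ultra_eq (u v : fct -> R[i]) : Prop := forall f, EM f -> u f = v f.

Definition ultra_of (g : fct) : fct -> R[i] :=
  fun f => torus_int (fun x => g x * f x).

Definition ultra_deriv (a : 'I_n -> nat) (u : fct -> R[i]) : fct -> R[i] :=
  fun f => (-1) ^+ mabs a * u (mderiv a f).

Definition ultra_conj (u : fct -> R[i]) : fct -> R[i] :=
  fun f => conjc (u (fconj f)).

(* A multi-index of length at most m has all its entries at most m; the values
   of c at the multi-indices a with |a| = 0 or |a| > m are ignored. *)
Section Operator.
Variables (m : nat) (c : {ffun 'I_n -> 'I_m.+1} -> R[i]) (A B : R[i]).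

Definition mindex (a : {ffun 'I_n -> 'I_m.+1}) : 'I_n -> nat :=
  fun i => nat_of_ord (a i).

Definition L_fct (f : fct) : fct := fun x =>
  \sum_(a : {ffun 'I_n -> 'I_m.+1} | (0 < mabs (mindex a) <= m)%N)
    c a * mderiv (mindex a) f x.

Definition L_ultra (u : fct -> R[i]) : fct -> R[i] := fun f =>
  \sum_(a : {ffun 'I_n -> 'I_m.+1} | (0 < mabs (mindex a) <= m)%N)
    c a * ultra_deriv (mindex a) u f.

Definition P_fct (f : fct) : fct := fun x =>
  L_fct f x - A * f x - B * fconj f x.

Definition P_ultra (u : fct -> R[i]) : fct -> R[i] := fun f =>
  L_ultra u f - A * u f - B * ultra_conj u f.

End Operator.

(* Complex-linear subspaces. P_fct is only real-linear, but real subspaces would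
   give the same notion of solvability: if F is real of finite codimension, so
   is the complex subspace F `&` 'i F. *)
Definition subspace (F : set fct) : Prop :=
  [/\ F `<=` EM, F (fun=> 0) &
    forall (a b : R[i]) (f g : fct), F f -> F g ->
      F (fun x => a * f x + b * g x)].

(* The quotient EM / F is spanned by the classes of finitely many g_i. *)
Definition finite_codim (F : set fct) : Prop :=
  exists (k : nat) (g : 'I_k -> fct), (forall i, EM (g i)) /\
    forall f, EM f -> exists a : 'I_k -> R[i],
      F (fun x => f x - \sum_(i < k) a i * g i x).

Definition M_solvable (P : fct -> fct) : Prop :=
  exists F : set fct, [/\ subspace F, finite_codim F &
    forall f, F f -> exists2 u, EM u & P u = f].

Definition M_globally_hypoelliptic (P : (fct -> R[i]) -> (fct -> R[i])) : Prop :=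
  forall u, ultradistribution u ->
    (exists2 g, EM g & ultra_eq (P u) (ultra_of g)) ->
    exists2 v, EM v & ultra_eq u (ultra_of v).

End Ultra.
End Torus.

(* Main.v *)
(** Smooth periodic functions and ultradistributions are determined by their
    Fourier coefficients [a xi], and a function lies in [EM] iff its coefficients
    satisfy [|a xi| |xi| ^ k <= C h ^ k m_k k!] for some [C, h] and all [k].  On
    coefficients, [P u = f] couples only [u^(xi)] with the conjugate of
    [u^(- xi)]; eliminating the latter gives
    [sigma xi * u^(xi) = q xi * f^(xi) + B * (f^(- xi))^*] with
    [sigma xi = p xi * (p (- xi))^* - |B| ^ 2] ([sigma = p] if [B = 0]), where [p]
    is the symbol of [L - A].  Both solvability and global hypoellipticity are
    equivalent to the same lower bound: for every [h], eventually [|sigma xi|]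
    exceeds [h ^ k m_k k! / |xi| ^ k] for some [k].  If it holds, division by
    [sigma] preserves the decay.  If it fails along a sequence [x_i], then
    prescribing bounded coefficients at [x_i, - x_i] gives an ultradistribution
    outside [EM] with [P u] in [EM], and right-hand sides of size [|sigma (x_i)|]
    on [k + 1] disjoint subsequences span a [k + 1]-dimensional space that meets
    the range of [P] only in 0. *)

From mathcomp Require Import all_boot all_order all_algebra.
From mathcomp Require Import complex ring lra zify.
From mathcomp Require Import all_classical all_reals all_analysis.
Require Import Defs.
Import Order.TTheory GRing.Theory Num.Theory numFieldNormedType.Exports.

Set Implicit Arguments.
Unset Strict Implicit.
Unset Printing Implicit Defensive.

Local Open Scope classical_set_scope.
Local Open Scope ring_scope.

Local Notation normc := ComplexField.Normc.normc.

(** * Complex numbers and one-dimensional integrals *)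

(** Losses are paid for in [h]. Stability of the weight sequence gives m_(k+p) (k+p)! <= (2H)^(k+p)
    (m_k k!) (m_p p!), so a polynomial factor, or a division by [sigma], only replaces [h] by
    [2 * H * h], which is harmless in the union over all [h]. This is why the lower bound on [sigma]
    is demanded for every [h]. The torus integral is iterated, so integrability has to be known at
    each level. Integrands stay in the class of bounded Lipschitz functions, which is stable under
    products, slices and partial integration; series are dominated by one fixed summable weight. In
    the failing case two degeneracies occur. The cofactor multiplying the data may be unbounded: the
    pair of coefficients at x_i and - x_i is normalised for hypoellipticity, and for solvability
    with B nonzero the data sit at - x_i, where the factor is the constant B. Moreover [sigma] may
    vanish along the sequence, so the right-hand sides have size |sigma (x_i)| + exp (- |x_i|); the
    second term keeps them nonzero and still decays fast enough for every weight sequence. *)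

Section ComplexModulus.
Variable R : realType.
Implicit Types (x y z : R[i]) (a b s t : R).

Lemma normc_ge0 z : 0 <= normc z.
Proof. by case: z => a b; exact: sqrtr_ge0. Qed.

Lemma normc0 : normc (0 : R[i]) = 0.
Proof. exact: ComplexField.Normc.normc0. Qed.

Lemma normc1 : normc (1 : R[i]) = 1.
Proof. exact: ComplexField.Normc.normc1. Qed.

Lemma normcM x y : normc (x * y) = normc x * normc y.
Proof. exact: ComplexField.Normc.normcM. Qed.

Lemma normcN x : normc (- x) = normc x.
Proof. exact: (@normcN R x). Qed.

Lemma normcV x : normc x^-1 = (normc x)^-1.
Proof. exact: ComplexField.Normc.normcV. Qed.

Lemma normcX x k : normc (x ^+ k) = normc x ^+ k.
Proof.
by elim: k => [|k ih]; rewrite ?expr0 ?normc1// !exprS normcM ih.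
Qed.

Lemma normcD x y : normc (x + y) <= normc x + normc y.
Proof. exact: (@le_normcD R x y). Qed.

Lemma normcB x y : normc (x - y) <= normc x + normc y.
Proof. by rewrite -(normcN y); exact: normcD. Qed.

Lemma normc_distC x y : normc (x - y) = normc (y - x).
Proof. by rewrite -normcN opprB. Qed.

Lemma normc_eq0 x : (normc x == 0) = (x == 0).
Proof.
apply/eqP/eqP => [|->]; last exact: normc0.
exact: ComplexField.Normc.eq0_normc.
Qed.

Lemma normc_gt0 x : (0 < normc x) = (x != 0).
Proof. by rewrite lt_neqAle normc_ge0 andbT eq_sym normc_eq0. Qed.

Lemma normc_real a : normc a%:C%C = `|a|.
Proof. by rewrite /= expr0n /= addr0 sqrtr_sqr. Qed.

Lemma normc_conj z : normc (conjc z) = normc z.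
Proof. by case: z => a b /=; rewrite sqrrN. Qed.

Lemma normc_Re z : `|complex.Re z| <= normc z.
Proof.
by case: z => a b /=; rewrite -sqrtr_sqr ler_wsqrtr// lerDl sqr_ge0.
Qed.

Lemma normc_Im z : `|complex.Im z| <= normc z.
Proof.
by case: z => a b /=; rewrite -sqrtr_sqr ler_wsqrtr// lerDr sqr_ge0.
Qed.

Lemma normc_i : normc ('i%C : R[i]) = 1.
Proof. by rewrite /= expr0n expr1n add0r sqrtr1. Qed.

Lemma normc_le_ReIm z : normc z <= `|complex.Re z| + `|complex.Im z|.
Proof.
rewrite {1}[z]complexE (le_trans (normcD _ _))//.
by rewrite normcM normc_i mul1r !normc_real.
Qed.

Lemma normc_sum (I : Type) (r : seq I) (Q : pred I) (F : I -> R[i]) :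
  normc (\sum_(i <- r | Q i) F i) <= \sum_(i <- r | Q i) normc (F i).
Proof.
elim/big_ind2: _ => //; first by rewrite normc0.
by move=> x1 x2 y1 y2 h1 h2; rewrite (le_trans (normcD _ _))// lerD.
Qed.

Lemma ReD x y : complex.Re (x + y) = complex.Re x + complex.Re y.
Proof. by case: x y => [? ?] [? ?]. Qed.

Lemma ImD x y : complex.Im (x + y) = complex.Im x + complex.Im y.
Proof. by case: x y => [? ?] [? ?]. Qed.

Lemma ReB x y : complex.Re (x - y) = complex.Re x - complex.Re y.
Proof. by case: x y => [? ?] [? ?]. Qed.

Lemma ImB x y : complex.Im (x - y) = complex.Im x - complex.Im y.
Proof. by case: x y => [? ?] [? ?]. Qed.

Lemma ReM x y : complex.Re (x * y) =
  complex.Re x * complex.Re y - complex.Im x * complex.Im y.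
Proof. by case: x y => [? ?] [? ?]. Qed.

Lemma ImM x y : complex.Im (x * y) =
  complex.Re x * complex.Im y + complex.Im x * complex.Re y.
Proof. by case: x y => [? ?] [? ?]. Qed.

Lemma conjcD x y : conjc (x + y) = conjc x + conjc y.
Proof. exact: rmorphD. Qed.

Lemma conjcB x y : conjc (x - y) = conjc x - conjc y.
Proof. exact: rmorphB. Qed.

Lemma conjcM x y : conjc (x * y) = conjc x * conjc y.
Proof. exact: rmorphM. Qed.

End ComplexModulus.

(** * Mean value estimates for sine and cosine *)

Section MeanValue.
Variable R : realType.

Lemma is_derive_continuous (f df : R -> R) :
  (forall x : R, is_derive x 1 f (df x)) -> continuous f.
Proof.
by move=> hf x; apply/differentiable_continuous/derivable1_diffP; case: (hf x).
Qed.

(** The bound on the intermediate point allows iteration: one application gives the Lipschitz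
    estimates for sine and cosine, and inserting these for [df c] gives the quadratic ones. *)
Lemma mean_value (f df : R -> R) (t : R) :
  (forall x : R, is_derive x 1 f (df x)) ->
  exists2 c, `|c| <= `|t| & f t - f 0 = df c * t.
Proof.
move=> hf; have cf := is_derive_continuous hf.
have [t0|t0] := leP 0 t.
  have [c /itvP hc e] := MVT_segment t0 (fun x _ => hf x)
    (continuous_subspaceT cf).
  exists c; last by rewrite e subr0.
  by rewrite !ger0_norm// hc.
have [c /itvP hc e] := MVT_segment (ltW t0) (fun x _ => hf x)
  (continuous_subspaceT cf).
exists c; last by rewrite -opprB e sub0r mulrN opprK.
by rewrite !ler0_norm ?lerN2 ?hc// ltW.
Qed.

Lemma sin_norm_le (t : R) : `|sin t| <= `|t|.
Proof.
have [c _ e] := @mean_value sin cos t (fun x => is_derive_sin x).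
rewrite -[sin t]subr0 -[X in _ - X]sin0 e normrM.
by rewrite ler_piMl// cos_max.
Qed.

Lemma onemcos_le (t : R) : `|cos t - 1| <= `|t|.
Proof.
have [c _ e] := @mean_value cos (fun x => - sin x) t (fun x => is_derive_cos x).
rewrite -[X in _ - X]cos0 e normrM normrN.
by rewrite ler_piMl// sin_max.
Qed.

Lemma onemcos_sqr (t : R) : `|cos t - 1| <= t ^+ 2.
Proof.
have [c hc e] := @mean_value cos (fun x => - sin x) t (fun x => is_derive_cos x).
rewrite -[X in _ - X]cos0 e normrM normrN -real_normK ?num_real// expr2.
by rewrite ler_wpM2r// (le_trans (sin_norm_le c)).
Qed.

Lemma sin_sqr (t : R) : `|sin t - t| <= t ^+ 2.
Proof.
have [c hc e] := @mean_value (fun x => sin x - x) (fun x => cos x - 1) t _.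
have -> : sin t - t = (cos c - 1) * t by rewrite -e sin0; ring.
rewrite normrM -[leRHS]real_normK ?num_real// expr2.
by rewrite ler_wpM2r// (le_trans (onemcos_le c)).
Qed.

End MeanValue.

(** * The exponential of an imaginary number *)

Section Expi.
Variable R : realType.
Implicit Types s t : R.

Definition expi s : R[i] := Complex (cos s) (sin s).

Lemma expiD s t : expi (s + t) = expi s * expi t.
Proof.
rewrite /expi cosD sinD; apply/eqP; rewrite eq_complex /=; apply/andP.
by split; apply/eqP; ring.
Qed.

Lemma expi0 : expi 0 = 1.
Proof. by rewrite /expi cos0 sin0. Qed.

Lemma conjc_expi s : conjc (expi s) = expi (- s).
Proof. by rewrite /expi cosN sinN. Qed.

Lemma normc_expi s : normc (expi s) = 1.
Proof. by rewrite /= cos2Dsin2 sqrtr1. Qed.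

Lemma expi_2pi : expi (2 * pi) = 1.
Proof. by rewrite /expi mulr_natl cos2pi sin2pi. Qed.

Lemma expi_period (k : int) s : expi (s + k%:~R * (2 * pi)) = expi s.
Proof.
have h n r : expi (r + n%:R * (2 * pi)) = expi r.
  elim: n => [|n ih]; first by rewrite mul0r addr0.
  by rewrite -natr1 mulrDl mul1r addrA expiD expi_2pi mulr1.
case: k => n; first exact: h.
rewrite -(h n.+1); congr expi.
by rewrite NegzE mulrNz -pmulrn mulNr addrNK.
Qed.

Lemma expi_lip s : normc (expi s - 1) <= 2 * `|s|.
Proof.
rewrite (le_trans (normc_le_ReIm _))//= subr0 mulr2n mulrDl !mul1r.
by rewrite lerD ?onemcos_le ?sin_norm_le.
Qed.

Lemma expi_quad s : normc (expi s - 1 - 'i%C * s%:C%C) <= 2 * s ^+ 2.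
Proof.
rewrite (le_trans (normc_le_ReIm _))// !ReB !ImB ReM ImM /=.
rewrite !(mul0r, mulr0, subr0, mul1r, addr0, add0r) mulrDl !mul1r.
by rewrite oppr0 subr0 lerD ?onemcos_sqr ?sin_sqr.
Qed.

End Expi.

(** * Bounded Lipschitz functions *)

Section BoundedLipschitz.
Variables (R : realType) (T : Type) (d : T -> T -> R).
Hypothesis d_ge0 : forall x y, 0 <= d x y.
Implicit Types f g : T -> R[i].

(** The regularity class of all integrands, used on the line and on the torus, hence the abstract
    [d]. Boundedness is what makes it closed under products. *)
Definition bounded_lipschitz f := exists2 K : R,
  forall x, normc (f x) <= K & forall x y, normc (f x - f y) <= K * d x y.

Lemma bl_cst a : bounded_lipschitz (fun=> a).
Proof.
exists (normc a) => // x y.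
by rewrite subrr normc0 mulr_ge0// normc_ge0.
Qed.

Lemma bl_ge0 f K : T -> (forall x, normc (f x) <= K) -> 0 <= K.
Proof. by move=> x /(_ x); apply: le_trans; exact: normc_ge0. Qed.

Lemma bl_D f g : bounded_lipschitz f -> bounded_lipschitz g ->
  bounded_lipschitz (fun x => f x + g x).
Proof.
move=> [K K1 K2] [L L1 L2]; exists (K + L) => [x|x y].
  by rewrite (le_trans (normcD _ _))// lerD.
rewrite mulrDl opprD addrACA (le_trans (normcD _ _))//.
by rewrite lerD.
Qed.

Lemma bl_M f g : bounded_lipschitz f -> bounded_lipschitz g ->
  bounded_lipschitz (fun x => f x * g x).
Proof.
move=> [K K1 K2] [L L1 L2]; exists (2 * (K * L)) => [x|x y].
  have K0 := bl_ge0 x K1; have L0 := bl_ge0 x L1.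
  rewrite normcM (@le_trans _ _ (K * L))//.
    by apply: ler_pM => //; exact: normc_ge0.
  by rewrite ler_peMl ?mulr_ge0// ler1n.
have -> : f x * g x - f y * g y = f x * (g x - g y) + (f x - f y) * g y.
  by ring.
have -> : 2 * (K * L) * d x y = K * (L * d x y) + (K * d x y) * L by ring.
rewrite (le_trans (normcD _ _))// !normcM lerD// ler_pM ?normc_ge0//.
Qed.

Lemma bl_Z a f : bounded_lipschitz f -> bounded_lipschitz (fun x => a * f x).
Proof. by apply: bl_M; exact: bl_cst. Qed.

Lemma bl_lin a b f g : bounded_lipschitz f -> bounded_lipschitz g ->
  bounded_lipschitz (fun x => a * f x + b * g x).
Proof. by move=> hf hg; apply: bl_D; apply: bl_Z. Qed.

End BoundedLipschitz.

(** * Derivatives with a uniform quadratic remainder *)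

Section QuadraticDerivative.
Variables (R : realType) (V : normedModType R).

(* Second-order control of the Taylor remainder, uniform in the base point,
   makes differentiation commute with integrals and with series. *)
Definition quad_derivative (v : V) (f f' : V -> R[i]) := exists K : R,
  forall x s, normc (f (x + s *: v) - f x - s%:C%C * f' x) <= K * s ^+ 2.

Lemma quad_is_derive (v : V) (f f' : V -> R) (K : R) :
  (forall x s, `|f (x + s *: v) - f x - s * f' x| <= K * s ^+ 2) ->
  forall x, is_derive x v f (f' x).
Proof.
move=> hK x; suff h : h^-1 *: ((f \o shift x) (h *: v) - f x) @[h --> 0^'] --> f' x.
  by apply: DeriveDef; [apply/cvg_ex; exists (f' x)|exact/cvg_lim].
apply/cvgrPdist_le => e e0; near=> h.
have h0 : h != 0 by near: h; exact: nbhs_dnbhs_neq.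
have K1 : 0 < `|K| + 1 by rewrite ltr_wpDl.
have he : (`|K| + 1) * `|h| <= e.
  rewrite mulrC -ler_pdivlMr//.
  near: h; apply: dnbhs0_le; exact: divr_gt0.
apply: le_trans he; rewrite distrC /= [h *: v + x]addrC.
have -> : h^-1 *: (f (x + h *: v) - f x) - f' x =
    h^-1 * (f (x + h *: v) - f x - h * f' x).
  by rewrite /GRing.scale /= [in RHS]mulrBr mulrA mulVf// mul1r.
rewrite normrM normfV mulrC ler_pdivrMr ?normr_gt0//.
rewrite (le_trans (hK x h))// -mulrA -expr2 real_normK ?num_real//.
by rewrite ler_wpM2r ?sqr_ge0// (le_trans (ler_norm K))// lerDl.
Unshelve. all: by end_near. Qed.

Lemma quad_is_derive_Re (v : V) (f f' : V -> R[i]) : quad_derivative v f f' ->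
  forall x, is_derive x v (fun x => complex.Re (f x)) (complex.Re (f' x)).
Proof.
move=> [K hK]; apply: (@quad_is_derive _ _ _ K) => x s.
rewrite (le_trans _ (hK x s))// (le_trans _ (normc_Re _))//.
by rewrite !ReB ReM /= mul0r subr0.
Qed.

Lemma quad_is_derive_Im (v : V) (f f' : V -> R[i]) : quad_derivative v f f' ->
  forall x, is_derive x v (fun x => complex.Im (f x)) (complex.Im (f' x)).
Proof.
move=> [K hK]; apply: (@quad_is_derive _ _ _ K) => x s.
rewrite (le_trans _ (hK x s))// (le_trans _ (normc_Im _))//.
by rewrite !ImB ImM /= mul0r addr0.
Qed.

End QuadraticDerivative.

(** * Integration over one period *)

Section PeriodIntegral.
Variable R : realType.
Implicit Types f g : R -> R[i].

Definition dist1 (s t : R) := `|s - t|.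

Lemma dist1_ge0 s t : 0 <= dist1 s t. Proof. exact: normr_ge0. Qed.

Definition rint (f : R -> R) : R :=
  \int[lebesgue_measure]_(t in `[0, 2 * pi]) f t.

Definition cint f : R[i] :=
  Complex (rint (fun t => complex.Re (f t))) (rint (fun t => complex.Im (f t))).

Lemma pi2_gt0 : 0 < 2 * pi :> R.
Proof. by rewrite mulr_gt0// pi_gt0. Qed.

Lemma rint_integrable (f : R -> R) : continuous f ->
  lebesgue_measure.-integrable `[0, 2 * pi] (EFin \o f).
Proof.
move=> cf; apply: continuous_compact_integrable; first exact: segment_compact.
exact: continuous_subspaceT.
Qed.

Lemma rintD (f g : R -> R) : continuous f -> continuous g ->
  rint (fun t => f t + g t) = rint f + rint g.
Proof. by move=> cf cg; apply: RintegralD => //; exact: rint_integrable. Qed.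

Lemma rintZ a (f : R -> R) : continuous f ->
  rint (fun t => a * f t) = a * rint f.
Proof. by move=> cf; apply: RintegralZl => //; exact: rint_integrable. Qed.

Lemma rint_le (f g : R -> R) : continuous f -> continuous g ->
  (forall t, 0 <= t <= 2 * pi -> f t <= g t) -> rint f <= rint g.
Proof.
move=> cf cg fg; apply: le_Rintegral => //; try exact: rint_integrable.
Qed.

Lemma rint_cst a : rint (fun=> a) = a * (2 * pi).
Proof.
rewrite /rint Rintegral_cst//.
have e : fine (lebesgue_measure ([set` `[0, 2 * pi]] : set R)) = 2 * pi :> R.
  by rewrite lebesgue_measure_itv /= lte_fin pi2_gt0 -EFinB subr0.
by rewrite -[in RHS]e.
Qed.

Lemma rint_derive (f df : R -> R) : (forall x : R, is_derive x 1 f (df x)) ->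
  continuous df -> rint df = f (2 * pi) - f 0.
Proof.
move=> fdf cdf; have cf := is_derive_continuous fdf.
rewrite /rint /Rintegral (@continuous_FTC2 _ df f)//; first exact: pi2_gt0.
- exact: continuous_subspaceT.
- split.
  + by move=> x _; case: (fdf x).
  + by apply: cvg_at_right_filter; exact: cf.
  + by apply: cvg_at_left_filter; exact: cf.
- by move=> x _; rewrite derive1E; case: (fdf x).
Qed.

Lemma rint_norm_le (f : R -> R) K : continuous f -> (forall t, `|f t| <= K) ->
  `|rint f| <= K * (2 * pi).
Proof.
move=> cf hf; have cc (a : R) : continuous (fun _ : R => a).
  exact: cst_continuous.
have hf' t : (- K <= f t) && (f t <= K) by rewrite -ler_norml hf.
rewrite ler_norml -mulNr -!rint_cst; apply/andP; split.
  by apply: rint_le (cc _) cf _ => t _; case/andP: (hf' t).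
by apply: rint_le cf (cc _) _ => t _; case/andP: (hf' t).
Qed.

Lemma lipschitz_continuous (f : R -> R) K :
  (forall s t, `|f s - f t| <= K * `|s - t|) -> continuous f.
Proof.
move=> hf t; apply/cvgrPdist_le => e e0; near=> s.
have K1 : 0 < `|K| + 1 by rewrite ltr_wpDl.
rewrite (le_trans (hf t s))// (@le_trans _ _ ((`|K| + 1) * `|t - s|))//.
  by rewrite ler_wpM2r// (le_trans (ler_norm K))// lerDl.
rewrite mulrC -ler_pdivlMr//.
near: s; apply: cvgr_dist_le => //; exact: divr_gt0.
Unshelve. all: by end_near. Qed.

Lemma bl_continuous_Re f : bounded_lipschitz dist1 f ->
  continuous (fun t => complex.Re (f t)).
Proof.
move=> [K _ hK]; apply: (@lipschitz_continuous _ K) => s t.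
by rewrite -ReB (le_trans (normc_Re _)).
Qed.

Lemma bl_continuous_Im f : bounded_lipschitz dist1 f ->
  continuous (fun t => complex.Im (f t)).
Proof.
move=> [K _ hK]; apply: (@lipschitz_continuous _ K) => s t.
by rewrite -ImB (le_trans (normc_Im _)).
Qed.

Lemma cintD f g : bounded_lipschitz dist1 f -> bounded_lipschitz dist1 g ->
  cint (fun t => f t + g t) = cint f + cint g.
Proof.
move=> hf hg; apply/eqP; rewrite eq_complex /=; apply/andP; split; apply/eqP.
  rewrite -rintD; try exact: bl_continuous_Re.
  by congr rint; apply/funext => t; rewrite ReD.
rewrite -rintD; try exact: bl_continuous_Im.
by congr rint; apply/funext => t; rewrite ImD.
Qed.

Lemma cintZ a f : bounded_lipschitz dist1 f ->
  cint (fun t => a * f t) = a * cint f.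
Proof.
move=> hf; have cR := bl_continuous_Re hf; have cI := bl_continuous_Im hf.
have cZ (b : R) (h : R -> R) : continuous h -> continuous (fun t => b * h t).
  by move=> ch t; apply: cvgM; [exact: cvg_cst|exact: ch].
apply/eqP; rewrite eq_complex ReM ImM /= -mulNr -!rintZ//.
rewrite -!rintD; try exact: cZ.
apply/andP; split; apply/eqP; congr rint; apply/funext => t.
  by rewrite ReM mulNr.
by rewrite ImM.
Qed.

Lemma cint_lin a b f g : bounded_lipschitz dist1 f -> bounded_lipschitz dist1 g ->
  cint (fun t => a * f t + b * g t) = a * cint f + b * cint g.
Proof.
by move=> hf hg; rewrite cintD ?cintZ//; apply: bl_Z => //; exact: dist1_ge0.
Qed.

(** Real and imaginary parts are bounded separately, each by K times the length of the period; hence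
    [4 * pi] instead of the sharp [2 * pi]. *)
Lemma cint_le f K : bounded_lipschitz dist1 f -> (forall t, normc (f t) <= K) ->
  normc (cint f) <= 4 * pi * K.
Proof.
move=> hf hK; have -> : 4 * pi * K = K * (2 * pi) + K * (2 * pi) by ring.
rewrite (le_trans (normc_le_ReIm _))//= lerD// rint_norm_le//.
- exact: bl_continuous_Re.
- by move=> t; rewrite (le_trans (normc_Re _)).
- exact: bl_continuous_Im.
- by move=> t; rewrite (le_trans (normc_Im _)).
Qed.

Lemma cint0 : cint (fun=> 0) = 0.
Proof. by rewrite /cint /= !rint_cst !mul0r. Qed.

Lemma cint_derive f f' : quad_derivative (1 : R) f f' ->
  bounded_lipschitz dist1 f' -> f (2 * pi) = f 0 -> cint f' = 0.
Proof.
move=> ff' hf' f0.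
rewrite /cint (rint_derive (quad_is_derive_Re ff') (bl_continuous_Re hf')).
rewrite (rint_derive (quad_is_derive_Im ff') (bl_continuous_Im hf')).
by rewrite f0 !subrr.
Qed.

Lemma cint_conj f : bounded_lipschitz dist1 f ->
  cint (fun t => conjc (f t)) = conjc (cint f).
Proof.
move=> hf; rewrite /cint /=; apply/eqP; rewrite eq_complex /=.
apply/andP; split; apply/eqP; first by congr rint; apply/funext => t; case: (f t).
rewrite -mulN1r -rintZ; last exact: bl_continuous_Im.
by congr rint; apply/funext => t; rewrite mulN1r; case: (f t).
Qed.

End PeriodIntegral.

(** * Uniqueness of Fourier coefficients *)

Section OneDimensionalUniqueness.
Variable R : realType.
Local Notation bl1 := (bounded_lipschitz (@dist1 R)).

Lemma normc_expiB (s t : R) : normc (expi s - expi t) <= 2 * `|s - t|.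
Proof.
have -> : expi s - expi t = expi t * (expi (s - t) - 1).
  by rewrite mulrBr mulr1 -expiD [t + _]addrC subrK.
by rewrite normcM normc_expi mul1r expi_lip.
Qed.

Lemma bl_expi (a : R) : bl1 (fun t => expi (a * t)).
Proof.
exists (1 + 2 * `|a|) => [t|s t]; first by rewrite normc_expi lerDl mulr_ge0.
rewrite (le_trans (normc_expiB _ _))// -mulrBr normrM mulrA /dist1.
by rewrite ler_wpM2r// lerDr.
Qed.

Variable t0 : R.

(* The powers of [hump] replace the Fejer kernel: multiplying by [hump] mixes
   neighbouring frequencies, and [hump_intS] gives the decay of their integrals. *)
Definition hump (t : R) : R := (1 + cos (t - t0)) / 2.

Lemma hump_ge0 t : 0 <= hump t.
Proof. by rewrite divr_ge0// -lerBlDl sub0r cos_geN1. Qed.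

Lemma hump_expi t : (hump t)%:C%C = (1 / 2)%:C%C +
  (1 / 4)%:C%C * expi (- t0) * expi (1 * t) +
  (1 / 4)%:C%C * expi t0 * expi (- 1 * t).
Proof.
rewrite -!mulrA -!expiD (mul1r t) mulN1r /hump cosB /expi !cosD !sinD !cosN !sinN.
apply/eqP; rewrite eq_complex /=; apply/andP.
by split; apply/eqP; field.
Qed.

Lemma is_derive_sinB (t : R) : is_derive t 1 (fun t => sin (t - t0)) (cos (t - t0)).
Proof.
have h : is_derive t 1 (fun t : R => t - t0) 1.
  by apply: is_derive_eq; rewrite oppr0 addr0.
rewrite -[cos _]mulr1.
by have := @is_derive1_comp _ sin (fun t : R => t - t0) t _ _ (is_derive_sin (t - t0)) h.
Qed.

Lemma is_derive_hump (t : R) : is_derive t 1 hump (- sin (t - t0) / 2).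
Proof.
have h : is_derive t 1 (fun t : R => t - t0) 1.
  by apply: is_derive_eq; rewrite oppr0 addr0.
have h2 := @is_derive1_comp _ cos (fun t : R => t - t0) t _ _ (is_derive_cos (t - t0)) h.
have h3 := is_deriveZ 2^-1 (is_deriveD (is_derive_cst (1 : R) t 1) h2).
have -> : hump = (2^-1 \*: (cst 1 + (cos \o (fun t : R => t - t0)))).
  by apply/funext => u; rewrite /hump /= mulrC.
by apply: (is_derive_eq h3); rewrite /GRing.scale /=; field.
Qed.

Lemma is_derive_humpX N (t : R) :
  is_derive t 1 (fun t => hump t ^+ N) (N%:R * hump t ^+ N.-1 * (- sin (t - t0) / 2)).
Proof.
have h := is_derive_hump t.
case: N => [|N].
  rewrite !mul0r; under eq_fun do rewrite expr0; exact: is_derive_cst.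
have -> : (fun t => hump t ^+ N.+1) = hump ^+ N.+1.
  by apply/funext => u; rewrite fctE.
exact: (is_derive_eq (is_deriveX N.+1 h)).
Qed.

Lemma continuous_humpX N : continuous (fun t => hump t ^+ N).
Proof. exact: is_derive_continuous (is_derive_humpX N). Qed.

Definition hump_int N := rint (fun t => hump t ^+ N).

(** The difference of the two integrands is the derivative of the periodic function
    [hump t ^+ N * sin (t - t0)]. Hence [hump_int N - hump_int N.+1] is only the fraction 1/(2N+2)
    of [hump_int N]: the mass concentrates where [hump] is close to 1, that is at [t0]. *)
Lemma hump_intS N : (2 * N%:R + 2) * hump_int N.+1 = (2 * N%:R + 1) * hump_int N.
Proof.
have h (t : R) : is_derive t 1 (fun t => hump t ^+ N * sin (t - t0))
   ((2 * N%:R + 2) * hump t ^+ N.+1 + - (2 * N%:R + 1) * hump t ^+ N).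
  have h1 := is_derive_humpX N t; have h2 := is_derive_sinB t.
  apply: (is_derive_eq (is_deriveM h1 h2)); rewrite /GRing.scale /=.
  have e : cos (t - t0) = 2 * hump t - 1 by rewrite /hump; field.
  have e2 := sin2cos2 (t - t0).
  have e3 : sin (t - t0) * sin (t - t0) = 4 * hump t * (1 - hump t).
    by rewrite -expr2 e2 e; ring.
  have -> : sin (t - t0) * (N%:R * hump t ^+ N.-1 * (- sin (t - t0) / 2)) =
    - (N%:R * hump t ^+ N.-1 * (2 * hump t * (1 - hump t))).
    transitivity (- (N%:R * hump t ^+ N.-1 * ((sin (t - t0) * sin (t - t0)) / 2))).
      by field.
    by rewrite e3; field.
  rewrite e; case: N {h1} => [|N] /=; first by rewrite expr0 expr1; ring.
  by rewrite !exprS; ring.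
have cb k (a : R) : continuous (fun t => a * hump t ^+ k).
  move=> t; apply: cvgM; [exact: cvg_cst|exact: continuous_humpX].
have := rint_derive h; rewrite rintD// !rintZ; try exact: continuous_humpX.
move=> /(_ _); set c := continuous _; have hc : c.
  by move=> t; apply: cvgD; exact: cb.
move=> /(_ hc) /eqP.
have -> : sin (2 * pi - t0) = sin (0 - t0) :> R.
  by rewrite mulr_natl addrC sinD2pi add0r.
have -> : hump (2 * pi) = hump 0.
  by rewrite /hump mulr_natl [_ - t0]addrC cosD2pi add0r.
by rewrite subrr mulNr subr_eq0 => /eqP.
Qed.

Lemma hump_int_gt0 N : 0 < hump_int N.
Proof.
elim: N => [|N ih].
  rewrite /hump_int; under eq_fun do rewrite expr0.
  by rewrite rint_cst mul1r pi2_gt0.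
have N0 : 0 <= N%:R :> R by [].
have h : 0 < (2 * N%:R + 2) * hump_int N.+1 by rewrite hump_intS mulr_gt0//; lra.
by rewrite pmulr_rgt0// in h; lra.
Qed.

End OneDimensionalUniqueness.

(** * Functions on the circle with vanishing Fourier coefficients *)

Section VanishingCoefficients.
Variable R : realType.
Local Notation bl1 := (bounded_lipschitz (@dist1 R)).
Implicit Type g : R -> R[i].

Lemma bl_expiM (a : R) g : bl1 g -> bl1 (fun t => expi (a * t) * g t).
Proof. by move=> hg; apply: bl_M (bl_expi _) hg => ? ?; exact: dist1_ge0. Qed.

Definition null_coefficients g :=
  forall k : int, cint (fun t => expi (k%:~R * t) * g t) = 0.

Lemma null_coefficients_hump g t0 : bl1 g -> null_coefficients g ->
  let gb t := (hump t0 t)%:C%C * g t in bl1 gb /\ null_coefficients gb.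
Proof.
move=> hg h0 gb.
have b0 := @dist1_ge0 R.
pose a1 : R[i] := (1 / 2)%:C%C; pose a2 := (1 / 4)%:C%C * expi (- t0).
pose a3 := (1 / 4)%:C%C * expi t0.
have e k : (fun t => expi (k%:~R * t) * gb t) = (fun t =>
    1 * (a1 * (expi (k%:~R * t) * g t) + a2 * (expi ((k + 1)%:~R * t) * g t)) +
    a3 * (expi ((k - 1)%:~R * t) * g t)).
  apply/funext => t; rewrite /gb hump_expi rmorphD rmorphB /= !mulrDl !expiD.
  by rewrite /a1 /a2 /a3; ring.
have hb (k : int) : bl1 (fun t => expi (k%:~R * t) * g t) by exact: bl_expiM.
split.
  have -> : gb = (fun t => expi (0%:~R * t) * gb t).
    by apply/funext => t; rewrite mul0r expi0 mul1r.
  by rewrite e; apply: bl_lin => //; apply: bl_lin.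
move=> k; rewrite e !cint_lin// ?h0; last exact: bl_lin.
by rewrite !mulr0 !addr0 mulr0.
Qed.

Lemma null_coefficients_humpX g t0 N : bl1 g -> null_coefficients g ->
  let gb t := (hump t0 t ^+ N)%:C%C * g t in bl1 gb /\ null_coefficients gb.
Proof.
move=> hg h0; elim: N => [|N [h1 h2]] /=.
  by under eq_fun do rewrite expr0 mul1r.
have := null_coefficients_hump t0 h1 h2.
by under eq_fun do rewrite /= mulrA -rmorphM -exprS.
Qed.

Lemma cos_le_away (delta s : R) : 0 < delta <= pi -> delta <= `|s| <= 2 * pi - delta ->
  cos s <= cos delta.
Proof.
move=> /andP[d0 dpi] /andP[s1 s2]; have p0 := @pi_gt0 R.
rewrite -cos_norm; have [sp|sp] := leP `|s| pi.
  rewrite leNgt ltr_cos ?in_itv/= -?leNgt//; apply/andP; split=> //; lra.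
have -> : cos `|s| = cos (2 * pi - `|s|).
  by rewrite mulr_natl addrC cosD2pi cosN.
rewrite leNgt ltr_cos ?in_itv/= -?leNgt//; last by apply/andP; split => //; lra.
  lra.
by apply/andP; split; lra.
Qed.

(** Near [t0] the real part stays above half its value at [t0]; away from [t0] the factor
    [1 - hump t0 t] is bounded below, so a large K outweighs the most negative value of the real
    part. *)
Lemma hump_lower_bound g t0 : bl1 g -> 0 < t0 < 2 * pi -> 0 < complex.Re (g t0) ->
  exists c K : R, [/\ 0 < c, 0 <= K & forall t, 0 <= t <= 2 * pi ->
    c - K * (1 - hump t0 t) <= complex.Re (g t)].
Proof.
move=> [K0 hK0 hL] /andP[t00 t02] r0; set r := complex.Re (g t0) in r0 *.
have p0 := @pi_gt0 R; have K00 := bl_ge0 t0 hK0.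
pose L := K0 + 1; have L0 : 0 < L by rewrite /L; lra.
(* The first entry is the radius on which the real part drops by at most r/2. The others keep
   [|t - t0| <= 2 * pi - delta] on the whole period, so that [t] does not come close to [t0] again
   modulo the period. *)
pose delta := Num.min (r / 2 / L) (Num.min t0 (2 * pi - t0)).
have d0 : 0 < delta.
  by rewrite !lt_min t00 subr_gt0 t02 divr_gt0// divr_gt0.
have d1 : delta <= r / 2 / L by rewrite /delta ge_min lexx.
have d2 : delta <= t0 by rewrite /delta !ge_min lexx !orbT.
have d3 : delta <= 2 * pi - t0 by rewrite /delta !ge_min lexx !orbT.
have dpi : delta <= pi by have [h|h] := leP t0 pi; lra.
pose e := (1 - cos delta) / 2.
have e0 : 0 < e.
  have dI : delta \in `[0, pi]%R by rewrite in_itv /= (ltW d0).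
  have zI : 0 \in `[0, pi : R]%R by rewrite in_itv /= lexx ltW.
  by rewrite divr_gt0// subr_gt0 -[ltRHS]cos0 ltr_cos.
have K1 : 0 <= (K0 + r / 2) / e by rewrite divr_ge0 ?(ltW e0)//; lra.
have wle t : 0 <= 1 - hump t0 t.
  by rewrite /hump; have := cos_le1 (t - t0); lra.
exists (r / 2), ((K0 + r / 2) / e); split => //; first by lra.
move=> t /andP[ht0 ht1].
have [s1|s1] := leP `|t - t0| delta.
  rewrite (@le_trans _ _ (r / 2))//; first by rewrite gerBl mulr_ge0.
  have h : `|r - complex.Re (g t)| <= L * delta.
    rewrite /r -ReB (le_trans (normc_Re _))// (le_trans (hL _ _))// /dist1 distrC.
    by rewrite ler_pM// /L; lra.
  have h2 : L * delta <= r / 2 by rewrite mulrC -ler_pdivlMr.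
  by move: h; rewrite ler_norml => /andP[_ h]; lra.
have s2 : `|t - t0| <= 2 * pi - delta by rewrite ler_norml; apply/andP; split; lra.
have hc : cos (t - t0) <= cos delta by apply: cos_le_away; rewrite ?d0 ?(ltW s1).
have he : e <= 1 - hump t0 t by rewrite /e /hump; lra.
have h1 : K0 + r / 2 <= (K0 + r / 2) / e * (1 - hump t0 t).
  rewrite -mulrA ler_peMr//; first by lra.
  by rewrite mulrC ler_pdivlMr// mul1r.
have := le_trans (normc_Re _) (hK0 t); rewrite ler_norml => /andP[h2 _]; lra.
Qed.

(** The powers of [hump] are trigonometric polynomials, so the integral of [hump ^ N] against the
    real part of [g] vanishes. If that part were positive at [t0], the lower bound
    [c - K * (1 - hump)] and the recurrence would bound the integral below by
    [(c - K / (2N+2)) * hump_int N], which is positive once N exceeds K/c. *)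
Lemma null_coefficients_Re g t0 : bl1 g -> null_coefficients g ->
  0 < t0 < 2 * pi -> complex.Re (g t0) <= 0.
Proof.
move=> hg h0 ht0; rewrite leNgt; apply/negP => r0.
have [c [K [c0 K0 hc]]] := hump_lower_bound hg ht0 r0.
pose N := Num.bound (K / c).
have hN : K / c < N%:R by apply: archi_boundP; rewrite divr_ge0// ltW.
have [hb hb0] := null_coefficients_humpX t0 N hg h0.
have {hb0} : rint (fun t => hump t0 t ^+ N * complex.Re (g t)) = 0.
  have := hb0 0; under eq_fun do rewrite mul0r expi0 mul1r.
  move/(congr1 (@complex.Re R)) => /=; under eq_fun do rewrite ReM mul0r subr0.
  by [].
have c1 k (a : R) : continuous (fun t => a * hump t0 t ^+ k).
  by move=> t; apply: cvgM; [exact: cvg_cst|exact: continuous_humpX].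
have c2 : continuous (fun t => hump t0 t ^+ N * complex.Re (g t)).
  move=> t; apply: cvgM; first exact: continuous_humpX.
  exact: (bl_continuous_Re hg).
pose f t := (c - K) * hump t0 t ^+ N + K * hump t0 t ^+ N.+1.
have cf : continuous f by move=> t; apply: cvgD; exact: c1.
have fle : rint f <= rint (fun t => hump t0 t ^+ N * complex.Re (g t)).
  apply: rint_le cf c2 _ => t ht; rewrite /f exprS.
  have -> : (c - K) * hump t0 t ^+ N + K * (hump t0 t * hump t0 t ^+ N) =
    hump t0 t ^+ N * (c - K * (1 - hump t0 t)) by ring.
  by rewrite ler_wpM2l ?exprn_ge0 ?hump_ge0 ?hc.
have ef : rint f = (c - K) * hump_int t0 N + K * hump_int t0 N.+1.
  by rewrite rintD ?rintZ//; try exact: c1; exact: continuous_humpX.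
move=> h; move: fle; rewrite h ef => h1.
have i0 := hump_int_gt0 t0 N; have rec := hump_intS t0 N.
have : ((2 * N%:R + 2) * c - K) * hump_int t0 N <= 0.
  have -> : ((2 * N%:R + 2) * c - K) * hump_int t0 N = (2 * N%:R + 2) *
     ((c - K) * hump_int t0 N + K * hump_int t0 N.+1).
    rewrite mulrDr [X in _ = _ + X]mulrCA rec; ring.
  by rewrite pmulr_rle0// ltr_wpDl// mulr_ge0.
rewrite pmulr_lle0// subr_le0 => h2.
rewrite ltr_pdivrMr// in hN.
have : 0 <= (N%:R + 2) * c by rewrite mulr_ge0// ?addr_ge0// ltW.
move: h2 hN; rewrite !mulrDl -!mulrA; set x := N%:R * c; lra.
Qed.

Lemma periodic_int g : (forall t, g (t + 2 * pi) = g t) ->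
  forall (k : int) t, g (t + k%:~R * (2 * pi)) = g t.
Proof.
move=> hp; have h n t : g (t + n%:R * (2 * pi)) = g t.
  elim: n => [|n ih]; first by rewrite mul0r addr0.
  by rewrite -natr1 mulrDl mul1r addrA hp.
case=> n t; first exact: h.
by rewrite -(h n.+1) NegzE mulrNz -pmulrn mulNr addrNK.
Qed.

(** The sign statement applied to the multiples of [g] by 1, -1, i and -i gives zero on the open
    interval; the endpoint follows from Lipschitz continuity and the rest from periodicity. *)
Lemma fourier_unique1 g : bl1 g -> (forall t, g (t + 2 * pi) = g t) ->
  null_coefficients g -> forall t, g t = 0.
Proof.
move=> hg hp h0.
have p0 := @pi2_gt0 R; have p1 := @pi_gt0 R.
have hle a t : 0 < t < 2 * pi -> complex.Re (a * g t) <= 0.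
  move=> ht; apply: (@null_coefficients_Re (fun t => a * g t)) => //.
    by apply: bl_Z hg => *; exact: dist1_ge0.
  move=> k; under eq_fun do rewrite mulrCA.
  by rewrite cintZ ?h0 ?mulr0//; exact: bl_expiM.
have hin t : 0 < t < 2 * pi -> g t = 0.
  move=> ht; have := hle 1 t ht; have := hle (-1) t ht.
  have := hle 'i%C t ht; have := hle (- 'i%C) t ht.
  case: (g t) => a b; rewrite !ReM /= !(mul0r, mul1r, oppr0, mulN1r, subr0, sub0r).
  move=> *; apply/eqP; rewrite eq_complex /=; apply/andP; split; apply/eqP; lra.
have hz : g 0 = 0.
  apply/eqP; rewrite -normc_eq0 eq_le normc_ge0 andbT leNgt; apply/negP => e0.
  have [K hK hL] := hg; have K0 := bl_ge0 0 hK.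
  pose s := Num.min pi (normc (g 0) / (K + 1) / 2).
  have K1 : 0 < K + 1 by lra.
  have s0 : 0 < s by rewrite lt_min p1 !divr_gt0.
  have s2 : s <= pi by rewrite ge_min lexx.
  have s3 : s <= normc (g 0) / (K + 1) / 2 by rewrite ge_min lexx orbT.
  have := hL 0 s; rewrite (hin s); last by rewrite s0 /=; lra.
  rewrite subr0 /dist1 sub0r normrN gtr0_norm// => h.
  have : (K + 1) * s <= normc (g 0) / 2.
    rewrite (le_trans (ler_wpM2l (ltW K1) s3))//.
    by have -> : (K + 1) * (normc (g 0) / (K + 1) / 2) = normc (g 0) / 2; [field; lra|].
  by rewrite mulrDl mul1r; lra.
move=> t; pose k := Num.floor (t / (2 * pi)).
have hk := floor_itv (t / (2 * pi)); rewrite -/k in hk.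
have -> : t = (t - k%:~R * (2 * pi)) + k%:~R * (2 * pi) by rewrite subrK.
rewrite periodic_int//; set s := t - _.
have /andP[h1 h2] : 0 <= s < 2 * pi.
  move: hk; rewrite ler_pdivlMr// ltr_pdivrMr// rmorphD /= mulrDl mul1r => /andP[? ?].
  by rewrite /s; apply/andP; split; lra.
move: h1; rewrite le_eqVlt => /orP[/eqP <-//|h1].
by apply: hin; rewrite h1 h2.
Qed.

End VanishingCoefficients.

(** * Iterated integrals and uniqueness of coefficients on the torus *)

Section TorusIntegral.
Variable R : realType.
Local Notation bl1 := (bounded_lipschitz (@dist1 R)).
Local Notation fct k := ('rV[R]_k -> R[i]).

(** This distance is additive under [cons_rv], so slices and partial integrals inherit Lipschitz
    bounds with explicit constants. *)
Definition l1dist k (x y : 'rV[R]_k) := \sum_i `|x 0 i - y 0 i|.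

Lemma l1dist_ge0 k (x y : 'rV[R]_k) : 0 <= l1dist x y.
Proof. exact: sumr_ge0. Qed.

Local Notation bln := (bounded_lipschitz (@l1dist _)).

Definition cons_rv k (t : R) (y : 'rV[R]_k) : 'rV[R]_k.+1 :=
  row_mx (const_mx t : 'rV[R]_1) y : 'rV[R]_(1 + k).

Lemma torus_intS k (f : fct k.+1) :
  torus_int f = cint (fun t => torus_int (fun y => f (cons_rv t y))).
Proof. by []. Qed.

Lemma sum_cons_rv (A : Type) (V : nmodType) (G : R -> A -> V) k t y (z : 'I_k.+1 -> A) :
  \sum_i G (cons_rv t y 0 i) (z i) =
  G t (z 0) + \sum_i G (y 0 i) (z (rshift 1 i)).
Proof.
rewrite (@big_split_ord _ _ _ 1 k) big_ord1 /=; congr (_ + _).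
  congr (G _ (z _)); last exact/val_inj.
  by rewrite /cons_rv (@row_mxEl _ 1 1 k) mxE.
by apply: eq_bigr => i _; rewrite /cons_rv (@row_mxEr _ 1 1 k).
Qed.

Lemma ord_consP k (i : 'I_k.+1) : i = 0 \/ exists j : 'I_k, i = rshift 1 j.
Proof.
case: (@split_ordP 1 k i) => j ->; last by right; exists j.
by left; apply/val_inj; rewrite /= ord1.
Qed.

Lemma cons_rv0 k t (y : 'rV[R]_k) : cons_rv t y 0 0 = t.
Proof.
have -> : (0 : 'I_k.+1) = lshift k (0 : 'I_1) by exact/val_inj.
by rewrite /cons_rv (@row_mxEl _ 1 1 k) mxE.
Qed.

Lemma cons_rvS k t (y : 'rV[R]_k) i : cons_rv t y 0 (rshift 1 i) = y 0 i.
Proof. by rewrite /cons_rv (@row_mxEr _ 1 1 k). Qed.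

Lemma l1dist_cons k t s (y y' : 'rV[R]_k) :
  l1dist (cons_rv t y) (cons_rv s y') = `|t - s| + l1dist y y'.
Proof.
rewrite /l1dist (@sum_cons_rv R _ (fun a b => `|a - b|) k t y (cons_rv s y' 0)).
by rewrite cons_rv0; congr (_ + _); apply: eq_bigr => i _; rewrite cons_rvS.
Qed.

Lemma l1dist_cons_l k t s (y : 'rV[R]_k) :
  l1dist (cons_rv t y) (cons_rv s y) = `|t - s|.
Proof.
by rewrite l1dist_cons /l1dist big1 ?addr0// => i _; rewrite subrr normr0.
Qed.

Lemma bl_slice k (f : fct k.+1) t : bln f -> bln (fun y => f (cons_rv t y)).
Proof.
move=> [K hK hL]; exists K => [//|x y].
by rewrite (le_trans (hL _ _))// l1dist_cons subrr normr0 add0r.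
Qed.

Definition torus_const k : R := (4 * pi) ^+ k.

Lemma torus_const_ge0 k : 0 <= torus_const k.
Proof. by rewrite exprn_ge0// mulr_ge0// pi_ge0. Qed.

Definition torus_int_linear k := forall a b (f g : fct k), bln f -> bln g ->
  torus_int (fun x => a * f x + b * g x) = a * torus_int f + b * torus_int g.

Definition torus_int_bounded k := forall (f : fct k) K, bln f ->
  (forall x, normc (f x) <= K) -> normc (torus_int f) <= torus_const k * K.

Lemma bl_slices k (f : fct k.+1) : torus_int_linear k -> torus_int_bounded k ->
  bln f -> bl1 (fun t => torus_int (fun y => f (cons_rv t y))).
Proof.
move=> lin bd hf; have [K hK hL] := hf; exists (torus_const k * K) => [t|s t].
  by apply: bd => //; exact: bl_slice.
have hs u := bl_slice u hf.
have -> : torus_int (fun y => f (cons_rv s y)) - torus_int (fun y => f (cons_rv t y)) =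
    torus_int (fun y => 1 * f (cons_rv s y) + -1 * f (cons_rv t y)).
  by rewrite lin// mul1r mulN1r.
rewrite -mulrA bd//; first by apply: bl_lin => //; exact: l1dist_ge0.
by move=> y; rewrite mul1r mulN1r -[dist1 s t](l1dist_cons_l s t y).
Qed.

(** The two properties have to be proved together: the inner integral must be Lipschitz in the outer
    variable before it can be integrated, and this uses both of them one dimension lower. *)
Lemma torus_int_linear_bounded k : torus_int_linear k /\ torus_int_bounded k.
Proof.
elim: k => [|k [lin bd]].
  have e (f : fct 0) : torus_int f = f 0.
    by rewrite /torus_int /= /fRe /fIm; case: (f 0).
  split; first by move=> *; rewrite !e.
  by move=> f K _ hK; rewrite e /torus_const expr0 mul1r.
split.
  move=> a b f g hf hg; rewrite !torus_intS -cint_lin; try exact: bl_slices.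
  by congr cint; apply/funext => t; rewrite lin//; exact: bl_slice.
move=> f K hf hK; rewrite torus_intS /torus_const exprS -mulrA.
apply: cint_le; first exact: bl_slices.
by move=> t; apply: bd => //; exact: bl_slice.
Qed.

Section Dimension.
Variable k : nat.
Implicit Types f g : fct k.

Lemma torus_int_lin a b f g : bln f -> bln g ->
  torus_int (fun x => a * f x + b * g x) = a * torus_int f + b * torus_int g.
Proof. by case: (torus_int_linear_bounded k) => + _; apply. Qed.

Lemma torus_int_le f K : bln f -> (forall x, normc (f x) <= K) ->
  normc (torus_int f) <= torus_const k * K.
Proof. by case: (torus_int_linear_bounded k) => _; apply. Qed.

Lemma bl_torus_slice (f : fct k.+1) : bln f ->
  bl1 (fun t => torus_int (fun y => f (cons_rv t y))).
Proof. by case: (torus_int_linear_bounded k) => *; exact: bl_slices. Qed.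

Lemma torus_intZ a f : bln f -> torus_int (fun x => a * f x) = a * torus_int f.
Proof.
move=> hf; have := torus_int_lin a 0 hf hf; rewrite mul0r addr0 => <-.
by congr torus_int; apply/funext => x; rewrite mul0r addr0.
Qed.

Lemma torus_int0 : torus_int (fun _ : 'rV[R]_k => 0) = 0.
Proof.
have h : bln (fun _ : 'rV[R]_k => 0 : R[i]) by apply: bl_cst; exact: l1dist_ge0.
transitivity (0 * torus_int (fun _ : 'rV[R]_k => 0 : R[i])); last by rewrite mul0r.
rewrite -torus_intZ//.
by congr torus_int; apply/funext => x; rewrite mul0r.
Qed.

End Dimension.

Lemma torus_int_conj k (f : fct k) : bln f ->
  torus_int (fun x => conjc (f x)) = conjc (torus_int f).
Proof.
elim: k f => [|k ih] f hf; first by rewrite /torus_int /= /fRe /fIm; case: (f 0).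
rewrite !torus_intS -cint_conj; last exact: bl_torus_slice.
by congr cint; apply/funext => t; rewrite ih//; exact: bl_slice.
Qed.

Lemma torus_int1 k : torus_int (fun _ : 'rV[R]_k => 1) = ((2 * pi) ^+ k)%:C%C.
Proof.
elim: k => [|k ih]; first by rewrite /torus_int /= /fRe /fIm /= expr0.
rewrite torus_intS ih /cint /= !rint_cst mul0r exprSr.
by apply/eqP; rewrite eq_complex /= !eqxx.
Qed.

Lemma cons_rv_eq k (x : 'rV[R]_k.+1) t (y : 'rV[R]_k) :
  x 0 0 = t -> (forall j, x 0 (rshift 1 j) = y 0 j) -> x = cons_rv t y.
Proof.
move=> h0 hS; apply/rowP => i.
by case: (ord_consP i) => [->|[j ->]]; rewrite ?cons_rv0 ?cons_rvS.
Qed.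

Lemma cons_rvD k t s (y z : 'rV[R]_k) :
  cons_rv t y + cons_rv s z = cons_rv (t + s) (y + z).
Proof.
by apply: cons_rv_eq => [|j]; rewrite mxE ?cons_rv0 ?cons_rvS ?mxE.
Qed.

Lemma delta_mx_cons0 k : delta_mx 0 0 = cons_rv 1 (0 : 'rV[R]_k).
Proof. by apply: cons_rv_eq => [|j]; rewrite !mxE. Qed.

Lemma delta_mx_consS k (j : 'I_k) :
  delta_mx 0 (rshift 1 j) = cons_rv 0 (delta_mx 0 j : 'rV[R]_k).
Proof.
by apply: cons_rv_eq => [|l]; rewrite !mxE ?eqxx //= (inj_eq (@rshift_inj 1 k)).
Qed.

Lemma scale_cons_rv k s t (y : 'rV[R]_k) : s *: cons_rv t y = cons_rv (s * t) (s *: y).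
Proof. by apply: cons_rv_eq => [|j]; rewrite mxE ?cons_rv0 ?cons_rvS ?mxE. Qed.

Lemma cons_rv_split k (x : 'rV[R]_k.+1) : exists t y, x = cons_rv t y.
Proof.
exists (x 0 0), (\row_i x 0 (rshift 1 i)).
by apply: cons_rv_eq => // j; rewrite mxE.
Qed.

(* The derivative in the first variable integrates to zero by the fundamental
   theorem of calculus, the others already do so in the inner integral. *)
Lemma torus_int_derive k (i : 'I_k) (f f' : fct k) :
  quad_derivative (delta_mx 0 i) f f' -> Defs.periodic f -> bln f -> bln f' ->
  torus_int f' = 0.
Proof.
elim: k i f f' => [[]//|k ih] i f f' [K hK] pf hf hf'.
rewrite torus_intS.
case: (ord_consP i) hK => [->|[j ->]] hK; last first.
  rewrite -[RHS]cint0; congr cint; apply/funext => t.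
  apply: (ih j (fun y => f (cons_rv t y))); [|move=> y l|exact: bl_slice|exact: bl_slice].
    exists K => x s; have := hK (cons_rv t x) s.
    by rewrite delta_mx_consS scale_cons_rv mulr0 cons_rvD addr0.
  have := pf (cons_rv t y) (rshift 1 l).
  by rewrite delta_mx_consS scale_cons_rv mulr0 cons_rvD addr0.
pose F (g : fct k.+1) t := torus_int (fun y => g (cons_rv t y)).
apply: (@cint_derive _ (F f)); last 2 first.
- exact: bl_torus_slice.
- congr torus_int; apply/funext => y; rewrite -(pf (cons_rv 0 y) 0).
  by rewrite delta_mx_cons0 scale_cons_rv mulr1 scaler0 cons_rvD add0r addr0.
exists (torus_const k * K) => t s.
have hs u := bl_slice u hf; have hs' u := bl_slice u hf'.
have l0 := @l1dist_ge0 k.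
have -> : F f (t + s *: (1 : R)) - F f t - s%:C%C * F f' t = torus_int (fun y =>
    1 * (1 * f (cons_rv (t + s) y) + -1 * f (cons_rv t y)) +
    (- s%:C%C) * f' (cons_rv t y)).
  rewrite !torus_int_lin//; last exact: bl_lin.
  by rewrite /F !mul1r mulN1r mulNr /GRing.scale /= mulr1.
rewrite -mulrA torus_int_le//; first by apply: bl_lin => //; exact: bl_lin.
move=> y; have := hK (cons_rv t y) s.
by rewrite delta_mx_cons0 scale_cons_rv mulr1 scaler0 cons_rvD addr0 !mul1r mulN1r mulNr.
Qed.

Definition dot k (xi : 'rV[int]_k) (x : 'rV[R]_k) : R :=
  \sum_i (xi 0 i)%:~R * x 0 i.

Definition character k (xi : 'rV[int]_k) : fct k := fun x => expi (dot xi x).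

Lemma bl_character k (xi : 'rV[int]_k) : bln (character xi).
Proof.
have S0 : 0 <= \sum_i `|(xi 0 i)%:~R : R| by exact: sumr_ge0.
exists (1 + 2 * \sum_i `|(xi 0 i)%:~R|) => [x|x y].
  by rewrite normc_expi lerDl mulr_ge0.
rewrite (le_trans (normc_expiB _ _))// (@le_trans _ _
    (2 * ((\sum_i `|(xi 0 i)%:~R : R|) * l1dist x y)))//; last first.
  by rewrite mulrA ler_wpM2r ?l1dist_ge0// lerDr.
rewrite ler_pM2l// /dot -sumrB (le_trans (ler_norm_sum _ _ _))// mulr_suml.
apply: ler_sum => i _; rewrite -mulrBr normrM ler_wpM2l//.
by rewrite /l1dist (bigD1 i)//= lerDl sumr_ge0.
Qed.

Lemma bl_characterM k (xi : 'rV[int]_k) f : bln f -> bln (fun x => character xi x * f x).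
Proof. by apply: bl_M (bl_character xi); exact: l1dist_ge0. Qed.

(* Applying the one-dimensional result to the partial Fourier coefficients in
   the remaining variables avoids any use of Fubini's theorem. *)
Lemma fourier_unique k (f : fct k) : bln f -> Defs.periodic f ->
  (forall xi, torus_int (fun x => character xi x * f x) = 0) -> forall x, f x = 0.
Proof.
elim: k f => [|k ih] f hf pf h0 x.
  have := h0 0; rewrite /character /dot; under eq_fun do rewrite big_ord0 expi0 mul1r.
  rewrite (thinmx0 x) /torus_int /= /fRe /fIm.
  by case: (f 0) => a b /=.
have [t [y ->]] := cons_rv_split x.
apply: (ih (fun y => f (cons_rv t y))); first exact: bl_slice.
  move=> z l; have := pf (cons_rv t z) (rshift 1 l).
  by rewrite delta_mx_consS scale_cons_rv mulr0 cons_rvD addr0.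
move=> eta {x y}; move: t.
have hc t : bln (fun y => character eta y * f (cons_rv t y)).
  by apply: bl_characterM; exact: bl_slice.
have e (m : int) t y : character (row_mx (const_mx m) eta : 'rV[int]_(1 + k)) (cons_rv t y) =
    expi (m%:~R * t) * character eta y.
  rewrite /character /dot -expiD; congr expi.
  rewrite (@sum_cons_rv _ _ (fun a b => b%:~R * a)).
  have -> : (0 : 'I_k.+1) = lshift k (0 : 'I_1) by exact/val_inj.
  rewrite (@row_mxEl _ 1 1 k) mxE; congr (_ + _); apply: eq_bigr => i _.
  by rewrite (@row_mxEr _ 1 1 k).
have cm t y : character eta y =
    character (row_mx (const_mx 0) eta : 'rV[int]_(1 + k)) (cons_rv t y).
  by rewrite e mul0r expi0 mul1r.
apply: fourier_unique1.
- have := bl_torus_slice (bl_characterM (row_mx (const_mx 0) eta : 'rV[int]_(1 + k)) hf).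
  by under eq_fun do under eq_fun do rewrite -cm.
- move=> t; congr torus_int; apply/funext => y; congr (_ * _).
  rewrite -(pf (cons_rv t y) 0).
  by rewrite delta_mx_cons0 scale_cons_rv mulr1 scaler0 cons_rvD addr0.
move=> m; rewrite -[RHS](h0 (row_mx (const_mx m) eta : 'rV[int]_(1 + k))).
rewrite torus_intS; congr cint; apply/funext => t; rewrite -torus_intZ//.
by congr torus_int; apply/funext => y; rewrite e mulrA.
Qed.

End TorusIntegral.

(** * Fourier series *)

Section FrequencySums.
Variables (R : realType) (n : nat).
Local Notation freq := 'rV[int]_n.
Implicit Types (xi : freq) (a b : freq -> R[i]) (N : nat).

Definition freq_size xi : nat := (\max_i absz (xi ord0 i))%N.

Definition box_point N (f : {ffun 'I_n -> 'I_N.*2.+1}) : freq :=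
  \row_i ((f i)%:Z - N%:Z).

Definition box N : seq freq := [seq box_point f | f : {ffun 'I_n -> 'I_N.*2.+1}].

Lemma box_point_inj N : injective (@box_point N).
Proof.
move=> f g /rowP e; apply/ffunP => i; have := e i; rewrite !mxE => /addIr [].
exact: val_inj.
Qed.

Lemma box_uniq N : uniq (box N).
Proof. by rewrite map_inj_uniq ?enum_uniq//; exact: box_point_inj. Qed.

Lemma mem_box N xi : (xi \in box N) = (freq_size xi <= N)%N.
Proof.
apply/idP/bigmax_leqP => [/fintype.imageP[f _ ->] i _|h].
  by rewrite mxE; have := ltn_ord (f i); move: (nat_of_ord (f i)) => k; lia.
apply/fintype.imageP; exists [ffun i => inord (absz (xi 0 i + N%:Z))] => //.
apply/rowP => i; have hi : (absz (xi ord0 i) <= N)%N := h i isT.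
by rewrite mxE ffunE inordK; move: (xi 0 i) hi => k; lia.
Qed.

Lemma freq_size_ge xi i : (absz (xi ord0 i) <= freq_size xi)%N.
Proof. exact: (@leq_bigmax _ (fun i => absz (xi ord0 i))). Qed.

Lemma freq_sizeN xi : freq_size (- xi) = freq_size xi.
Proof. by apply: eq_bigr => i _; rewrite mxE abszN. Qed.

(** The common majorant of all series over frequencies. Its product form makes a sum over a box the
    n-th power of a one-dimensional sum. *)
Definition weight xi : R := \prod_i (1 + (xi 0 i)%:~R ^+ 2)^-1.

Lemma freq_weight_gt0 xi : 0 < weight xi.
Proof. by apply: prodr_gt0 => i _; rewrite invr_gt0 ltr_pwDl// sqr_ge0. Qed.

Lemma weight_ge0 xi : 0 <= weight xi.
Proof. exact: ltW (freq_weight_gt0 _). Qed.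

Lemma weight_neg xi : weight (- xi) = weight xi.
Proof. by apply: eq_bigr => i _; rewrite mxE mulrNz sqrrN. Qed.

Definition psum (V : nmodType) N (a : freq -> V) : V := \sum_(xi <- box N) a xi.

Lemma psum_split (V : zmodType) N M (a : freq -> V) : (N <= M)%N ->
  psum M a - psum N a = \sum_(xi <- box M | (N < freq_size xi)%N) a xi.
Proof.
move=> NM; rewrite /psum (bigID (fun xi => (N < freq_size xi)%N)) /=.
suff -> : \sum_(xi <- box M | ~~ (N < freq_size xi)%N) a xi = \sum_(xi <- box N) a xi.
  by rewrite addrK.
rewrite -big_filter; apply: perm_big; apply: uniq_perm.
- by rewrite filter_uniq ?box_uniq.
- exact: box_uniq.
move=> xi.
by rewrite mem_filter !mem_box -leqNgt; lia.
Qed.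

Lemma psum_neg (V : nmodType) N (a : freq -> V) : psum N (fun xi => a (- xi)) = psum N a.
Proof.
rewrite /psum -[LHS](big_map (fun xi => - xi) xpredT a); apply: perm_big.
apply: uniq_perm; first by rewrite map_inj_uniq ?box_uniq//; exact: oppr_inj.
  exact: box_uniq.
move=> xi; rewrite -[xi in LHS]opprK mem_map; last exact: oppr_inj.
by rewrite !mem_box freq_sizeN.
Qed.

Lemma psum_weight_le N : psum N weight <= 5 ^+ n.
Proof.
rewrite /psum /box big_image /=.
rewrite (eq_bigr (fun f : {ffun 'I_n -> 'I_N.*2.+1} =>
   \prod_i (1 + ((f i)%:Z - N%:Z)%:~R ^+ 2 : R)^-1)); last first.
  by move=> f _; apply: eq_bigr => i _; rewrite mxE.
rewrite -(bigA_distr_bigA (fun (i : 'I_n) (j : 'I_N.*2.+1) => (1 + (j%:Z - N%:Z)%:~R ^+ 2 : R)^-1)).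
rewrite prodr_const card_ord; set s := \sum_(j < _) _.
have g0 (x : R) : 0 < 1 + x ^+ 2 by rewrite ltr_pwDl// sqr_ge0.
(* A telescoping bound: passing from N to N+1 adds two terms 1/(1+x^2) with x = N+1, each at most
   2/x - 2/(x+1). The constant 5 makes it an equality for N = 0. *)
suff : s <= 5 - 4 / N.+1%:R.
  move=> h; apply: lerXn2r; rewrite ?nnegrE.
  - by apply: sumr_ge0 => i _; rewrite invr_ge0 ltW.
  - by [].
  - by rewrite (le_trans h)// gerBl divr_ge0.
rewrite {}/s; elim: N => [|N ih].
  by rewrite big_ord1 /= subrr expr0n addr0 invr1; lra.
rewrite doubleS big_ord_recl big_ord_recr /=.
rewrite (eq_bigr (fun j : 'I_N.*2.+1 => (1 + (j%:Z - N%:Z)%:~R ^+ 2 : R)^-1)); last first.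
  move=> j _; rewrite (_ : (bump 0 j)%:Z - N.+1%:Z = j%:Z - N%:Z)//.
  by rewrite /= /bump; move: (nat_of_ord j) => l; lia.
have -> : ((0%:Z - N.+1%:Z)%:~R : R) = - N.+1%:R by rewrite sub0r mulrNz.
have -> : (((bump 0 N.*2.+1)%:Z - N.+1%:Z)%:~R : R) = N.+1%:R.
  by rewrite [X in X%:~R](_ : _ = N.+1%:Z)//; rewrite /bump; lia.
rewrite sqrrN; set x : R := N.+1%:R; have x1 : 1 <= x by rewrite ler1n.
have -> : N.+2%:R = x + 1 :> R by rewrite -natr1.
have h1 : (1 + x ^+ 2)^-1 <= 2 / x - 2 / (x + 1).
  have -> : 2 / x - 2 / (x + 1) = (x * (x + 1) / 2)^-1 by field; lra.
  by rewrite lef_pV2 ?posrE ?g0//; [nra|rewrite divr_gt0// mulr_gt0; lra].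
move: ih h1; rewrite -/x; set S := \sum_(j < _) _; set v := _^-1; set p := x^-1.
set q := (x + 1)^-1; lra.
Qed.

Lemma psum_weight_cvg : cvgn (fun N => psum N weight).
Proof.
apply: nondecreasing_is_cvgn; last by exists (5 ^+ n) => _ [N _ <-]; exact: psum_weight_le.
move=> N M NM; rewrite -subr_ge0 psum_split//.
by apply: sumr_ge0 => xi _; exact: weight_ge0.
Qed.

(* The factor 2 accounts for the real and imaginary parts in [csum_approx]. *)
Definition tail N : R := 2 * (limn (fun N => psum N weight) - psum N weight).

Lemma psum_weight_le_lim N : psum N weight <= limn (fun N => psum N weight).
Proof.
apply: (nondecreasing_cvgn_le (u_ := fun N => psum N weight)) psum_weight_cvg N.
move=> N M NM; rewrite -subr_ge0 psum_split//.
by apply: sumr_ge0 => xi _; exact: weight_ge0.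
Qed.

Lemma tail_ge0 N : 0 <= tail N.
Proof. by rewrite mulr_ge0// subr_ge0 psum_weight_le_lim. Qed.

Lemma tail_small e : 0 < e -> exists N0, forall N, (N0 <= N)%N -> tail N <= e.
Proof.
move=> e0; have /cvgrPdist_le /(_ (e / 2)) := psum_weight_cvg.
rewrite divr_gt0// => /(_ isT) [N0 _ h]; exists N0 => N hN.
have := h N hN; rewrite ger0_norm ?subr_ge0 ?psum_weight_le_lim//.
by rewrite /tail; lra.
Qed.

Definition csum a : R[i] :=
  Complex (limn (fun N => complex.Re (psum N a))) (limn (fun N => complex.Im (psum N a))).

Definition weight_bounded (C : R) a := forall xi, normc (a xi) <= C * weight xi.

Lemma weight_bounded_ge0 C a : weight_bounded C a -> 0 <= C.
Proof.
move=> /(_ 0) h; have := le_trans (normc_ge0 _) h.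
by rewrite pmulr_lge0// freq_weight_gt0.
Qed.

Lemma psum_diff_le C a N M : weight_bounded C a -> (N <= M)%N ->
  normc (psum M a - psum N a) <= C * (psum M weight - psum N weight).
Proof.
move=> ha NM; rewrite !psum_split// (le_trans (normc_sum _ _ _))// mulr_sumr.
exact: ler_sum.
Qed.

(** Adding [C * psum N weight] turns [u] into a nondecreasing bounded sequence, so both summands of
    the difference that recovers [u] converge. *)
Lemma lim_dominated (C : R) (u : nat -> R) :
  (forall N M, (N <= M)%N -> `|u M - u N| <= C * (psum M weight - psum N weight)) ->
  0 <= C ->
  forall N, `|limn u - u N| <= C * (limn (fun N => psum N weight) - psum N weight).
Proof.
move=> h C0; pose w N := psum N weight.
have cw : cvgn (fun N => C * w N) by apply: is_cvgMr; exact: psum_weight_cvg.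
have c1 : cvgn (fun N => u N + C * w N).
  apply: nondecreasing_is_cvgn.
    move=> N M NM; have := h N M NM; rewrite ler_norml => /andP[+ _].
    by rewrite /w; lra.
  exists (`|u 0%N| + C * (5 ^+ n) + C * (5 ^+ n)) => _ [N _ <-].
  have h0 := h 0%N N (leq0n N).
  have h1 : C * w N <= C * 5 ^+ n by rewrite ler_wpM2l// psum_weight_le.
  have h2 : 0 <= C * w 0%N.
    by rewrite mulr_ge0// /w /psum sumr_ge0// => xi _; exact: weight_ge0.
  move: h0; rewrite ler_norml => /andP[_ h0].
  have := ler_norm (u 0%N); move: h0; rewrite -/(w N) -/(w 0%N); lra.
have cu : cvgn u.
  have e : (fun N => u N + C * w N) - (fun N => C * w N) = u.
    by apply/funext => N; rewrite !fctE addrK.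
  by rewrite -e; exact: is_cvgB.
move=> N.
have cuN : `|u M - u N| @[M --> \oo] --> `|limn u - u N|.
  by apply: cvg_norm; apply: cvgB => //; exact: cvg_cst.
have cwN : C * (w M - w N) @[M --> \oo] --> C * (limn w - w N).
  apply: cvgMr; apply: cvgB; [exact: psum_weight_cvg|exact: cvg_cst].
rewrite -(cvg_lim _ cuN)// -(cvg_lim _ cwN)//.
apply: ler_lim; [by apply: cvgP cuN|by apply: cvgP cwN|].
by near=> M; apply: h; near: M; exact: nbhs_infty_ge.
Unshelve. all: by end_near. Qed.

Lemma csum_approx C a N : weight_bounded C a ->
  normc (csum a - psum N a) <= C * tail N.
Proof.
move=> ha; have C0 := weight_bounded_ge0 ha.
have -> : C * tail N = C * (limn (fun N => psum N weight) - psum N weight) +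
   C * (limn (fun N => psum N weight) - psum N weight) by rewrite /tail; ring.
rewrite (le_trans (normc_le_ReIm _))// ReB ImB /= lerD//;
  apply: lim_dominated => // {}N M NM; rewrite -?ReB -?ImB;
  rewrite (le_trans _ (psum_diff_le ha NM))// ?normc_Re ?normc_Im//.
Qed.

(** The tool for identities about [csum]: linearity, conjugation, reflection and exchange with
    integrals hold exactly for box sums, and the error is a multiple of [tail], which tends to 0. *)
Lemma csum_unique C C' a (x : R[i]) N0 : weight_bounded C a ->
  (forall N, (N0 <= N)%N -> normc (x - psum N a) <= C' * tail N) -> x = csum a.
Proof.
move=> ha hx; apply/eqP; rewrite -subr_eq0 -normc_eq0 eq_le normc_ge0 andbT.
rewrite leNgt; apply/negP => e0; have C0 := weight_bounded_ge0 ha.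
set e := normc _ in e0; have D0 : 0 < C + `|C'| + 1 by rewrite ltr_wpDl// addr_ge0.
have [N1 h1] := tail_small (divr_gt0 (divr_gt0 e0 (ltr0Sn R 1)) D0).
have := h1 (maxn N0 N1) (leq_maxr _ _); set N := maxn _ _ => h2.
have := hx N (leq_maxl _ _) => h3; have h4 := csum_approx N ha.
have : e <= normc (x - psum N a) + normc (csum a - psum N a).
  by rewrite (le_trans _ (normcB _ _))// opprB addrA subrK.
have h5 : (C + `|C'| + 1) * tail N <= e / 2.
  by rewrite mulrC -ler_pdivlMr.
have h6 : C' * tail N <= `|C'| * tail N by rewrite ler_wpM2r ?tail_ge0 ?ler_norm.
have := tail_ge0 N; move: h5; rewrite !mulrDl mul1r; lra.
Qed.

Lemma weight_bounded_lin C D x y a b : weight_bounded C a -> weight_bounded D b ->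
  weight_bounded (normc x * C + normc y * D) (fun xi => x * a xi + y * b xi).
Proof.
move=> ha hb xi; rewrite (le_trans (normcD _ _))// !normcM mulrDl -!mulrA.
by rewrite lerD// ler_wpM2l ?normc_ge0.
Qed.

Lemma csum_lin C D x y a b : weight_bounded C a -> weight_bounded D b ->
  csum (fun xi => x * a xi + y * b xi) = x * csum a + y * csum b.
Proof.
move=> ha hb; apply/esym.
apply: (@csum_unique _ (normc x * C + normc y * D) _ _ 0%N (weight_bounded_lin x y ha hb)).
move=> N _; rewrite /psum big_split /= -!mulr_sumr -/(psum N a) -/(psum N b).
have -> : x * csum a + y * csum b - (x * psum N a + y * psum N b) =
  x * (csum a - psum N a) + y * (csum b - psum N b) by ring.
rewrite (le_trans (normcD _ _))// !normcM mulrDl -!mulrA.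
by rewrite lerD// ler_wpM2l ?normc_ge0// csum_approx.
Qed.

Lemma csumZ C x a : weight_bounded C a -> csum (fun xi => x * a xi) = x * csum a.
Proof.
move=> ha; have := csum_lin x 0 ha ha; rewrite mul0r addr0 => <-.
by congr csum; apply/funext => xi; rewrite mul0r addr0.
Qed.

Lemma csum_conj C a : weight_bounded C a ->
  csum (fun xi => conjc (a xi)) = conjc (csum a).
Proof.
move=> ha; apply/esym; apply: (@csum_unique C C _ _ 0%N).
  by move=> xi; rewrite normc_conj.
by move=> N _; rewrite /psum -rmorph_sum -rmorphB normc_conj csum_approx.
Qed.

Lemma csum_neg C a : weight_bounded C a -> csum (fun xi => a (- xi)) = csum a.
Proof.
move=> ha; apply/esym; apply: (@csum_unique C C _ _ 0%N).
  by move=> xi; rewrite -weight_neg.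
by move=> N _; rewrite psum_neg csum_approx.
Qed.

Lemma csum_single eta (x : R[i]) :
  csum (fun xi => if xi == eta then x else 0) = x.
Proof.
apply/esym; apply: (@csum_unique (normc x / weight eta) 0 _ _ (freq_size eta)).
  move=> xi; case: eqP => [->|_]; first by rewrite divfK// gt_eqF// freq_weight_gt0.
  by rewrite normc0 mulr_ge0 ?weight_ge0// divr_ge0 ?normc_ge0 ?weight_ge0.
move=> N hN; rewrite mul0r /psum (bigD1_seq eta) ?mem_box ?box_uniq//= eqxx.
by rewrite big1 ?addr0 ?subrr ?normc0// => xi /negbTE ->.
Qed.

Lemma csum_tail C a N : weight_bounded C a ->
  (forall xi, (freq_size xi <= N)%N -> a xi = 0) -> normc (csum a) <= C * tail N.
Proof.
move=> ha h0; have := csum_approx N ha; rewrite /psum big_seq big1 ?subr0//.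
by move=> xi; rewrite mem_box; exact: h0.
Qed.

Definition csum_const : R := psum 0 weight + tail 0.

Lemma csum_const_ge0 : 0 <= csum_const.
Proof.
by rewrite addr_ge0 ?tail_ge0// sumr_ge0// => xi _; exact: weight_ge0.
Qed.

Lemma csum_le C a : weight_bounded C a -> normc (csum a) <= C * csum_const.
Proof.
move=> ha; rewrite -[csum a](subrK (psum 0 a)) /csum_const mulrDr addrC.
rewrite [leRHS]addrC (le_trans (normcD _ _))// [leRHS]addrC lerD//; last exact: csum_approx.
by rewrite (le_trans (normc_sum _ _ _))// mulr_sumr; apply: ler_sum.
Qed.

End FrequencySums.

(** * Fourier coefficients and series of functions *)

Section FourierSeries.
Variables (R : realType) (n : nat).
Local Notation freq := 'rV[int]_n.
Local Notation fct := ('rV[R]_n -> R[i]).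
Local Notation bln := (bounded_lipschitz (@l1dist R n)).
Implicit Types (xi eta : freq) (a b : freq -> R[i]) (f g : fct) (x y : 'rV[R]_n).

Let d0 : forall x y : 'rV[R]_n, 0 <= l1dist x y := @l1dist_ge0 R n.

Definition coord xi i : R[i] := 'i%C * ((xi 0 i)%:~R : R)%:C%C.

Lemma normc_coord xi i : normc (coord xi i) <= (freq_size xi)%:R.
Proof.
rewrite normcM normc_i mul1r normc_real -intr_norm.
by rewrite -(pmulrn 1) ler_nat freq_size_ge.
Qed.

Lemma dotD xi x y : dot xi (x + y) = dot xi x + dot xi y.
Proof. by rewrite /dot -big_split; apply: eq_bigr => i _; rewrite mxE mulrDr. Qed.

Lemma dot_delta xi (s : R) i : dot xi (s *: delta_mx 0 i) = (xi 0 i)%:~R * s.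
Proof.
rewrite /dot (bigD1 i)//= big1 => [|j /negbTE ij]; rewrite !mxE ?eqxx ?ij /=.
  by rewrite mulr1 addr0.
by rewrite !mulr0.
Qed.

Lemma characterD xi eta x : character (xi + eta) x = character xi x * character eta x.
Proof.
rewrite /character -expiD; congr expi; rewrite /dot -big_split.
by apply: eq_bigr => i _; rewrite mxE rmorphD mulrDl.
Qed.

Lemma character0 x : character 0 x = 1.
Proof. by rewrite /character /dot big1 ?expi0// => i _; rewrite mxE mul0r. Qed.

Lemma normc_character xi x : normc (character xi x) = 1.
Proof. exact: normc_expi. Qed.

Lemma character_shift xi x s i :
  character xi (x + s *: delta_mx 0 i) = character xi x * expi ((xi 0 i)%:~R * s).
Proof. by rewrite /character dotD dot_delta expiD. Qed.

Lemma conjc_character xi x : conjc (character xi x) = character (- xi) x.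
Proof.
rewrite /character conjc_expi; congr expi; rewrite /dot -sumrN.
by apply: eq_bigr => i _; rewrite mxE mulrNz mulNr.
Qed.

Lemma periodic_character xi : Defs.periodic (character xi : fct).
Proof.
move=> x i; rewrite character_shift -[_ * (2 * pi)]add0r expi_period expi0.
by rewrite mulr1.
Qed.

Lemma character_lip xi x y :
  normc (character xi x - character xi y) <= 2 * (freq_size xi)%:R * l1dist x y.
Proof.
rewrite (le_trans (normc_expiB _ _))// -mulrA ler_pM2l//.
rewrite /dot -sumrB (le_trans (ler_norm_sum _ _ _))// mulr_sumr.
apply: ler_sum => i _; rewrite -mulrBr normrM ler_wpM2r//.
by rewrite -intr_norm -(pmulrn 1) ler_nat freq_size_ge.
Qed.

Lemma quad_expi (r s : R) :
  normc (expi (r * s) - 1 - s%:C%C * ('i%C * r%:C%C)) <= 2 * r ^+ 2 * s ^+ 2.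
Proof.
have -> : s%:C%C * ('i%C * r%:C%C) = 'i%C * (r * s)%:C%C :> R[i].
  by rewrite rmorphM /=; ring.
by rewrite (le_trans (expi_quad _))// exprMn mulrA.
Qed.

Lemma quad_characterM i f f' xi : quad_derivative (delta_mx 0 i) f f' ->
  bln f -> bln f' ->
  quad_derivative (delta_mx 0 i) (fun x => character xi x * f x)
    (fun x => character xi x * (f' x + coord xi i * f x)).
Proof.
move=> [K hK] [F hF _] [F' hF' _]; set r : R := (xi 0 i)%:~R.
exists (K + 2 * `|r| * F' + 2 * r ^+ 2 * F) => x s.
rewrite character_shift -/r; set e := expi _.
have -> : character xi x * e * f (x + s *: delta_mx 0 i) - character xi x * f x -
    s%:C%C * (character xi x * (f' x + coord xi i * f x)) =
  character xi x * (e * (f (x + s *: delta_mx 0 i) - f x - s%:C%C * f' x) +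
    (e - 1) * s%:C%C * f' x + (e - 1 - s%:C%C * ('i%C * r%:C%C)) * f x).
  by rewrite /coord; ring.
rewrite normcM normc_character mul1r (le_trans (normcD _ _))//.
rewrite [leRHS]mulrDl [X in _ <= X + _]mulrDl lerD//.
  rewrite (le_trans (normcD _ _))// lerD//; first by rewrite normcM normc_expi mul1r.
  have F0 := le_trans (normc_ge0 _) (hF' x).
  rewrite !normcM normc_real (@le_trans _ _ (2 * `|r * s| * `|s| * F'))//.
    rewrite ler_pM ?mulr_ge0 ?normc_ge0//.
    by rewrite ler_wpM2r// expi_lip.
  rewrite normrM -(@real_normK _ s) ?num_real//.
  by rewrite [leRHS](_ : _ = 2 * (`|r| * `|s|) * `|s| * F')//; ring.
rewrite normcM (@le_trans _ _ (2 * r ^+ 2 * s ^+ 2 * F))//; last first.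
  by rewrite mulrAC.
by rewrite ler_pM ?normc_ge0// quad_expi.
Qed.

Definition hat f xi : R[i] :=
  (((2 * pi) ^+ n)^-1)%:C%C * torus_int (fun x => character (- xi) x * f x).

Definition hat_const : R := ((2 * pi) ^+ n)^-1 * torus_const R n.

Lemma vol_gt0 : 0 < (2 * pi) ^+ n :> R.
Proof. by rewrite exprn_gt0// pi2_gt0. Qed.

Lemma hat_const_ge0 : 0 <= hat_const.
Proof. by rewrite mulr_ge0 ?torus_const_ge0// invr_ge0 ltW// vol_gt0. Qed.

Lemma hat_lin (u v : R[i]) f g xi : bln f -> bln g ->
  hat (fun t => u * f t + v * g t) xi = u * hat f xi + v * hat g xi.
Proof.
move=> hf hg; rewrite /hat; transitivity ((((2 * pi) ^+ n)^-1)%:C%C *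
   torus_int (fun t => u * (character (- xi) t * f t) + v * (character (- xi) t * g t))).
  by congr (_ * torus_int _); apply/funext => t; ring.
rewrite torus_int_lin; try exact: bl_characterM.
ring.
Qed.

Lemma hat_conj f xi : bln f -> hat (fun t => conjc (f t)) xi = conjc (hat f (- xi)).
Proof.
move=> hf; rewrite /hat conjcM conjc_real -torus_int_conj; last exact: bl_characterM.
congr (_ * torus_int _); apply/funext => t.
by rewrite conjcM conjc_character opprK.
Qed.

Lemma hat_le f K xi : bln f -> (forall x, normc (f x) <= K) ->
  normc (hat f xi) <= hat_const * K.
Proof.
move=> hf hK; rewrite normcM normc_real ger0_norm; last by rewrite invr_ge0 ltW// vol_gt0.
rewrite -mulrA ler_pM2l ?invr_gt0 ?vol_gt0// torus_int_le//.
  exact: bl_characterM.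
by move=> x; rewrite normcM normc_character mul1r.
Qed.

(** Integration by parts: the derivative of the periodic function [character (- xi) x * f x] has
    integral zero. *)
Lemma hat_quad i f f' xi : quad_derivative (delta_mx 0 i) f f' -> Defs.periodic f ->
  bln f -> bln f' -> hat f' xi = coord xi i * hat f xi.
Proof.
move=> hq hp hf hf'.
have := torus_int_derive (quad_characterM (- xi) hq hf hf') _ (bl_characterM _ hf).
have b : bln (fun x => character (- xi) x * (f' x + coord (- xi) i * f x)).
  by apply: bl_characterM; apply: bl_D hf' _; exact: bl_Z.
move=> /(_ _ b) h.
have {}h : torus_int (fun x => 1 * (character (- xi) x * f' x) +
   - coord xi i * (character (- xi) x * f x)) = 0.
  rewrite -[RHS]h; last by move=> x j; rewrite periodic_character hp.
  congr torus_int; apply/funext => x; rewrite /coord mxE mulrNz rmorphN /=; ring.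
move: h; rewrite torus_int_lin; try exact: bl_characterM.
rewrite mul1r mulNr => /eqP; rewrite subr_eq0 => /eqP h.
by rewrite /hat h; ring.
Qed.

Lemma hat_inj f g : bln f -> bln g -> Defs.periodic f -> Defs.periodic g ->
  (forall xi, hat f xi = hat g xi) -> f = g.
Proof.
move=> hf hg pf pg h; apply/funext => x.
have hz := @fourier_unique _ _ (fun t => 1 * f t + -1 * g t).
apply/eqP; rewrite -subr_eq0; apply/eqP.
rewrite -[LHS]/(f x - g x) -(mul1r (f x)) -mulN1r; apply: hz.
- exact: bl_lin.
- by move=> t i; rewrite pf pg.
- move=> xi; have := h (- xi); have := hat_lin 1 (-1) (- xi) hf hg.
  move=> + e; rewrite e mul1r mulN1r subrr /hat opprK => /eqP; rewrite mulf_eq0.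
  case/orP => [|/eqP//]; rewrite eq_complex /= eqxx andbT invr_eq0.
  by rewrite gt_eqF// vol_gt0.
Qed.

(** For nonzero [xi], integration by parts applied to the constant 1 gives
    [0 = coord (- xi) i * hat 1 (- xi)], and some coordinate factor is nonzero. *)
Lemma torus_int_character xi :
  torus_int (character xi : fct) = if xi == 0 then ((2 * pi) ^+ n)%:C%C else 0.
Proof.
case: eqP => [->|].
  by rewrite -torus_int1; congr torus_int; apply/funext => x; rewrite character0.
move=> /eqP/rV0Pn[i hi].
have b1 : bln (fun=> 1) by exact: bl_cst.
have q : quad_derivative (delta_mx 0 i) (fun _ : 'rV[R]_n => 1 : R[i]) (fun=> 0).
  by exists 0 => x s; rewrite mulr0 subrr subr0 normc0 mul0r.
have b0 : bln (fun=> 0) by exact: bl_cst.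
have := hat_quad (- xi) q (fun _ _ => erefl) b1 b0.
rewrite /hat opprK; under eq_fun do rewrite mulr0; rewrite torus_int0 mulr0.
under eq_fun do rewrite mulr1; move/esym/eqP; rewrite !mulf_eq0.
rewrite eq_complex /= oner_eq0 andbF /= eq_complex /= eqxx andbT mxE mulrNz.
rewrite oppr_eq0 intr_eq0 (negbTE hi) /= eq_complex /= eqxx andbT invr_eq0.
by rewrite gt_eqF ?vol_gt0//= => /eqP.
Qed.

Definition fser a : fct := fun x => csum (fun xi => a xi * character xi x).

(** The exponent 2 matches the second-order Taylor remainder of a character, which grows like the
    square of the frequency; it lets a series be differentiated once, termwise and with uniform
    quadratic error. *)
Definition fast a := exists C : R, forall xi,
  (1 + (freq_size xi)%:R) ^+ 2 * normc (a xi) <= C * weight R xi.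

Lemma weight_boundedM C a (e : freq -> R[i]) : weight_bounded C a ->
  (forall xi, normc (e xi) <= 1) -> weight_bounded C (fun xi => a xi * e xi).
Proof.
move=> ha he xi; rewrite normcM (le_trans _ (ha xi))//.
by rewrite ler_piMr ?normc_ge0.
Qed.

Lemma weight_bounded_character C a x : weight_bounded C a ->
  weight_bounded C (fun xi => a xi * character xi x).
Proof. by move=> ha; apply: weight_boundedM => // xi; rewrite normc_character. Qed.

Lemma fser_le C a x : weight_bounded C a -> normc (fser a x) <= C * csum_const R n.
Proof. by move=> ha; apply: csum_le; exact: weight_bounded_character. Qed.

Lemma fast_bounds a : fast a -> exists C : R, 0 <= C /\
  [/\ weight_bounded C a,
     weight_bounded C (fun xi => (freq_size xi)%:R%:C%C * a xi) &
     weight_bounded C (fun xi => ((freq_size xi)%:R ^+ 2)%:C%C * a xi)].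
Proof.
move=> [C hC]; have C0 : 0 <= C.
  have := hC 0; rewrite -(pmulr_lge0 _ (freq_weight_gt0 R (0 : freq))); apply: le_trans.
  by rewrite mulr_ge0 ?normc_ge0// sqr_ge0.
exists C; split => //; have z0 xi : 0 <= (freq_size xi)%:R :> R by [].
split=> xi; rewrite ?normcM ?normc_real (le_trans _ (hC xi))//.
- rewrite ler_peMl ?normc_ge0// exprn_ege1// lerDl//.
- by rewrite ler_wpM2r ?normc_ge0// ger0_norm//; have := z0 xi; nra.
- by rewrite ler_wpM2r ?normc_ge0// ger0_norm ?sqr_ge0//; have := z0 xi; nra.
Qed.

Lemma fser_lin C D (u v : R[i]) a b : weight_bounded C a -> weight_bounded D b ->
  fser (fun xi => u * a xi + v * b xi) = (fun t => u * fser a t + v * fser b t).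
Proof.
move=> ha hb; apply/funext => t; rewrite /fser.
rewrite -(csum_lin u v (weight_bounded_character t ha) (weight_bounded_character t hb)).
by congr csum; apply/funext => xi; ring.
Qed.

Lemma periodic_fser a : Defs.periodic (fser a).
Proof.
by move=> x i; congr csum; apply/funext => xi; rewrite periodic_character.
Qed.

Lemma bl_fser a : fast a -> bln (fser a).
Proof.
move=> /fast_bounds[C [C0 [h0 h1 _]]]; exists (2 * C * csum_const R n) => [x|x y].
  rewrite (le_trans (fser_le _ h0))// ler_wpM2r ?csum_const_ge0//.
  by rewrite ler_peMl// ler1n.
have -> : fser a x - fser a y = csum (fun xi =>
    1 * (a xi * character xi x) + -1 * (a xi * character xi y)).
  rewrite (csum_lin _ _ (weight_bounded_character x h0) (weight_bounded_character y h0)).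
  by rewrite mul1r mulN1r.
rewrite mulrAC; apply: csum_le => xi.
rewrite mul1r mulN1r -mulrBr normcM.
rewrite (le_trans (ler_wpM2l (normc_ge0 _) (character_lip xi x y)))//.
have := h1 xi; rewrite normcM normc_real normr_nat => h.
have -> : normc (a xi) * (2 * (freq_size xi)%:R * l1dist x y) =
  2 * l1dist x y * ((freq_size xi)%:R * normc (a xi)) by ring.
have -> : 2 * C * l1dist x y * weight R xi = 2 * l1dist x y * (C * weight R xi) by ring.
by rewrite ler_wpM2l// mulr_ge0.
Qed.

Lemma quad_fser i a : fast a ->
  quad_derivative (delta_mx 0 i) (fser a) (fser (fun xi => coord xi i * a xi)).
Proof.
move=> /fast_bounds[C [C0 [h0 h1 h2]]]; exists (2 * C * csum_const R n) => x s.
have hc : weight_bounded C (fun xi => coord xi i * a xi).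
  move=> xi; rewrite (le_trans _ (h1 xi))// [leLHS]normcM [leRHS]normcM ler_wpM2r ?normc_ge0//.
  by rewrite normc_real normr_nat normc_coord.
set x' := x + _; have -> : fser a x' - fser a x - s%:C%C * fser (fun xi => coord xi i * a xi) x =
  csum (fun xi => 1 * (1 * (a xi * character xi x') + -1 * (a xi * character xi x)) +
     - s%:C%C * (coord xi i * a xi * character xi x)).
  have w0 y := weight_bounded_character y h0.
  rewrite (csum_lin _ _ (weight_bounded_lin _ _ (w0 x') (w0 x)) (weight_bounded_character x hc)).
  by rewrite (csum_lin _ _ (w0 x') (w0 x)) !mul1r mulN1r mulNr.
rewrite mulrAC; apply: csum_le => xi.
rewrite /x' character_shift.
have -> : 1 * (1 * (a xi * (character xi x * expi ((xi 0 i)%:~R * s))) +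
   -1 * (a xi * character xi x)) + - s%:C%C * (coord xi i * a xi * character xi x) =
  a xi * character xi x * (expi ((xi 0 i)%:~R * s) - 1 - s%:C%C * ('i%C * ((xi 0 i)%:~R : R)%:C%C)).
  by rewrite /coord; ring.
rewrite 2!normcM normc_character mulr1.
rewrite (le_trans (ler_wpM2l (normc_ge0 _) (quad_expi _ s)))//.
have := h2 xi; rewrite normcM normc_real ger0_norm ?sqr_ge0// => h.
have -> : 2 * C * s ^+ 2 * weight R xi = 2 * s ^+ 2 * (C * weight R xi) by ring.
apply: le_trans (ler_wpM2l _ h); last by rewrite mulr_ge0 ?sqr_ge0.
have -> : normc (a xi) * (2 * (xi 0 i)%:~R ^+ 2 * s ^+ 2) =
  2 * s ^+ 2 * ((xi 0 i)%:~R ^+ 2 * normc (a xi)) by ring.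
apply: ler_wpM2l; first by rewrite mulr_ge0 ?sqr_ge0.
apply: ler_wpM2r; first exact: normc_ge0.
rewrite -[leLHS]real_normK ?num_real// lerXn2r ?nnegrE//.
by rewrite -intr_norm -(pmulrn 1) ler_nat freq_size_ge.
Qed.

Lemma bl_sum (r : seq freq) (phi : freq -> fct) : (forall xi, bln (phi xi)) ->
  bln (fun x => \sum_(xi <- r) phi xi x).
Proof.
move=> h; elim: r => [|xi r ih].
  by under eq_fun do rewrite big_nil; exact: bl_cst.
by under eq_fun do rewrite big_cons; exact: bl_D.
Qed.

Lemma torus_int_sum (r : seq freq) (phi : freq -> fct) : (forall xi, bln (phi xi)) ->
  torus_int (fun x => \sum_(xi <- r) phi xi x) = \sum_(xi <- r) torus_int (phi xi).
Proof.
move=> h; elim: r => [|xi r ih].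
  by rewrite big_nil; under eq_fun do rewrite big_nil; exact: torus_int0.
rewrite big_cons -ih -[torus_int (phi xi)]mul1r -[X in _ + X]mul1r.
rewrite -torus_int_lin//; last exact: bl_sum.
by congr torus_int; apply/funext => x; rewrite big_cons !mul1r.
Qed.

(** The box sums approximate the series uniformly in [x] at rate [C * tail], hence so do their
    integrals. *)
Lemma torus_int_csum (phi : freq -> fct) C : (forall xi, bln (phi xi)) ->
  (forall x, weight_bounded C (phi^~ x)) -> bln (fun x => csum (phi^~ x)) ->
  torus_int (fun x => csum (phi^~ x)) = csum (fun xi => torus_int (phi xi)).
Proof.
move=> hb hC hF; apply: (@csum_unique _ _ (torus_const R n * C) (torus_const R n * C) _ _ 0%N).
  by move=> xi; rewrite -mulrA torus_int_le// => x; exact: hC.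
move=> N _; rewrite /psum -torus_int_sum//.
have -> : torus_int (fun x => csum (phi^~ x)) - torus_int (fun x => \sum_(xi <- box n N) phi xi x) =
    torus_int (fun x => 1 * csum (phi^~ x) + -1 * \sum_(xi <- box n N) phi xi x).
  by rewrite torus_int_lin ?mul1r ?mulN1r//; exact: bl_sum.
rewrite -mulrA torus_int_le//.
  by apply: bl_lin => //; exact: bl_sum.
by move=> x; rewrite mul1r mulN1r csum_approx.
Qed.

Lemma torus_int_fser a g : fast a -> bln g ->
  torus_int (fun x => fser a x * g x) =
  csum (fun xi => a xi * torus_int (fun x => character xi x * g x)).
Proof.
move=> fa hg; have [C [C0 [h0 _ _]]] := fast_bounds fa; have [K hK _] := hg.
have bc xi : bln (fun x => a xi * (character xi x * g x)).
  by apply: bl_Z => //; exact: bl_characterM.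
have wb x : weight_bounded (C * K) (fun xi => a xi * (character xi x * g x)).
  move=> xi; rewrite normcM normcM normc_character mul1r mulrAC.
  by rewrite ler_pM ?normc_ge0.
have e : (fun x => fser a x * g x) = (fun x => csum (fun xi => a xi * (character xi x * g x))).
  apply/funext => x; rewrite mulrC /fser -(csumZ (g x) (weight_bounded_character x h0)).
  by congr csum; apply/funext => xi; ring.
rewrite e (torus_int_csum bc wb); last by rewrite -e; apply: bl_M hg => //; exact: bl_fser.
by congr csum; apply/funext => xi; rewrite torus_intZ//; exact: bl_characterM.
Qed.

Lemma hat_fser a eta : fast a -> hat (fser a) eta = a eta.
Proof.
move=> fa; rewrite /hat; under eq_fun do rewrite mulrC.
rewrite torus_int_fser//; last exact: bl_character.
have v0 : ((2 * pi) ^+ n)%:C%C != 0 :> R[i].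
  by rewrite eq_complex /= eqxx andbT gt_eqF// vol_gt0.
rewrite (_ : (fun xi => _) = (fun xi => if xi == eta then ((2 * pi) ^+ n)%:C%C * a eta else 0)).
  rewrite csum_single mulrA -rmorphM /= mulVf ?rmorph1 ?mul1r// gt_eqF//.
  exact: vol_gt0.
apply/funext => xi; under eq_fun do rewrite -characterD.
rewrite torus_int_character subr_eq0; case: eqP => [->|_]; first by rewrite mulrC.
by rewrite mulr0.
Qed.

Lemma fser_hat f : bln f -> Defs.periodic f -> fast (hat f) -> fser (hat f) = f.
Proof.
move=> hf pf ff; apply: hat_inj => //; first exact: bl_fser.
  exact: periodic_fser.
by move=> xi; rewrite hat_fser.
Qed.

End FourierSeries.

(** * Ultradifferentiable functions *)

Section SmoothPeriodic.
Variables (R : realType) (n : nat).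
Local Notation freq := 'rV[int]_n.
Local Notation fct := ('rV[R]_n -> R[i]).
Local Notation bln := (bounded_lipschitz (@l1dist R n)).
Local Notation e_ i := (delta_mx 0 i : 'rV[R]_n).
Implicit Types (xi eta : freq) (f g : fct) (x y : 'rV[R]_n).

Lemma periodic_lattice (T : Type) (F : 'rV[R]_n -> T) (r : seq 'I_n) (k : 'I_n -> int) x :
  (forall x i, F (x + (2 * pi) *: e_ i) = F x) ->
  F (x + \sum_(i <- r) ((k i)%:~R * (2 * pi)) *: e_ i) = F x.
Proof.
move=> hp; elim: r x => [|i r ih] x; first by rewrite big_nil addr0.
rewrite big_cons addrA ih; move: (k i) => {ih k}.
have h p y : F (y + (p%:R * (2 * pi)) *: e_ i) = F y.
  elim: p => [|p ih]; first by rewrite mul0r scale0r addr0.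
  by rewrite -natr1 mulrDl mul1r scalerDl addrA hp.
case=> p; first exact: h.
by rewrite -(h p.+1) NegzE mulrNz -pmulrn mulNr -addrA -scalerDl addNr scale0r addr0.
Qed.

Lemma periodic_continuous_bounded (F : 'rV[R]_n -> R) : continuous F ->
  (forall x i, F (x + (2 * pi) *: e_ i) = F x) ->
  exists K : R, forall x, `|F x| <= K.
Proof.
move=> cF hp.
have cK := @rV_compact _ n (fun=> `[0, 2 * pi : R]%classic) (fun=> @segment_compact R _ _).
have /compact_bounded[M [_ hM]] := continuous_compact (continuous_subspaceT cF) cK.
exists (M + 1) => x.
pose k i := - Num.floor (x 0 i / (2 * pi)).
rewrite -(periodic_lattice (index_enum 'I_n) k x hp).
apply: hM; first by rewrite ltrDl.
eexists; last by [].
move=> i /=; rewrite in_itv /= mxE summxE.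
rewrite (bigD1 i)//= big1 => [|j /negbTE ji]; last by rewrite !mxE [i == j]eq_sym ji andbF mulr0.
rewrite !mxE !eqxx /= mulr1 addr0 /k.
have := floor_itv (x 0 i / (2 * pi)); set m := Num.floor _.
rewrite ler_pdivlMr ?pi2_gt0// ltr_pdivrMr ?pi2_gt0// rmorphD /= mulrDl mul1r.
by rewrite mulrNz mulNr => /andP[? ?]; apply/andP; split; lra.
Qed.

Lemma is_derive_line (F : 'rV[R]_n -> R) (i : 'I_n) x : (forall x, derivable F x (e_ i)) ->
  forall s : R, is_derive s 1 (fun s => F (x + s *: e_ i)) ('D_(e_ i) F (x + s *: e_ i)).
Proof.
move=> dF s.
have e : (fun h : R => h^-1 *: (((fun s => F (x + s *: e_ i)) \o shift s) (h *: (1 : R)) -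
     F (x + s *: e_ i))) =
   (fun h : R => h^-1 *: ((F \o shift (x + s *: e_ i)) (h *: e_ i) - F (x + s *: e_ i))).
  apply/funext => h /=; congr (_ *: (F _ - _)).
  by rewrite /GRing.scale /= mulr1 [RHS]addrC -addrA -scalerDl [s + h]addrC.
apply: DeriveDef; first by rewrite /derivable e; exact: dF.
by rewrite /derive e.
Qed.

Lemma line_lipschitz (F : 'rV[R]_n -> R) (i : 'I_n) K :
  (forall x, derivable F x (e_ i)) -> (forall x, `|'D_(e_ i) F x| <= K) ->
  forall x s, `|F (x + s *: e_ i) - F x| <= K * `|s|.
Proof.
move=> dF hK x s.
have [c _ h] := mean_value s (is_derive_line x dF).
rewrite scale0r addr0 in h; rewrite h normrM.
by rewrite ler_wpM2r.
Qed.

Lemma line_quadratic (F : 'rV[R]_n -> R) (i : 'I_n) L :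
  (forall x, derivable F x (e_ i)) ->
  (forall x s, `|'D_(e_ i) F (x + s *: e_ i) - 'D_(e_ i) F x| <= L * `|s|) ->
  forall x s, `|F (x + s *: e_ i) - F x - s * 'D_(e_ i) F x| <= L * s ^+ 2.
Proof.
move=> dF hL x s; set D := 'D_(e_ i) F x.
have hd (t : R) : is_derive t 1 (fun s => F (x + s *: e_ i) - s * D)
    ('D_(e_ i) F (x + t *: e_ i) - D).
  have h1 : is_derive t 1 (fun s : R => s * D) D.
    have -> : (fun s : R => s * D) = D \*: id.
      by apply/funext => u; rewrite mulrC.
    apply: (is_derive_eq (is_deriveZ D (is_derive_id t (1 : R)))).
    by rewrite /GRing.scale /= mulr1.
  exact: (is_deriveB (is_derive_line x dF t) h1).
have [c hc] := mean_value s hd.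
rewrite mul0r subr0 scale0r addr0 addrAC => ->.
rewrite normrM -(@real_normK _ s) ?num_real// expr2 mulrA ler_wpM2r//.
rewrite (le_trans (hL x c))// ler_wpM2l//.
have := le_trans (normr_ge0 _) (hL x 1); by rewrite normr1 mulr1.
Qed.

Lemma coordinate_path (F : 'rV[R]_n -> R) K (r : seq 'I_n) (t : 'I_n -> R) x :
  (forall i x s, `|F (x + s *: e_ i) - F x| <= K * `|s|) ->
  `|F (x + \sum_(i <- r) t i *: e_ i) - F x| <= K * \sum_(i <- r) `|t i|.
Proof.
move=> h; elim: r x => [|i r ih] x; first by rewrite !big_nil addr0 subrr normr0 mulr0.
rewrite !big_cons addrA mulrDr [leRHS]addrC -[F _ - F x](subrKA (F (x + t i *: e_ i))).
by rewrite (le_trans (ler_normD _ _))// lerD.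
Qed.

Lemma partial_lipschitz (F : 'rV[R]_n -> R) K :
  (forall i x s, `|F (x + s *: e_ i) - F x| <= K * `|s|) ->
  forall x y, `|F x - F y| <= K * l1dist x y.
Proof.
move=> h x y; have := coordinate_path (index_enum 'I_n) (fun i => x 0 i - y 0 i) y h.
rewrite (_ : y + _ = x)//; apply/rowP => j; rewrite !mxE summxE (bigD1 j)//=.
rewrite big1 => [|i /negbTE ij]; last by rewrite !mxE [j == i]eq_sym ij andbF mulr0.
by rewrite !mxE !eqxx mulr1 addr0 addrC subrK.
Qed.

Lemma foldr_partial_rcons (s : seq 'I_n) i f :
  foldr (@partial R n) (partial i f) s = foldr (@partial R n) f (rcons s i).
Proof. by rewrite foldr_rcons. Qed.

Lemma smooth_partial f i : smooth f -> smooth (partial i f).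
Proof. by move=> h s; rewrite foldr_partial_rcons; exact: h. Qed.

Lemma periodic_derive (F : 'rV[R]_n -> R) i :
  (forall x j, F (x + (2 * pi) *: e_ j) = F x) ->
  forall x j, 'D_(e_ i) F (x + (2 * pi) *: e_ j) = 'D_(e_ i) F x.
Proof.
move=> hp x j; set y := x + _.
have e : (fun h : R => h^-1 *: ((F \o shift y) (h *: e_ i) - F y)) =
    (fun h => h^-1 *: ((F \o shift x) (h *: e_ i) - F x)).
  by apply/funext => h /=; rewrite /y addrA !hp.
by rewrite /derive e.
Qed.

Lemma periodic_partial f i : Defs.periodic f -> Defs.periodic (partial i f).
Proof.
move=> pf x j; rewrite /partial; congr Complex; apply: periodic_derive => y k;
  by rewrite /fRe /fIm pf.
Qed.

Lemma bl_of_ReIm f (K L : R) : (forall x, `|complex.Re (f x)| <= K) ->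
  (forall x, `|complex.Im (f x)| <= K) ->
  (forall x y, `|complex.Re (f x) - complex.Re (f y)| <= L * l1dist x y) ->
  (forall x y, `|complex.Im (f x) - complex.Im (f y)| <= L * l1dist x y) -> bln f.
Proof.
move=> h1 h2 h3 h4; exists (2 * (`|K| + `|L|)) => [x|x y].
  rewrite (le_trans (normc_le_ReIm _))// mulrDl !mul1r lerD//.
    by rewrite (le_trans (h1 x))// (le_trans (ler_norm K))// lerDl.
  by rewrite (le_trans (h2 x))// (le_trans (ler_norm K))// lerDl.
have hL : L * l1dist x y <= (`|K| + `|L|) * l1dist x y.
  by rewrite ler_wpM2r ?l1dist_ge0// (le_trans (ler_norm L))// lerDr.
rewrite (le_trans (normc_le_ReIm _))// ReB ImB -mulrA mulrDl !mul1r.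
by rewrite lerD// (le_trans _ hL).
Qed.

Lemma uniform_bound (K : 'I_n -> R -> Prop) :
  (forall i a b, a <= b -> K i a -> K i b) -> (forall i, exists a, K i a) ->
  exists a, forall i, K i a.
Proof.
move=> hm hx; have /choice[a ha] := hx.
exists (\sum_i `|a i|) => i; apply: hm (ha i).
by rewrite (le_trans (ler_norm _))// (bigD1 i)//= lerDl sumr_ge0.
Qed.

(** The function and its first partial derivatives are bounded, by compactness of the period cube.
    Moving from one point to another along one coordinate at a time then gives the Lipschitz bound
    for [l1dist]. *)
Lemma smooth_bl f : smooth f -> Defs.periodic f -> bln f.
Proof.
move=> sf pf; have [c1 c2 hd] := sf [::].
have pR x j : fRe f (x + (2 * pi) *: e_ j) = fRe f x by rewrite /fRe pf.
have pI x j : fIm f (x + (2 * pi) *: e_ j) = fIm f x by rewrite /fIm pf.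
have [K1 h1] := periodic_continuous_bounded c1 pR.
have [K2 h2] := periodic_continuous_bounded c2 pI.
have [L hL] : exists L : R, forall i x, `|'D_(e_ i) (fRe f) x| <= L /\
     `|'D_(e_ i) (fIm f) x| <= L.
  apply: (@uniform_bound (fun i L => forall x, `|'D_(e_ i) (fRe f) x| <= L /\
     `|'D_(e_ i) (fIm f) x| <= L)) => [i a b ab h x|i].
    by have [h3 h4] := h x; rewrite (le_trans h3)// (le_trans h4).
  have [_ _ c3 c4] := hd i.
  have [K3 h3] := periodic_continuous_bounded c3 (periodic_derive i pR).
  have [K4 h4] := periodic_continuous_bounded c4 (periodic_derive i pI).
  exists (`|K3| + `|K4|) => x; split.
    by rewrite (le_trans (h3 x))// (le_trans (ler_norm _))// lerDl.
  by rewrite (le_trans (h4 x))// (le_trans (ler_norm _))// lerDr.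
apply: (@bl_of_ReIm f (`|K1| + `|K2|) L).
- by move=> x; rewrite (le_trans (h1 x))// (le_trans (ler_norm _))// lerDl.
- by move=> x; rewrite (le_trans (h2 x))// (le_trans (ler_norm _))// lerDr.
- apply: (@partial_lipschitz (fRe f)) => i; have [d1 _ _ _] := hd i.
  by apply: line_lipschitz => // x; case: (hL i x).
- apply: (@partial_lipschitz (fIm f)) => i; have [_ d2 _ _] := hd i.
  by apply: line_lipschitz => // x; case: (hL i x).
Qed.

Lemma l1dist_line x s i : l1dist (x + s *: e_ i) x = `|s|.
Proof.
rewrite /l1dist (bigD1 i)//= big1 => [|j /negbTE ij].
  by rewrite !mxE !eqxx mulr1 addr0 addrAC subrr add0r.
by rewrite !mxE ij andbF mulr0 addr0 subrr normr0.
Qed.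

(** The partial derivative is again smooth and periodic, hence Lipschitz, and the mean value theorem
    turns this into a quadratic remainder. *)
Lemma smooth_quad f i : smooth f -> Defs.periodic f ->
  quad_derivative (e_ i) f (partial i f).
Proof.
move=> sf pf; have [_ _ /(_ i)[d1 d2 _ _]] := sf [::].
have [L _ hL] := smooth_bl (smooth_partial i sf) (periodic_partial i pf).
exists (L + L) => x s.
rewrite (le_trans (normc_le_ReIm _))// !ReB !ImB ReM ImM /= !mul0r subr0 addr0.
rewrite mulrDl lerD//.
  apply: (@line_quadratic (fRe f)) => // {}x {}s; rewrite -(l1dist_line x s i).
  by rewrite (le_trans _ (hL _ _))// (le_trans _ (normc_Re _))// ReB.
apply: (@line_quadratic (fIm f)) => // {}x {}s; rewrite -(l1dist_line x s i).
by rewrite (le_trans _ (hL _ _))// (le_trans _ (normc_Im _))// ImB.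
Qed.

Lemma hat_partial f i xi : smooth f -> Defs.periodic f ->
  hat (partial i f) xi = coord R xi i * hat f xi.
Proof.
move=> sf pf; apply: hat_quad => //; [exact: smooth_quad|exact: smooth_bl|].
by apply: smooth_bl; [exact: smooth_partial|exact: periodic_partial].
Qed.

Definition monomial (a : 'I_n -> nat) xi : R[i] := \prod_i coord R xi i ^+ a i.

Lemma mderiv_spec (a : 'I_n -> nat) f : smooth f -> Defs.periodic f ->
  [/\ smooth (mderiv a f), Defs.periodic (mderiv a f) &
     forall xi, hat (mderiv a f) xi = monomial a xi * hat f xi].
Proof.
move=> sf pf; rewrite /mderiv /monomial.
have it k i g : smooth g -> Defs.periodic g -> [/\ smooth (iter k (@partial R n i) g),
   Defs.periodic (iter k (@partial R n i) g) &
   forall xi, hat (iter k (@partial R n i) g) xi = coord R xi i ^+ k * hat g xi].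
  move=> sg pg; elim: k => [|k [h1 h2 h3]].
    by split => // xi; rewrite expr0 mul1r.
  split; [exact: smooth_partial|exact: periodic_partial|move=> xi].
  by rewrite /= hat_partial// h3 exprS mulrA.
have : [/\ smooth (foldr (fun i g => iter (a i) (@partial R n i) g) f (enum 'I_n)),
   Defs.periodic (foldr (fun i g => iter (a i) (@partial R n i) g) f (enum 'I_n)) &
   forall xi, hat (foldr (fun i g => iter (a i) (@partial R n i) g) f (enum 'I_n)) xi =
     (\prod_(i <- enum 'I_n) coord R xi i ^+ a i) * hat f xi].
  elim: (enum 'I_n) => [|i r [h1 h2 h3]] /=.
    by split => // xi; rewrite big_nil mul1r.
  have [k1 k2 k3] := it (a i) i _ h1 h2.
  by split => // xi; rewrite k3 h3 big_cons mulrA.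
by case=> ? ? h; split => // xi; rewrite h big_enum.
Qed.

End SmoothPeriodic.

(** * Decay of coefficients governed by the weight sequence *)

Section WeightedDecay.
Variables (R : realType) (n : nat) (M : nat -> R) (H : R).
Hypotheses (hM : weight_sequence M) (H1 : 1 <= H).
Hypothesis MH : forall j k, M (j + k)%N <= H ^+ (j + k) * M j * M k.
Local Notation freq := 'rV[int]_n.
Local Notation fct := ('rV[R]_n -> R[i]).
Local Notation bln := (bounded_lipschitz (@l1dist R n)).
Local Notation z xi := ((freq_size xi)%:R : R).
Implicit Types (xi eta : freq) (a b : freq -> R[i]) (f g : fct) (C h : R).

Definition fact_weight k : R := M k * k`!%:R.
Local Notation fm := fact_weight.

Lemma fact_weight_gt0 k : 0 < fm k.
Proof. by rewrite mulr_gt0 ?(weight_gt0 hM)// ltr0n fact_gt0. Qed.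

Lemma fact_weight_ge0 k : 0 <= fm k.
Proof. exact: ltW (fact_weight_gt0 k). Qed.

(** By log-convexity the ratios m_(k+1) / m_k do not decrease, and the first one is 1. The induction
    therefore carries monotonicity along. *)
Lemma weight_ge1 k : 1 <= M k.
Proof.
suff : 1 <= M k /\ M k <= M k.+1 by case.
have [_ M0 M1 Mc _] := hM.
elim: k => [|k [ih1 ih2]]; first by rewrite M0 M1.
have k1 : 1 <= M k.+1 by exact: le_trans ih2.
split => //; have := Mc k; have m0 := weight_gt0 hM k; rewrite expr2 => hc.
rewrite -(ler_pM2l m0) (le_trans _ hc)// ler_wpM2r//.
exact: ltW (weight_gt0 hM _).
Qed.

Lemma bin_le_exp2 p k : ('C(p, k) <= 2 ^ p)%N.
Proof.
elim: p k => [|p ih] [|k] //; rewrite ?bin0 ?expn_gt0// binS expnS mul2n -addnn.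
exact: leq_add.
Qed.

Lemma fact_weightD k p : fm (k + p) <= (2 * H) ^+ (k + p) * fm k * fm p.
Proof.
have h : ((k + p)`!%:R : R) <= 2 ^+ (k + p) * (k`!%:R * p`!%:R).
  rewrite -natrX -!natrM ler_nat -[X in (X <= _)%N](bin_fact (leq_addr p k)).
  by rewrite addKn leq_mul2r bin_le_exp2 orbT.
have H0 : 0 <= H by apply: le_trans H1.
rewrite /fact_weight (@le_trans _ _ ((H ^+ (k + p) * M k * M p) *
   (2 ^+ (k + p) * (k`!%:R * p`!%:R))))//.
  by apply: ler_pM => //; rewrite ltW// (weight_gt0 hM).
by rewrite exprMn le_eqVlt; apply/orP; left; apply/eqP; ring.
Qed.

(** The infimum over k of h^k m_k k! / |xi|^k is the associated decay function of the weight; the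
    quantifier over k stands for it. At frequency 0 only k = 0 carries information. *)
Definition dec C h a := forall xi k, normc (a xi) * z xi ^+ k <= C * (h ^+ k * fm k).

Definition decays a := exists C h, [/\ 0 <= C, 0 < h & dec C h a].

Definition shift_const h p : R := 2 ^+ p * (1 + (2 * H * h) ^+ p * fm p).

Lemma shift_const_ge0 h p : 0 < h -> 0 <= shift_const h p.
Proof.
move=> h0; have H0 : 0 <= H by apply: le_trans H1.
rewrite mulr_ge0 ?exprn_ge0// addr_ge0// mulr_ge0 ?fact_weight_ge0//.
by rewrite exprn_ge0// !mulr_ge0// ltW.
Qed.

Lemma exprD1_le (x : R) p : 0 <= x -> (1 + x) ^+ p <= 2 ^+ p * (1 + x ^+ p).
Proof.
move=> x0; have [x1|x1] := leP x 1.
  rewrite (@le_trans _ _ (2 ^+ p))//.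
    by rewrite lerXn2r ?nnegrE//; lra.
  by rewrite ler_peMr ?exprn_ge0// lerDl exprn_ge0.
rewrite (@le_trans _ _ (2 ^+ p * x ^+ p))//.
  by rewrite -exprMn lerXn2r ?nnegrE//; lra.
by rewrite ler_wpM2l ?exprn_ge0// lerDr.
Qed.

(** [(1 + z) ^+ p] is at most [2 ^+ p * (1 + z ^+ p)], and the term with [z ^+ p] is the hypothesis
    at k + p. There [fact_weightD] splits the weight; the power of 2H goes into the new radius and
    [fm p] into the constant. *)
Lemma dec_shift C h a p : 0 <= C -> 0 < h -> dec C h a ->
  dec (C * shift_const h p) (2 * H * h) (fun xi => ((1 + z xi) ^+ p)%:C%C * a xi).
Proof.
move=> C0 h0 ha xi k; have H0 : 0 <= H by apply: le_trans H1.
have z0 : 0 <= z xi by [].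
rewrite normcM normc_real ger0_norm ?exprn_ge0 ?addr_ge0//.
have hk : h ^+ k <= (2 * H * h) ^+ k.
  have h2 : h <= 2 * H * h by have h1 := H1; nra.
  by rewrite lerXn2r ?nnegrE// ?(le_trans _ h2) ?(ltW h0).
have e1 := ha xi k; have e2 := ha xi (k + p)%N.
have e3 : C * (h ^+ (k + p) * fm (k + p)) <=
    C * ((2 * H * h) ^+ k * fm k) * ((2 * H * h) ^+ p * fm p).
  have -> : C * ((2 * H * h) ^+ k * fm k) * ((2 * H * h) ^+ p * fm p) =
      C * (h ^+ (k + p) * ((2 * H) ^+ (k + p) * fm k * fm p)).
    by rewrite !exprMn !exprD; ring.
  by rewrite ler_wpM2l// ler_wpM2l ?fact_weightD// exprn_ge0// ltW.
have e4 : C * (h ^+ k * fm k) <= C * ((2 * H * h) ^+ k * fm k).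
  by rewrite ler_wpM2l// ler_wpM2r ?fact_weight_ge0.
have -> : (1 + z xi) ^+ p * normc (a xi) * z xi ^+ k =
  normc (a xi) * z xi ^+ k * (1 + z xi) ^+ p by ring.
rewrite (le_trans (ler_wpM2l _ (exprD1_le p z0)))//.
  by rewrite mulr_ge0 ?normc_ge0 ?exprn_ge0.
rewrite /shift_const; rewrite exprD in e2.
have -> : normc (a xi) * z xi ^+ k * (2 ^+ p * (1 + z xi ^+ p)) =
  2 ^+ p * (normc (a xi) * z xi ^+ k + normc (a xi) * (z xi ^+ k * z xi ^+ p)) by ring.
have -> : C * (2 ^+ p * (1 + (2 * H * h) ^+ p * fm p)) * ((2 * H * h) ^+ k * fm k) =
  2 ^+ p * (C * ((2 * H * h) ^+ k * fm k) +
     C * ((2 * H * h) ^+ k * fm k) * ((2 * H * h) ^+ p * fm p)) by ring.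
rewrite ler_wpM2l ?exprn_ge0// lerD//; first exact: le_trans e1 e4.
exact: le_trans e2 e3.
Qed.

(** Each of the n factors of [weight] is at least (1 + |xi|)^(-2). This is the origin of the shift
    by [2 * n] whenever decay is converted into domination by [weight]. *)
Lemma weight_inv_le xi : 1 <= (1 + z xi) ^+ (2 * n) * weight R xi.
Proof.
have -> : (1 + z xi) ^+ (2 * n) = \prod_(i < n) (1 + z xi) ^+ 2.
  by rewrite prodr_const card_ord exprM.
rewrite /weight -big_split /=.
apply: (big_ind (fun x => 1 <= x)) => // [x y|i _]; first exact: mulr_ege1.
rewrite ler_pdivlMr; last by rewrite ltr_pwDl// sqr_ge0.
have z0 : 0 <= z xi by [].
have : (xi 0 i)%:~R ^+ 2 <= z xi ^+ 2.
  rewrite -[leLHS]real_normK ?num_real// lerXn2r ?nnegrE//.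
  by rewrite -intr_norm -(pmulrn 1) ler_nat freq_size_ge.
by rewrite mul1r expr2 => h; nra.
Qed.

Lemma dec_weight C h a : 0 <= C -> 0 < h -> dec C h a -> forall xi k,
  normc (a xi) * z xi ^+ k <=
  C * shift_const h (2 * n) * ((2 * H * h) ^+ k * fm k) * weight R xi.
Proof.
move=> C0 h0 ha xi k; have := dec_shift (2 * n) C0 h0 ha xi k.
rewrite normcM normc_real ger0_norm ?exprn_ge0 ?addr_ge0// => e.
apply: le_trans (ler_wpM2r (weight_ge0 _ _) e).
rewrite -[leLHS]mul1r.
have -> : (1 + z xi) ^+ (2 * n) * normc (a xi) * z xi ^+ k * weight R xi =
  ((1 + z xi) ^+ (2 * n) * weight R xi) * (normc (a xi) * z xi ^+ k) by ring.
by rewrite ler_wpM2r ?weight_inv_le// mulr_ge0 ?normc_ge0 ?exprn_ge0.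
Qed.

Lemma twoHh_gt0 h : 0 < h -> 0 < 2 * H * h.
Proof. by move=> h0; rewrite !mulr_gt0// (lt_le_trans _ H1). Qed.

(** Two successive shifts, by 2 for the polynomial factor in [fast] and by 2n to gain [weight]; the
    result is read off at k = 0. *)
Lemma decays_fast a : decays a -> fast a.
Proof.
case=> C [h [C0 h0 ha]].
have h1 := twoHh_gt0 h0.
have C1 : 0 <= C * shift_const h 2 by rewrite mulr_ge0// shift_const_ge0.
have := dec_weight C1 h1 (dec_shift 2 C0 h0 ha) => hw.
exists (C * shift_const h 2 * shift_const (2 * H * h) (2 * n) *
  ((2 * H * (2 * H * h)) ^+ 0 * fm 0)) => xi.
have := hw xi 0%N; rewrite normcM normc_real ger0_norm ?exprn_ge0 ?addr_ge0//.
by rewrite expr0 mulr1.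
Qed.

Lemma dec_le C C' h h' a : C <= C' -> 0 <= C -> 0 <= h -> h <= h' -> dec C h a -> dec C' h' a.
Proof.
move=> CC C0 h0 hh ha xi k; rewrite (le_trans (ha xi k))//.
apply: ler_pM => //; first by rewrite mulr_ge0 ?exprn_ge0 ?fact_weight_ge0.
by rewrite ler_wpM2r ?fact_weight_ge0// lerXn2r// nnegrE (le_trans h0).
Qed.

Lemma decays_lin (x y : R[i]) a b : decays a -> decays b ->
  decays (fun xi => x * a xi + y * b xi).
Proof.
move=> [C [h [C0 h0 ha]]] [D [l [D0 l0 hb]]].
exists (normc x * C + normc y * D), (h + l); split.
- by rewrite addr_ge0// mulr_ge0// normc_ge0.
- by rewrite addr_gt0.
move=> xi k.
have hl : h <= h + l by rewrite lerDl ltW.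
have lh : l <= h + l by rewrite lerDr ltW.
have e1 := dec_le (lexx C) C0 (ltW h0) hl ha xi k.
have e2 := dec_le (lexx D) D0 (ltW l0) lh hb xi k.
rewrite (@le_trans _ _ ((normc x * normc (a xi) + normc y * normc (b xi)) * z xi ^+ k))//.
  by rewrite ler_wpM2r ?exprn_ge0// -!normcM normcD.
by rewrite !mulrDl -!mulrA lerD// ler_wpM2l ?normc_ge0.
Qed.

Lemma decays_le (K : R) a b : 0 <= K -> (forall xi, normc (b xi) <= K * normc (a xi)) ->
  decays a -> decays b.
Proof.
move=> K0 hb [C [h [C0 h0 ha]]]; exists (K * C), h; split => //; first exact: mulr_ge0.
move=> xi k; rewrite (le_trans (ler_wpM2r _ (hb xi)))// ?exprn_ge0//.
by rewrite -!mulrA ler_wpM2l.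
Qed.

Lemma decaysZ (x : R[i]) a : decays a -> decays (fun xi => x * a xi).
Proof.
by apply: decays_le (normc_ge0 x) _ => xi; rewrite normcM.
Qed.

Lemma decays_conj a : decays a -> decays (fun xi => conjc (a xi)).
Proof.
by apply: decays_le ler01 _ => xi; rewrite normc_conj mul1r.
Qed.

Lemma decays_neg a : decays a -> decays (fun xi => a (- xi)).
Proof.
move=> [C [h [C0 h0 ha]]]; exists C, h; split => // xi k.
by rewrite -freq_sizeN.
Qed.

Lemma decays_coord i a : decays a -> decays (fun xi => coord R xi i * a xi).
Proof.
move=> [C [h [C0 h0 ha]]].
apply: (@decays_le 1 (fun xi => ((1 + z xi) ^+ 1)%:C%C * a xi)) => //.
  move=> xi; rewrite mul1r [leLHS]normcM [leRHS]normcM ler_wpM2r ?normc_ge0//.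
  rewrite normc_real expr1 ger0_norm ?addr_ge0// (le_trans (normc_coord _ _ _))//.
  by rewrite lerDr.
exists (C * shift_const h 1), (2 * H * h); split.
- by rewrite mulr_ge0// shift_const_ge0.
- exact: twoHh_gt0.
- exact: dec_shift.
Qed.

Lemma decays_finite N a : (forall xi, (N < freq_size xi)%N -> a xi = 0) -> decays a.
Proof.
(* On the box |xi|^k <= (N+1)^k, and [fm k >= 1]. The 1 added to N keeps the radius positive for N =
   0. *)
move=> h0; exists (\sum_(xi <- box n N) normc (a xi)), (N%:R + 1); split.
- by apply: sumr_ge0 => xi _; exact: normc_ge0.
- by rewrite ltr_wpDl.
move=> xi k; have S0 : 0 <= \sum_(xi <- box n N) normc (a xi).
  by apply: sumr_ge0 => ? _; exact: normc_ge0.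
have [le|lt] := leqP (freq_size xi) N; last first.
  by rewrite h0// normc0 mul0r mulr_ge0// mulr_ge0 ?fact_weight_ge0// exprn_ge0// addr_ge0.
apply: ler_pM; rewrite ?normc_ge0 ?exprn_ge0//.
  rewrite (bigD1_seq xi) ?mem_box ?box_uniq//= lerDl.
  by apply: sumr_ge0 => ? _; exact: normc_ge0.
have f1 : 1 <= fm k.
  by rewrite -[1]mulr1 ler_pM ?ler1n ?fact_gt0 ?weight_ge1.
rewrite (@le_trans _ _ ((N%:R + 1) ^+ k))//.
  rewrite lerXn2r ?nnegrE ?addr_ge0//.
  by rewrite natr1 ler_nat leqW.
by rewrite ler_peMr ?exprn_ge0// addr_ge0.
Qed.

End WeightedDecay.

(** * Ultradifferentiable functions and decaying coefficients *)

Section UltradifferentiableSeries.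
Variables (R : realType) (n : nat) (M : nat -> R) (H : R).
Hypotheses (hM : weight_sequence M) (H1 : 1 <= H).
Hypothesis MH : forall j k, M (j + k)%N <= H ^+ (j + k) * M j * M k.
Local Notation freq := 'rV[int]_n.
Local Notation fct := ('rV[R]_n -> R[i]).
Local Notation bln := (bounded_lipschitz (@l1dist R n)).
Local Notation z xi := ((freq_size xi)%:R : R).
Local Notation fm := (fact_weight M).
Local Notation decays := (@decays R n M).
Implicit Types (xi eta : freq) (a b c : freq -> R[i]) (f g : fct) (C h : R).

Lemma bl_continuous (f : fct) : bln f -> continuous (fRe f) /\ continuous (fIm f).
Proof.
move=> [K _ hK]; have K1 : 0 < `|K| + 1 by rewrite ltr_wpDl.
have n1 : 0 < n%:R + 1 :> R by rewrite ltr_wpDl.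
suff h (F : 'rV[R]_n -> R) : (forall x y, `|F x - F y| <= K * l1dist x y) -> continuous F.
  split; apply: h => x y; rewrite /fRe /fIm -?ReB -?ImB (le_trans _ (hK x y))//.
    exact: normc_Re.
  exact: normc_Im.
move=> hF x A /= /(nbhs_ballP (F x)) [e /= e0 hA].
have e1 : 0 < e / 2 / (`|K| + 1) / (n%:R + 1) by rewrite !divr_gt0.
apply/nbhs_ballP; exists (e / 2 / (`|K| + 1) / (n%:R + 1)) => //= y [_ hxy].
have hy i : `|x 0 i - y 0 i| <= e / 2 / (`|K| + 1) / (n%:R + 1) by exact: ltW (hxy 0 i).
apply: hA; apply: (@le_lt_trans _ _ (e / 2)); last by lra.
rewrite (le_trans (hF x y))// (@le_trans _ _ ((`|K| + 1) * l1dist x y))//.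
  by rewrite ler_wpM2r ?l1dist_ge0// (le_trans (ler_norm K))// lerDl.
rewrite mulrC -ler_pdivlMr// (@le_trans _ _ (\sum_(i < n) e / 2 / (`|K| + 1) / (n%:R + 1)))//.
  exact: ler_sum.
have q0 : 0 < e / 2 / (`|K| + 1) by rewrite !divr_gt0.
rewrite sumr_const card_ord -[leLHS]mulr_natr; move: (e / 2 / (`|K| + 1)) q0 => q q0.
by rewrite mulrAC ler_pdivrMr// ler_wpM2l ?lerDl// ltW.
Qed.

Lemma partial_fser i a : fast a -> partial i (fser a) = fser (fun xi => coord R xi i * a xi).
Proof.
move=> fa; have q := quad_fser i fa; apply/funext => x.
have [_ e1] := quad_is_derive_Re q x; have [_ e2] := quad_is_derive_Im q x.
rewrite /partial -[fRe _]/(fun x => complex.Re (fser a x)).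
rewrite -[fIm _]/(fun x => complex.Im (fser a x)) e1 e2.
by case: (fser _ x).
Qed.

Lemma is_C1_fser a : decays a -> is_C1 (fser a).
Proof.
move=> da; have fa := decays_fast hM H1 MH da.
have [c1 c2] := bl_continuous (bl_fser fa).
split; [exact: c1|exact: c2|move=> i].
have q := quad_fser i fa.
have [c3 c4] := bl_continuous (bl_fser (decays_fast hM H1 MH (decays_coord hM H1 MH i da))).
rewrite (partial_fser i fa); split; [move=> x|move=> x|exact: c3|exact: c4].
  by case: (quad_is_derive_Re q x).
by case: (quad_is_derive_Im q x).
Qed.

Lemma smooth_fser a : decays a -> smooth (fser a).
Proof.
move=> da s; have [b db ->] : exists2 b, decays b & foldr (@partial R n) (fser a) s = fser b.
  elim: s => [|i s [b db /= ->]]; first by exists a; [exact: da|].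
  exists (fun xi => coord R xi i * b xi); first exact: (decays_coord hM H1 MH).
  by rewrite partial_fser//; exact: (decays_fast hM H1 MH db).
exact: is_C1_fser.
Qed.

Lemma decays_monomial (al : 'I_n -> nat) c : decays c ->
  decays (fun xi => monomial R al xi * c xi).
Proof.
move=> dc; rewrite /monomial; elim: (index_enum _) => [|i r ih].
  by under eq_fun do rewrite big_nil mul1r.
under eq_fun do rewrite big_cons -mulrA.
elim: (al i) => [|k ihk]; first by under eq_fun do rewrite expr0 mul1r.
by under eq_fun do rewrite exprS -mulrA; exact: (decays_coord hM H1 MH).
Qed.

(** Both sides are periodic and bounded Lipschitz with the same Fourier coefficients, so uniqueness
    replaces a termwise differentiation of arbitrary order. *)
Lemma mderiv_fser (al : 'I_n -> nat) c : decays c ->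
  mderiv al (fser c) = fser (fun xi => monomial R al xi * c xi).
Proof.
move=> dc; have dm := decays_monomial al dc.
have [s p hh] := mderiv_spec al (smooth_fser dc) (@periodic_fser R n c).
apply: hat_inj => //; [exact: smooth_bl|exact: bl_fser (decays_fast hM H1 MH dm)| |].
  exact: periodic_fser.
by move=> xi; rewrite hh !hat_fser//; exact: (decays_fast hM H1 MH).
Qed.

Lemma normc_monomial_le (al : 'I_n -> nat) xi :
  normc (monomial R al xi) <= z xi ^+ mabs al.
Proof.
rewrite /monomial (big_morph _ (@normcM R) (@normc1 R)) /mabs expr_sum.
apply: ler_prod => i _; rewrite normc_ge0 /= normcX.
by rewrite lerXn2r ?nnegrE ?normc_ge0 ?normc_coord.
Qed.

Definition fser_const C h : R := C * shift_const M H h (2 * n).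

Lemma weight_bounded_monomial (al : 'I_n -> nat) C h c : 0 <= C -> 0 < h ->
  dec M C h c ->
  weight_bounded (fser_const C h * ((2 * H * h) ^+ mabs al * fm (mabs al)))
    (fun xi => monomial R al xi * c xi).
Proof.
move=> C0 h0 hc xi; rewrite normcM mulrC.
apply: le_trans (dec_weight hM H1 MH C0 h0 hc xi (mabs al)).
by rewrite ler_wpM2l ?normc_ge0// normc_monomial_le.
Qed.

Lemma Mnorm_le h f K : 0 < h ->
  (forall al x, normc (mderiv al f x) <= K * (h ^+ mabs al * fm (mabs al))) ->
  (Mnorm M h f <= K%:E)%E.
Proof.
move=> h0 hf; apply: ge_ereal_sup => _ [[al x] _ <-] /=.
rewrite lee_fin -mulrA ler_pdivrMr//.
by rewrite mulr_gt0 ?exprn_gt0// (fact_weight_gt0 hM).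
Qed.

Lemma Mnorm_lt h f K : 0 < h -> (Mnorm M h f < K%:E)%E ->
  forall al x, normc (mderiv al f x) <= K * (h ^+ mabs al * fm (mabs al)).
Proof.
move=> h0 hK al x.
have p0 : 0 < h ^+ mabs al * fm (mabs al).
  by rewrite mulr_gt0 ?exprn_gt0// (fact_weight_gt0 hM).
rewrite -ler_pdivrMr// -lee_fin (le_trans _ (ltW hK))//; apply: ereal_sup_ubound.
by exists (al, x); rewrite //= /fact_weight mulrA.
Qed.

Lemma Mnorm_fser C h c : 0 <= C -> 0 < h -> dec M C h c ->
  (Mnorm M (2 * H * h) (fser c) <= (fser_const C h * csum_const R n)%:E)%E.
Proof.
move=> C0 h0 hc; have dc : decays c by exists C, h.
apply: Mnorm_le; first exact: twoHh_gt0.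
move=> al x; rewrite mderiv_fser// mulrAC.
exact: fser_le (weight_bounded_monomial al C0 h0 hc).
Qed.

Lemma Mnorm_fser_tail N C h c : 0 <= C -> 0 < h -> dec M C h c ->
  (forall xi, (freq_size xi <= N)%N -> c xi = 0) ->
  (Mnorm M (2 * H * h) (fser c) <= (fser_const C h * tail R n N)%:E)%E.
Proof.
move=> C0 h0 hc c0; have dc : decays c by exists C, h.
apply: Mnorm_le; first exact: twoHh_gt0.
move=> al x; rewrite mderiv_fser// mulrAC /fser; apply: csum_tail.
  exact: weight_bounded_character (weight_bounded_monomial al C0 h0 hc).
by move=> xi hxi; rewrite c0// mulr0 mul0r.
Qed.

Lemma EMh_fser C h c : 0 <= C -> 0 < h -> dec M C h c -> EMh M (2 * H * h) (fser c).
Proof.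
move=> C0 h0 hc; split; first exact: periodic_fser.
  by apply: smooth_fser; exists C, h.
by rewrite (le_lt_trans (Mnorm_fser C0 h0 hc))// ltry.
Qed.

Lemma EM_fser c : decays c -> Defs.EM M (fser c).
Proof.
move=> [C [h [C0 h0 hc]]]; exists (2 * H * h); first exact: twoHh_gt0.
exact: EMh_fser C0 h0 hc.
Qed.

Lemma mderiv0 (f : fct) : mderiv (fun=> 0%N) f = f.
Proof. by rewrite /mderiv; elim: (enum _) => //= i r ->. Qed.

Lemma normc_coord_eq xi i : normc (coord R xi i) = (absz (xi ord0 i))%:R.
Proof. by rewrite normcM normc_i mul1r normc_real -intr_norm -(pmulrn 1). Qed.

Lemma freq_size_attained xi : freq_size xi = 0%N \/
  exists i, freq_size xi = absz (xi ord0 i).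
Proof.
rewrite /freq_size; case: (posnP n) => [n0|n0].
  by left; apply: big1 => -[i hi] _; exfalso; move: hi; rewrite n0.
have [|i ->] := @bigop.eq_bigmax _ (fun i : 'I_n => absz (xi ord0 i)).
  by rewrite card_ord.
by right; exists i.
Qed.

(** Since [freq_size] is a maximum norm, it suffices to differentiate k times in a coordinate where
    the maximum is attained. *)
Lemma EMh_dec h f K : 0 < h -> EMh M h f -> (Mnorm M h f < K%:E)%E ->
  dec M (hat_const R n * K) h (hat f).
Proof.
move=> h0 [pf sf _] hK xi k.
have hb i : normc (hat f xi) * normc (coord R xi i) ^+ k <=
    hat_const R n * K * (h ^+ k * fm k).
  have e : mabs (fun j => if j == i then k else 0%N) = k.
    by rewrite /mabs (bigD1 i)//= eqxx big1 ?addn0// => j /negbTE ->.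
  have := Mnorm_lt h0 hK (fun j => if j == i then k else 0%N); rewrite e => hb.
  have [s p hh] := mderiv_spec (fun j => if j == i then k else 0%N) sf pf.
  rewrite -mulrA -normcX mulrC -normcM.
  rewrite (_ : coord R xi i ^+ k = monomial R (fun j => if j == i then k else 0%N) xi).
    by rewrite -hh; exact: hat_le (smooth_bl s p) hb.
  by rewrite /monomial (bigD1 i)//= eqxx big1 ?mulr1// => j /negbTE ->.
have hz : normc (hat f xi) <= hat_const R n * K * (h ^+ 0 * fm 0).
  have := Mnorm_lt h0 hK (fun=> 0%N); rewrite /mabs big1// mderiv0 => hb0.
  by rewrite -mulrA; exact: hat_le (smooth_bl sf pf) hb0.
case: (freq_size_attained xi) => [->|[i ->]]; last by rewrite -normc_coord_eq.
case: k {hb} => [|k]; first by rewrite expr0 mulr1.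
have K0 : 0 <= hat_const R n * K.
  have := le_trans (normc_ge0 _) hz; rewrite expr0 mul1r pmulr_lge0//.
  exact: (fact_weight_gt0 hM).
rewrite expr0n mulr0 mulr_ge0// mulr_ge0 ?exprn_ge0 ?(ltW h0)//.
exact: (fact_weight_ge0 hM).
Qed.

Lemma Mnorm_finite h f : (Mnorm M h f < +oo)%E -> exists2 K, 0 <= K & (Mnorm M h f < K%:E)%E.
Proof.
case: (Mnorm M h f) => [r| |]//= _; last by exists 0; rewrite ?ltNyr.
by exists (`|r| + 1); rewrite ?addr_ge0// lte_fin (le_lt_trans (ler_norm r))// ltrDl.
Qed.

Lemma EM_decays f : Defs.EM M f -> decays (hat f).
Proof.
move=> [h h0 hf]; have [_ _ /Mnorm_finite[K K0 hK]] := hf.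
exists (hat_const R n * K), h; split=> //.
  by rewrite mulr_ge0// hat_const_ge0.
exact: EMh_dec.
Qed.

Lemma EM_smooth f : Defs.EM M f -> smooth f /\ Defs.periodic f.
Proof. by case=> h _ []. Qed.

Lemma EM_bl f : Defs.EM M f -> bln f.
Proof. by case/EM_smooth => *; exact: smooth_bl. Qed.

Lemma EM_fser_hat f : Defs.EM M f -> fser (hat f) = f.
Proof.
move=> hf; have [sf pf] := EM_smooth hf.
apply: fser_hat => //; first exact: smooth_bl.
exact: (decays_fast hM H1 MH (EM_decays hf)).
Qed.

Lemma fser_linear (u v : R[i]) a b : decays a -> decays b ->
  fser (fun xi => u * a xi + v * b xi) = (fun t => u * fser a t + v * fser b t).
Proof.
move=> /(decays_fast hM H1 MH) /fast_bounds [C [_ [ha _ _]]].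
move=> /(decays_fast hM H1 MH) /fast_bounds [D [_ [hb _ _]]].
exact: fser_lin ha hb.
Qed.

Lemma EM_linear (u v : R[i]) f g : Defs.EM M f -> Defs.EM M g ->
  Defs.EM M (fun x => u * f x + v * g x).
Proof.
move=> hf hg; rewrite -(EM_fser_hat hf) -(EM_fser_hat hg).
rewrite -fser_linear; try exact: EM_decays.
by apply: EM_fser; apply: decays_lin => //; exact: EM_decays.
Qed.

Lemma EM_mderiv al f : Defs.EM M f -> Defs.EM M (mderiv al f).
Proof.
move=> hf; rewrite -(EM_fser_hat hf) mderiv_fser; last exact: EM_decays.
by apply: EM_fser; apply: decays_monomial; exact: EM_decays.
Qed.

Lemma fconj_fser a : decays a ->
  fconj (fser a) = fser (fun xi => conjc (a (- xi))).
Proof.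
move=> /(decays_fast hM H1 MH) /fast_bounds [C [_ [ha _ _]]].
apply/funext => x; rewrite /fconj /fser -(csum_conj (weight_bounded_character x ha)).
rewrite -(@csum_neg _ _ C (fun xi => conjc (a xi * character xi x))).
  congr csum; apply/funext => xi; rewrite conjcM -(opprK xi) -conjc_character !opprK.
  by rewrite conjcK.
by move=> xi; rewrite normc_conj; exact: weight_bounded_character.
Qed.

Lemma hat_character eta xi : hat (character eta : fct) xi = if xi == eta then 1 else 0.
Proof.
rewrite /hat; under eq_fun do rewrite -characterD.
rewrite torus_int_character addrC subr_eq0 eq_sym; case: eqP => _; last by rewrite mulr0.
by rewrite -rmorphM /= mulVf ?rmorph1// gt_eqF// vol_gt0.
Qed.

Lemma character_fser eta : (character eta : fct) = fser (fun xi => if xi == eta then 1 else 0).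
Proof.
apply/funext => x; rewrite /fser -[LHS](csum_single eta); congr csum.
by apply/funext => xi; case: eqP => [->|_]; rewrite ?mul1r ?mul0r.
Qed.

Lemma decays_single eta : decays (fun xi => if xi == eta then 1 else 0).
Proof.
apply: (@decays_finite _ _ _ hM (freq_size eta)) => xi.
by case: eqP => [->|//]; rewrite ltnn.
Qed.

Lemma EM_character eta : Defs.EM M (character eta : fct).
Proof. by rewrite character_fser; apply: EM_fser; exact: decays_single. Qed.

Definition fpartial_sum N f : fct := fun x =>
  \sum_(xi <- box n N) hat f xi * character xi x.

Lemma fpartial_sum_tail N f : Defs.EM M f -> (fun x => fpartial_sum N f x - f x) =
  fser (fun xi => if (freq_size xi <= N)%N then 0 else - hat f xi).
Proof.
move=> hf; have /(decays_fast hM H1 MH) /fast_bounds [C [_ [ha _ _]]] := EM_decays hf.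
have hb : weight_bounded C (fun xi => if (freq_size xi <= N)%N then 0 else - hat f xi).
  move=> xi; case: ifP => _; last by rewrite normcN.
  rewrite normc0 mulr_ge0 ?weight_ge0//.
  exact: weight_bounded_ge0 ha.
apply/funext => x; rewrite -{2}(EM_fser_hat hf).
apply: (@csum_unique _ _ C C _ _ N (weight_bounded_character x hb)) => N' hN.
rewrite /fpartial_sum.
have -> : psum N' (fun xi => (if (freq_size xi <= N)%N then 0 else - hat f xi) * character xi x) =
    - (psum N' (fun xi => hat f xi * character xi x) -
       psum N (fun xi => hat f xi * character xi x)).
  rewrite psum_split// -sumrN /psum [RHS]big_mkcond /=; apply: eq_bigr => xi _.
  by rewrite ltnNge; case: ifP => _; rewrite ?mul0r ?mulNr.
have := csum_approx N' (weight_bounded_character x ha).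
rewrite normc_distC; rewrite -/(psum N _) /fser.
by apply: le_trans; rewrite le_eqVlt; apply/orP; left; apply/eqP; congr normc; ring.
Qed.

(** The partial sums converge in one fixed space of the inductive system, so they eventually enter
    every neighbourhood in the sense of [indlim_nbhs0]. *)
Lemma EM_approx f : Defs.EM M f -> exists h K : R, [/\ 0 < h, 0 <= K & forall N,
  EMh M h (fun x => fpartial_sum N f x - f x) /\
  (Mnorm M h (fun x => (fpartial_sum N f x - f x)%R) <= (K * tail R n N)%:E)%E].
Proof.
move=> hf; have [C [h [C0 h0 hc]]] := EM_decays hf.
exists (2 * H * h), (fser_const C h); split.
- exact: twoHh_gt0.
- by rewrite mulr_ge0//; exact: shift_const_ge0.
move=> N; have hb : dec M C h (fun xi => if (freq_size xi <= N)%N then 0 else - hat f xi).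
  move=> xi k; case: ifP => _; last by rewrite normcN.
  rewrite normc0 mul0r mulr_ge0// mulr_ge0 ?exprn_ge0 ?(ltW h0)//.
  exact: (fact_weight_ge0 hM).
rewrite fpartial_sum_tail//; split; first exact: EMh_fser C0 h0 hb.
by apply: (Mnorm_fser_tail C0 h0 hb) => xi ->.
Qed.

End UltradifferentiableSeries.

(** * Ultradistributions *)

Section UltradistributionSeries.
Variables (R : realType) (n : nat) (M : nat -> R) (H : R).
Hypotheses (hM : weight_sequence M) (H1 : 1 <= H).
Hypothesis MH : forall j k, M (j + k)%N <= H ^+ (j + k) * M j * M k.
Local Notation freq := 'rV[int]_n.
Local Notation fct := ('rV[R]_n -> R[i]).
Local Notation bln := (bounded_lipschitz (@l1dist R n)).
Local Notation fm := (fact_weight M).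
Local Notation EM := (@Defs.EM R n M).
Local Notation decays := (@decays R n M).
Implicit Types (u v : fct -> R[i]) (xi eta : freq) (a b c : freq -> R[i]) (f g : fct) (C h : R).

Definition vol : R[i] := ((2 * pi) ^+ n)%:C%C.

Lemma vol_neq0 : vol != 0.
Proof. by rewrite /vol eq_complex /= eqxx andbT gt_eqF// vol_gt0. Qed.

Lemma EM_weight_bounded f : EM f -> exists C, weight_bounded C (hat f).
Proof.
move=> hf; have /fast_bounds[C [_ [h _ _]]] := decays_fast hM H1 MH (EM_decays hM hf).
by exists C.
Qed.

(** The ultradistribution with bounded Fourier coefficients [b]. The pairing is bilinear, without
    conjugation, so frequency [xi] meets [- xi]. *)
Definition coef_ultra b : fct -> R[i] := fun f => vol * csum (fun xi => b xi * hat f (- xi)).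

Lemma weight_bounded_pair K C b a : (forall xi, normc (b xi) <= K) -> weight_bounded C a ->
  weight_bounded (K * C) (fun xi => b xi * a (- xi)).
Proof.
move=> hb ha xi; rewrite normcM -mulrA; apply: ler_pM; rewrite ?normc_ge0//.
by rewrite -weight_neg.
Qed.

Lemma coef_ultra_linear K b (u v : R[i]) f g : (forall xi, normc (b xi) <= K) -> EM f -> EM g ->
  coef_ultra b (fun x => u * f x + v * g x) = u * coef_ultra b f + v * coef_ultra b g.
Proof.
move=> hb hf hg; have [C hC] := EM_weight_bounded hf; have [D hD] := EM_weight_bounded hg.
have := csum_lin u v (weight_bounded_pair hb hC) (weight_bounded_pair hb hD) => e.
rewrite /coef_ultra [u * _]mulrCA [v * _]mulrCA -mulrDr -e; congr (_ * csum _).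
apply/funext => xi; rewrite hat_lin; [ring|exact: (EM_bl hf)|exact: (EM_bl hg)].
Qed.

Lemma coef_ultra_le K e b f : (forall xi, normc (b xi) <= K) -> weight_bounded e (hat f) ->
  normc (coef_ultra b f) <= normc vol * (K * e * csum_const R n).
Proof.
move=> hb he; rewrite normcM ler_wpM2l ?normc_ge0//.
exact: csum_le (weight_bounded_pair hb he).
Qed.

Definition coef_nbhs (e : R) : set fct := [set f | EM f /\ weight_bounded e (hat f)].

(** These neighbourhoods make every [coef_ultra] with bounded coefficients continuous. In the space
    with parameter [h] the radius comes from decay of the coefficients at k = 0, converted into
    domination by [weight]. *)
Lemma coef_nbhs_indlim e : 0 < e -> indlim_nbhs0 M (coef_nbhs e).
Proof.
move=> e0; split; first by move=> f [].
  move=> u v f g [hf ef] [hg eg] uv; split; first exact: (EM_linear hM H1 MH).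
  move=> xi; rewrite hat_lin; [|exact: (EM_bl hf)|exact: (EM_bl hg)].
  rewrite (le_trans (weight_bounded_lin u v ef eg xi))//.
  rewrite ler_wpM2r ?weight_ge0// -mulrDl ler_piMl// ltW//.
move=> h h0; set D := hat_const R n * shift_const M H h (2 * n) * fm 0.
have D0 : 0 <= D.
  by rewrite mulr_ge0 ?(fact_weight_ge0 hM)// mulr_ge0 ?hat_const_ge0// (shift_const_ge0 hM H1).
have D1 : 0 < D + 1 by rewrite ltr_wpDl.
exists (e / (D + 1)); first exact: divr_gt0.
move=> f hf hr; split; first by exists h.
have r0 : 0 <= hat_const R n * (e / (D + 1)).
  by rewrite mulr_ge0 ?hat_const_ge0// divr_ge0// ltW.
have hd := EMh_dec hM h0 hf hr.
move=> xi; have := dec_weight hM H1 MH r0 h0 hd xi 0%N; rewrite !expr0 mulr1 mul1r.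
move/le_trans; apply; rewrite ler_wpM2r ?weight_ge0//.
have -> : hat_const R n * (e / (D + 1)) * shift_const M H h (2 * n) * fm 0 = D * e / (D + 1).
  by rewrite /D; ring.
by rewrite ler_pdivrMr// mulrC ler_wpM2l ?lerDl// ltW.
Qed.

Lemma coef_ultraP K b : (forall xi, normc (b xi) <= K) -> ultradistribution M (coef_ultra b).
Proof.
move=> hb; have K0 : 0 <= K by apply: le_trans (hb 0); exact: normc_ge0.
split=> [u v f g hf hg|f hf e e0]; first exact: (coef_ultra_linear _ _ hb).
set D := normc vol * (K * csum_const R n).
have D0 : 0 <= D by rewrite mulr_ge0 ?normc_ge0// mulr_ge0// csum_const_ge0.
have D1 : 0 < D + 1 by rewrite ltr_wpDl.
exists (coef_nbhs (e / (D + 1))); first exact/coef_nbhs_indlim/divr_gt0.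
move=> g hg [_ hgf].
have -> : coef_ultra b g - coef_ultra b f = coef_ultra b (fun x => g x - f x).
  have := coef_ultra_linear 1 (-1) hb hg hf; rewrite mul1r mulN1r => <-.
  by congr coef_ultra; apply/funext => x; rewrite mul1r mulN1r.
rewrite (le_lt_trans (coef_ultra_le hb hgf))//.
have -> : normc vol * (K * (e / (D + 1)) * csum_const R n) = D * e / (D + 1).
  by rewrite /D; ring.
by rewrite ltr_pdivrMr// mulrC ltr_pM2l// ltrDl.
Qed.

Lemma decays_bounded a : decays a -> exists K, forall xi, normc (a xi) <= K.
Proof.
case=> C [h [_ _ ha]]; exists (C * (h ^+ 0 * fm 0)) => xi.
by have := ha xi 0%N; rewrite expr0 mulr1.
Qed.

Lemma ultra_of_coef (v f : fct) : EM v -> EM f -> ultra_of v f = coef_ultra (hat v) f.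
Proof.
move=> hv hf; have fv := decays_fast hM H1 MH (EM_decays hM hv).
have bf := EM_bl hf.
rewrite /ultra_of -{1}(EM_fser_hat hM H1 MH hv) torus_int_fser//.
have [C hC] := EM_weight_bounded hf; have [K K0] := decays_bounded (EM_decays hM hv).
rewrite /coef_ultra -(csumZ _ (weight_bounded_pair K0 hC)); congr csum.
apply/funext => xi; rewrite /hat opprK mulrCA [X in _ = _ * X]mulrA.
by rewrite -rmorphM /= divff ?rmorph1 ?mul1r// gt_eqF// vol_gt0.
Qed.

Lemma coef_ultra_character b eta : coef_ultra b (character eta) = vol * b (- eta).
Proof.
rewrite /coef_ultra; congr (_ * _); rewrite -[RHS](csum_single (- eta)); congr csum.
apply/funext => xi; rewrite hat_character eqr_oppLR.
by case: eqP => [->|_]; rewrite ?mulr1 ?mulr0.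
Qed.

Lemma ultra_zero u : ultradistribution M u -> u (fun=> 0) = 0.
Proof.
case=> lin _; have := lin 0 0 _ _ (EM_character hM H1 MH 0) (EM_character hM H1 MH 0).
rewrite !mul0r addr0 => e; rewrite -[RHS]e; congr u; apply/funext => x.
by rewrite !mul0r addr0.
Qed.

Lemma ultra_sum u (r : seq freq) a : ultradistribution M u ->
  EM (fun x => \sum_(xi <- r) a xi * character xi x) /\
  u (fun x => \sum_(xi <- r) a xi * character xi x) = \sum_(xi <- r) a xi * u (character xi).
Proof.
move=> hu; have [lin _] := hu; have hc xi := EM_character hM H1 MH xi.
elim: r => [|xi r [ih1 ih2]].
  rewrite big_nil; under eq_fun do rewrite big_nil.
  split; last exact: ultra_zero.
  have := EM_linear hM H1 MH 0 0 (hc 0) (hc 0).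
  by rewrite (_ : (fun x => _) = fun=> 0)//; apply/funext => x; rewrite !mul0r addr0.
have -> : (fun x => \sum_(xi <- xi :: r) a xi * character xi x) =
  (fun x => a xi * character xi x + 1 * \sum_(xi <- r) a xi * character xi x).
  by apply/funext => x; rewrite big_cons mul1r.
split; first exact: (EM_linear hM H1 MH).
by rewrite lin// big_cons ih2 mul1r.
Qed.

(** Density of trigonometric polynomials: one partial sum of [f] is taken close enough to [f] for
    both functionals, and on it they agree. *)
Lemma ultra_density u v : ultradistribution M u -> ultradistribution M v ->
  (forall xi, u (character xi) = v (character xi)) -> ultra_eq M u v.
Proof.
move=> hu hv uv f hf; apply/eqP; rewrite -subr_eq0 -normc_eq0 eq_le normc_ge0 andbT.
rewrite leNgt; apply/negP; set d := normc _ => d0.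
have d2 : 0 < d / 2 by rewrite divr_gt0.
have [V [_ _ hV] cu] := hu.2 f hf _ d2; have [W [_ _ hW] cv] := hv.2 f hf _ d2.
have [h [K [h0 K0 hK]]] := EM_approx hM H1 MH hf.
have [r r0 hr] := hV h h0; have [s s0 hs] := hW h h0.
have m0 : 0 < Num.min r s by rewrite lt_min r0 s0.
have K1 : 0 < K + 1 by rewrite ltr_wpDl.
have [N hN] := @tail_small R n _ (divr_gt0 m0 K1).
have [k1 k2] := hK N.
have kt : (Mnorm M h (fun x => (fpartial_sum N f x - f x)%R) < (Num.min r s)%:E)%E.
  rewrite (le_lt_trans k2)// lte_fin.
  have := hN N (leqnn N); have t0 := @tail_ge0 R n N.
  rewrite ler_pdivlMr// mulrDr mulr1 mulrC.
  have [t1|t1] := eqVneq (tail R n N) 0; first by rewrite t1 mulr0.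
  have : 0 < tail R n N by rewrite lt_def t1.
  lra.
have [e1 eu] := ultra_sum (box n N) (hat f) hu.
have [_ ev] := ultra_sum (box n N) (hat f) hv.
have h1 : normc (u (fpartial_sum N f) - u f) < d / 2.
  apply: cu => //; apply: hr => //; rewrite (lt_le_trans kt)// lee_fin.
  by rewrite ge_min lexx.
have h2 : normc (v (fpartial_sum N f) - v f) < d / 2.
  apply: cv => //; apply: hs => //; rewrite (lt_le_trans kt)// lee_fin.
  by rewrite ge_min lexx orbT.
have e : u (fpartial_sum N f) = v (fpartial_sum N f).
  by rewrite /fpartial_sum eu ev; apply: eq_bigr => xi _; rewrite uv.
have : d <= normc (v (fpartial_sum N f) - v f) + normc (u (fpartial_sum N f) - u f).
  rewrite /d (_ : u f - v f = (v (fpartial_sum N f) - v f) - (u (fpartial_sum N f) - u f)).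
    exact: normcB.
  by rewrite e; ring.
lra.
Qed.

Definition ultra_hat (u : fct -> R[i]) xi : R[i] := vol^-1 * u (character (- xi)).

Lemma ultra_coef K u : ultradistribution M u -> (forall xi, normc (ultra_hat u xi) <= K) ->
  ultra_eq M u (coef_ultra (ultra_hat u)).
Proof.
move=> hu hK; apply: ultra_density => //; first exact: coef_ultraP hK.
by move=> xi; rewrite coef_ultra_character /ultra_hat opprK mulrA divff ?mul1r ?vol_neq0.
Qed.

Lemma ultra_of_fser b : decays b -> ultra_eq M (coef_ultra b) (ultra_of (fser b)).
Proof.
move=> db f hf; rewrite ultra_of_coef//; last exact: (EM_fser hM H1 MH).
have -> // : hat (fser b) = b.
apply/funext => xi; rewrite hat_fser//; exact: (decays_fast hM H1 MH db).
Qed.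

Lemma ultra_of_decays b (v : fct) : EM v -> ultra_eq M (coef_ultra b) (ultra_of v) -> decays b.
Proof.
move=> hv e; rewrite (_ : b = hat v); first exact: (EM_decays hM).
apply/funext => xi; have hc := EM_character hM H1 MH (- xi).
have := e _ hc; rewrite ultra_of_coef// !coef_ultra_character opprK.
exact: (mulfI vol_neq0).
Qed.

End UltradistributionSeries.

(** * The operator on Fourier coefficients *)

Section Symbol.
Variables (R : realType) (n : nat) (M : nat -> R) (H : R).
Hypotheses (hM : weight_sequence M) (H1 : 1 <= H).
Hypothesis MH : forall j k, M (j + k)%N <= H ^+ (j + k) * M j * M k.
Variables (A B : R[i]) (m : nat) (c : {ffun 'I_n -> 'I_m.+1} -> R[i]).
Local Notation freq := 'rV[int]_n.
Local Notation fct := ('rV[R]_n -> R[i]).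
Local Notation fm := (fact_weight M).
Local Notation EM := (@Defs.EM R n M).
Local Notation decays := (@decays R n M).
Local Notation vol := (vol R n).
Implicit Types (xi eta : freq) (a b : freq -> R[i]) (f g : fct) (C h : R) (u : fct -> R[i]).
Implicit Types (al : {ffun 'I_n -> 'I_m.+1}).

Definition symbol xi : R[i] :=
  \sum_(al : {ffun 'I_n -> 'I_m.+1} | (0 < mabs (mindex al) <= m)%N)
    c al * monomial R (mindex al) xi - A.

Definition P_coef a xi : R[i] := symbol xi * a xi - B * conjc (a (- xi)).

Lemma fser_sum (I : Type) (r : seq I) (Q : pred I) (F : I -> freq -> R[i]) :
  (forall i, decays (F i)) ->
  decays (fun xi => \sum_(i <- r | Q i) F i xi) /\
  fser (fun xi => \sum_(i <- r | Q i) F i xi) =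
    (fun x => \sum_(i <- r | Q i) fser (F i) x) :> fct.
Proof.
move=> hF; elim: r => [|i r [ih1 ih2]].
  have -> : (fun xi => \sum_(i <- [::] | Q i) F i xi) = (fun=> 0).
    by apply/funext => xi; rewrite big_nil.
  split; first exact: (@decays_finite _ _ _ hM 0%N).
  apply/funext => x; rewrite big_nil /fser -[RHS](csum_single (0 : freq)).
  by congr csum; apply/funext => xi; rewrite mul0r if_same.
have -> : (fun xi => \sum_(i0 <- i :: r | Q i0) F i0 xi) =
    (fun xi => if Q i then F i xi + \sum_(i <- r | Q i) F i xi else \sum_(i <- r | Q i) F i xi).
  by apply/funext => xi; rewrite big_cons.
case: (boolP (Q i)) => qi; last first.
  by split=> //; rewrite ih2; apply/funext => x; rewrite big_cons (negbTE qi).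
have e : (fun xi => F i xi + \sum_(i <- r | Q i) F i xi) =
   (fun xi => 1 * F i xi + 1 * \sum_(i <- r | Q i) F i xi).
  by apply/funext => xi; rewrite !mul1r.
rewrite e; split; first exact: (decays_lin hM).
rewrite (fser_linear hM H1 MH)// ih2; apply/funext => x.
by rewrite big_cons qi !mul1r.
Qed.

Lemma decays_symbol a : decays a -> decays (fun xi => symbol xi * a xi).
Proof.
move=> da; have [h _] := @fser_sum _ (index_enum {ffun 'I_n -> 'I_m.+1})
  (fun al => (0 < mabs (mindex al) <= m)%N)
  (fun al xi => c al * (monomial R (mindex al) xi * a xi))
  (fun al => decaysZ _ (decays_monomial hM H1 MH _ da)).
have := decays_lin hM 1 (- A) h da.
congr decays; apply/funext => xi; rewrite /symbol mulrBl mulr_suml mul1r mulNr.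
by congr (_ - _); apply: eq_bigr => al _; rewrite mulrA.
Qed.

Lemma decays_flip a : decays a -> decays (fun xi => conjc (a (- xi))).
Proof. by move=> da; exact: (decays_conj (decays_neg da)). Qed.

Lemma decays_P_coef a : decays a -> decays (P_coef a).
Proof.
move=> da; have := decays_lin hM 1 (- B) (decays_symbol da) (decays_flip da).
by congr decays; apply/funext => xi; rewrite mul1r mulNr.
Qed.

Lemma P_fct_fser a : decays a -> P_fct c A B (fser a) = fser (P_coef a).
Proof.
move=> da; have [h e] := @fser_sum _ (index_enum {ffun 'I_n -> 'I_m.+1})
  (fun al => (0 < mabs (mindex al) <= m)%N)
  (fun al xi => c al * (monomial R (mindex al) xi * a xi))
  (fun al => decaysZ _ (decays_monomial hM H1 MH _ da)).
have dL := decays_lin hM 1 (- A) h da.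
have -> : P_coef a = (fun xi => 1 * (1 *
    (\sum_(al : {ffun 'I_n -> 'I_m.+1} | (0 < mabs (mindex al) <= m)%N)
    c al * (monomial R (mindex al) xi * a xi)) + - A * a xi) + - B * conjc (a (- xi))).
  apply/funext => xi; rewrite /P_coef /symbol mulrBl mulr_suml !mul1r !mulNr.
  by congr (_ - _ - _); apply: eq_bigr => al _; rewrite mulrA.
rewrite (fser_linear hM H1 MH)//; last exact: decays_flip.
rewrite (fser_linear hM H1 MH)// e; apply/funext => x.
rewrite /P_fct (fconj_fser hM H1 MH da) /L_fct !mul1r !mulNr; congr (_ - _ - _).
apply: eq_bigr => al _; rewrite (mderiv_fser hM H1 MH _ da).
have := fser_linear hM H1 MH (c al) 0 (decays_monomial hM H1 MH (mindex al) da) da.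
move/(congr1 (fun F : fct => F x)); rewrite /= mul0r addr0 => <-; congr fser.
by apply/funext => xi; rewrite mul0r addr0.
Qed.

Lemma hat_P (u f : fct) : EM u -> P_fct c A B u = f -> P_coef (hat u) = hat f.
Proof.
move=> hu <-; have du := EM_decays hM hu.
rewrite -{2}(EM_fser_hat hM H1 MH hu) P_fct_fser//; apply/funext => xi.
by rewrite hat_fser//; exact: (decays_fast hM H1 MH (decays_P_coef du)).
Qed.

Lemma monomial_neg (al : 'I_n -> nat) xi :
  monomial R al (- xi) = (-1) ^+ mabs al * monomial R al xi.
Proof.
rewrite /monomial /mabs expr_sum -big_split; apply: eq_bigr => i _ /=.
by rewrite -exprMn; congr (_ ^+ _); rewrite /coord mxE mulrNz rmorphN mulrN mulN1r.
Qed.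

Lemma csum_sum (I : Type) (r : seq I) (Q : pred I) (F : I -> freq -> R[i]) :
  (forall i, exists C, weight_bounded C (F i)) ->
  (exists C, weight_bounded C (fun xi => \sum_(i <- r | Q i) F i xi)) /\
  csum (fun xi => \sum_(i <- r | Q i) F i xi) = \sum_(i <- r | Q i) csum (F i).
Proof.
move=> hF; elim: r => [|i r [[D hD] ih]].
  have -> : (fun xi => \sum_(i <- [::] | Q i) F i xi) = (fun=> 0).
    by apply/funext => xi; rewrite big_nil.
  rewrite big_nil; split; first by exists 0 => xi; rewrite normc0 mul0r.
  rewrite -[RHS](csum_single (0 : freq)); congr csum.
  by apply/funext => xi; rewrite if_same.
have -> : (fun xi => \sum_(i0 <- i :: r | Q i0) F i0 xi) =
    (fun xi => if Q i then F i xi + \sum_(i <- r | Q i) F i xi else \sum_(i <- r | Q i) F i xi).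
  by apply/funext => xi; rewrite big_cons.
rewrite big_cons; case: (boolP (Q i)) => qi.
  have [C hC] := hF i.
  have e : (fun xi => F i xi + \sum_(i <- r | Q i) F i xi) =
    (fun xi => 1 * F i xi + 1 * \sum_(i <- r | Q i) F i xi).
    by apply/funext => xi; rewrite !mul1r.
  rewrite e (csum_lin _ _ hC hD) ih !mul1r; split => //.
  exists (normc (1 : R[i]) * C + normc (1 : R[i]) * D); exact: weight_bounded_lin.
by rewrite ih; split => //; exists D.
Qed.

(** The form used to compute [P] on a prescribed functional, tested on all of [EM]; boundedness of
    [b] gives convergence of the series involved. *)
Lemma P_ultra_coef K b f : (forall xi, normc (b xi) <= K) -> EM f ->
  P_ultra c A B (coef_ultra b) f = coef_ultra (P_coef b) f.
Proof.
move=> hb hf; have [C hC] := EM_weight_bounded hM H1 MH hf.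
pose F al xi : R[i] := c al * (monomial R (mindex al) xi * b xi * hat f (- xi)).
(* The sign from the duality definition of the derivative cancels the one from evaluating the
   monomial at [- xi]. *)
have eF al xi : (-1) ^+ mabs (mindex al) * (b xi * hat (mderiv (mindex al) f) (- xi)) =
    monomial R (mindex al) xi * b xi * hat f (- xi).
  have [sf pf] := EM_smooth hf; have [_ _ ->] := mderiv_spec (mindex al) sf pf.
  rewrite monomial_neg; set s := (-1) ^+ _.
  have ss : s * s = 1 by rewrite /s -expr2 sqrr_sign.
  transitivity (s * s * (monomial R (mindex al) xi * b xi * hat f (- xi))); first by ring.
  by rewrite ss mul1r.
have hF al : exists D, weight_bounded D (F al).
  have [D hD] := EM_weight_bounded hM H1 MH (EM_mderiv hM H1 MH (mindex al) hf).
  exists (normc (c al) * (K * D)) => xi; rewrite /F normcM -[leRHS]mulrA ler_wpM2l ?normc_ge0//.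
  rewrite -eF normcM normcX normcN normc1 expr1n mul1r.
  exact: weight_bounded_pair hb hD xi.
have eL : L_ultra c (coef_ultra b) f = vol * csum (fun xi =>
    \sum_(al : {ffun 'I_n -> 'I_m.+1} | (0 < mabs (mindex al) <= m)%N) F al xi).
  have [_ ->] := csum_sum (index_enum _) (fun al => (0 < mabs (mindex al) <= m)%N) hF.
  rewrite /L_ultra mulr_sumr; apply: eq_bigr => al _.
  rewrite /ultra_deriv /coef_ultra.
  have [D hD] := EM_weight_bounded hM H1 MH (EM_mderiv hM H1 MH (mindex al) hf).
  have hw := weight_bounded_pair hb hD.
  transitivity (vol * (c al * ((-1) ^+ mabs (mindex al) *
    csum (fun xi => b xi * hat (mderiv (mindex al) f) (- xi))))); first by ring.
  congr (_ * _); rewrite -(csumZ _ hw).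
  have hw2 : weight_bounded (K * D) (fun xi =>
     (-1) ^+ mabs (mindex al) * (b xi * hat (mderiv (mindex al) f) (- xi))).
    by move=> xi; rewrite normcM normcX normcN normc1 expr1n mul1r; exact: hw.
  by rewrite -(csumZ _ hw2); congr csum; apply/funext => xi; rewrite /F -eF.
have hw := weight_bounded_pair hb hC.
have hb' xi : normc (conjc (b (- xi))) <= K by rewrite normc_conj.
have hw' := weight_bounded_pair hb' hC.
(* Conjugating [f] reflects its frequencies, so the sum is reindexed by [xi] to [- xi]. *)
have eC : ultra_conj (coef_ultra b) f = vol * csum (fun xi => conjc (b (- xi)) * hat f (- xi)).
  rewrite /ultra_conj /coef_ultra conjcM; congr (_ * _).
    by rewrite /vol conjc_real.
  have hC' : weight_bounded C (hat (fconj f)).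
    move=> xi; rewrite /fconj hat_conj; last exact: (EM_bl hf).
    by rewrite normc_conj -weight_neg.
  rewrite -(csum_conj (weight_bounded_pair hb hC')).
  rewrite -[RHS](csum_neg hw'); congr csum; apply/funext => xi.
  rewrite /= conjcM opprK /fconj hat_conj ?conjcK ?opprK//.
  exact: (EM_bl hf).
have [[D hD] _] := csum_sum (index_enum _) (fun al => (0 < mabs (mindex al) <= m)%N) hF.
rewrite /P_ultra eL eC /coef_ultra.
have -> : (fun xi => P_coef b xi * hat f (- xi)) = (fun xi =>
    1 * (1 * (\sum_(al : {ffun 'I_n -> 'I_m.+1} | (0 < mabs (mindex al) <= m)%N) F al xi) +
      - A * (b xi * hat f (- xi))) + - B * (conjc (b (- xi)) * hat f (- xi))).
  apply/funext => xi; rewrite /P_coef /symbol !mulrBl !mulr_suml !mul1r !mulNr.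
  rewrite !mulrA; congr (_ - _ - _).
  by apply: eq_bigr => al _; rewrite /F !mulrA.
rewrite (csum_lin _ _ (weight_bounded_lin _ _ hD hw) hw') (csum_lin _ _ hD hw).
ring.
Qed.

(** For an arbitrary ultradistribution, whose coefficients may grow: testing on a single character
    leaves only finite sums. *)
Lemma P_ultra_hat u xi : ultradistribution M u ->
  P_ultra c A B u (character (- xi)) = vol * P_coef (ultra_hat u) xi.
Proof.
move=> hu; have [lin _] := hu; have hc eta := EM_character hM H1 MH eta.
have uh eta : u (character eta) = vol * ultra_hat u (- eta).
  by rewrite /ultra_hat opprK mulrA divff ?mul1r ?vol_neq0.
have uZ (k : R[i]) eta : u (fun x => k * character eta x) = k * u (character eta).
  have := lin k 0 _ _ (hc eta) (hc eta); rewrite mul0r addr0 => <-; congr u.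
  by apply/funext => x; rewrite mul0r addr0.
rewrite /P_ultra /P_coef /symbol /ultra_conj.
have -> : fconj (character (- xi) : fct) = character xi.
  by apply/funext => x; rewrite /fconj conjc_character opprK.
have cv : conjc vol = vol by rewrite /vol conjc_real.
rewrite !uh opprK conjcM cv mulrBl mulr_suml mulrBr [X in _ = _ - X]mulrCA mulrBr.
rewrite [A * (vol * _)]mulrCA; congr (_ - _ - _).
rewrite mulr_sumr; apply: eq_bigr => al _; rewrite /ultra_deriv.
have -> : mderiv (mindex al) (character (- xi) : fct) =
   (fun x => monomial R (mindex al) (- xi) * character (- xi) x).
  rewrite {1}character_fser (mderiv_fser hM H1 MH _ (decays_single hM _)).
  apply/funext => x; rewrite /fser -[RHS](csum_single (- xi)); congr csum.
  by apply/funext => eta; case: eqP => [->|_]; rewrite ?mulr1 ?mulr0 ?mul0r.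
rewrite uZ uh opprK monomial_neg; set s := (-1) ^+ _.
have ss : s * s = 1 by rewrite /s -expr2 sqrr_sign.
transitivity (s * s * (c al * (monomial R (mindex al) xi * (vol * ultra_hat u xi)))).
  by ring.
by rewrite ss mul1r; ring.
Qed.

End Symbol.

(** * Small divisors *)

Section SmallDivisors.
Variables (R : realType) (n : nat) (M : nat -> R) (H : R).
Hypotheses (hM : weight_sequence M) (H1 : 1 <= H).
Hypothesis MH : forall j k, M (j + k)%N <= H ^+ (j + k) * M j * M k.
Variables (A B : R[i]) (m : nat) (c : {ffun 'I_n -> 'I_m.+1} -> R[i]).
Local Notation freq := 'rV[int]_n.
Local Notation fct := ('rV[R]_n -> R[i]).
Local Notation fm := (fact_weight M).
Local Notation EM := (@Defs.EM R n M).
Local Notation decays := (@decays R n M).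
Local Notation vol := (vol R n).
Local Notation z xi := ((freq_size xi)%:R : R).
Local Notation symbol := (symbol A c).
Local Notation P_coef := (P_coef A B c).
Implicit Types (xi eta : freq) (a b : freq -> R[i]) (f g : fct) (C h : R) (u : fct -> R[i]).

(* The equations for [a xi] and [conjc (a (- xi))] form a linear system with
   determinant [sigma xi], which is already diagonal when [B = 0]. *)
Definition cofactor xi : R[i] := if B == 0 then 1 else conjc (symbol (- xi)).

Definition sigma xi : R[i] := cofactor xi * symbol xi - B * conjc B.

Lemma cofactorE xi : B != 0 -> cofactor xi = conjc (symbol (- xi)).
Proof. by rewrite /cofactor => /negbTE ->. Qed.

Lemma P_coef_cramer a xi :
  cofactor xi * P_coef a xi + B * conjc (P_coef a (- xi)) = sigma xi * a xi.
Proof.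
have [B0|B0] := eqVneq B 0.
  by rewrite /P_coef /sigma /cofactor B0 eqxx; ring.
rewrite /sigma cofactorE// /P_coef opprK.
move: (symbol xi) (symbol (- xi)) => s t.
by rewrite conjcB !conjcM conjcK; ring.
Qed.

Lemma sigma_neg xi : B != 0 -> sigma (- xi) = conjc (sigma xi).
Proof.
move=> B0; rewrite /sigma !cofactorE// opprK.
move: (symbol xi) (symbol (- xi)) => s t.
by rewrite conjcB !conjcM !conjcK; ring.
Qed.

Definition divide a xi : R[i] :=
  (cofactor xi * a xi + B * conjc (a (- xi))) / sigma xi.

(** The converse of Cramer's rule. For nonzero B the value at [- xi] also enters, and it has the
    conjugate determinant by [sigma_neg], so one nonvanishing hypothesis serves both. *)
Lemma P_coef_divide a xi : sigma xi != 0 -> P_coef (divide a) xi = a xi.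
Proof.
move=> s0; rewrite /P_coef /divide; have [B0|B0] := eqVneq B 0.
  move: s0; rewrite /sigma /cofactor B0 eqxx !mul0r !mul1r subr0 => s0.
  by rewrite subr0 addr0; field.
rewrite sigma_neg// opprK conjcM conjcD !conjcM conjcK.
rewrite (conjc_inv (conjc (sigma xi))) conjcK !cofactorE// opprK conjcK.
have e : sigma xi = conjc (symbol (- xi)) * symbol xi - B * conjc B.
  by rewrite /sigma cofactorE.
move: (symbol xi) (symbol (- xi)) e => p q e.
apply: (mulIf s0); rewrite mulrBl !mulrA; move: (sigma xi) s0 e => s s0 e.
by rewrite !divfK// e; ring.
Qed.

(** Pointwise beyond N this negates the estimate of [dec] with constant 1, so its failure hands over
    frequencies along which [sigma] itself decays as the coefficients of a function in [EM] do. *)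
Definition small_divisor_condition := forall h, 0 < h -> exists N, forall xi,
  (N < freq_size xi)%N -> exists k, h ^+ k * fm k < normc (sigma xi) * z xi ^+ k.

Lemma normc_gt0_of_lt (w : R[i]) (x y : R) : 0 <= x -> x < normc w * y -> w != 0.
Proof.
move=> x0; apply: contraTneq => ->; rewrite normc0 mul0r -leNgt//.
Qed.

Lemma hfm_ge0 h k : 0 <= h -> 0 <= h ^+ k * fm k.
Proof. by move=> h0; rewrite mulr_ge0 ?exprn_ge0// (fact_weight_ge0 hM). Qed.

Lemma decays_split N a b : (forall xi, (N < freq_size xi)%N -> a xi = b xi) ->
  decays a -> decays b.
Proof.
move=> ab da.
have df : decays (fun xi => if (freq_size xi <= N)%N then b xi - a xi else 0).
  by apply: (@decays_finite _ _ _ hM N) => xi; rewrite ltnNge => /negbTE ->.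
have := decays_lin hM 1 1 da df; congr decays; apply/funext => xi.
rewrite !mul1r; case: leqP => h; first by rewrite addrC subrK.
by rewrite addr0 ab.
Qed.

(** The condition is used with radius [2 * H * h], where [h] is the radius of [a]. If it holds at
    [xi] with exponent j, the decay of [a] at k + j splits by [fact_weightD], and the factor with
    index j cancels against the lower bound for [sigma]. *)
Lemma decays_div a : small_divisor_condition -> decays a -> decays (fun xi => a xi / sigma xi).
Proof.
move=> dc [C [h [C0 h0 ha]]].
have hh := twoHh_gt0 H1 h0; have [N hN] := dc _ hh.
apply: (@decays_split N (fun xi => if (freq_size xi <= N)%N then 0 else a xi / sigma xi)).
  by move=> xi; rewrite ltnNge => /negbTE ->.
exists C, (2 * H * h); split => // xi k; case: (leqP (freq_size xi) N) => hx.
  by rewrite normc0 mul0r mulr_ge0// hfm_ge0// ltW.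
have [j hj] := hN xi hx.
have p0 : 0 < (2 * H * h) ^+ j * fm j.
  by rewrite mulr_gt0 ?exprn_gt0// (fact_weight_gt0 hM).
have s0 : 0 < normc (sigma xi).
  by rewrite normc_gt0; exact: normc_gt0_of_lt (ltW p0) hj.
rewrite normcM normcV mulrAC ler_pdivrMr// -(ler_pM2r p0).
have e1 := ha xi (k + j)%N; have e2 := fact_weightD hM H1 MH k j.
rewrite (@le_trans _ _ (normc (a xi) * z xi ^+ k * (normc (sigma xi) * z xi ^+ j)))//.
  by rewrite ler_wpM2l ?(ltW hj)// mulr_ge0 ?normc_ge0 ?exprn_ge0.
have -> : normc (a xi) * z xi ^+ k * (normc (sigma xi) * z xi ^+ j) =
  normc (sigma xi) * (normc (a xi) * z xi ^+ (k + j)) by rewrite exprD; ring.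
have -> : C * ((2 * H * h) ^+ k * fm k) * normc (sigma xi) * ((2 * H * h) ^+ j * fm j) =
  normc (sigma xi) * (C * (h ^+ (k + j) * ((2 * H) ^+ (k + j) * fm k * fm j))).
  by rewrite !exprMn !exprD; ring.
rewrite ler_pM2l// (le_trans e1)// ler_wpM2l// ler_wpM2l// exprn_ge0// ltW//.
Qed.

Lemma cofactor_decays a : decays a ->
  decays (fun xi => cofactor xi * a xi + B * conjc (a (- xi))).
Proof.
move=> da; have dc : decays (fun xi => cofactor xi * a xi).
  rewrite /cofactor; case: eqP => _; first by under eq_fun do rewrite mul1r.
  (* For nonzero B the cofactor is a reflected conjugate of the symbol, so multiplying by it means
     reflecting, multiplying by [symbol] and reflecting back. *)
  have := decays_flip (decays_symbol hM H1 MH A c (decays_flip da)).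
  by congr decays; apply/funext => xi; rewrite conjcM conjcK opprK.
have := decays_lin hM 1 B dc (decays_flip da); congr decays.
by apply/funext => xi; rewrite mul1r.
Qed.

Lemma sigma_neq0_outside : small_divisor_condition ->
  exists N, forall xi, (N < freq_size xi)%N -> sigma xi != 0.
Proof.
move=> /(_ 1 ltr01) [N hN]; exists N => xi /hN [k hk].
by apply: normc_gt0_of_lt hk; rewrite hfm_ge0.
Qed.

Lemma small_divisor_solvable : small_divisor_condition -> M_solvable M (P_fct c A B : fct -> fct).
Proof.
move=> dc; have [N hN] := sigma_neq0_outside dc.
(* Only frequencies outside the box have [sigma] known to be nonzero. The characters of the box span
   a complement. *)
exists [set f | EM f /\ forall xi, (freq_size xi <= N)%N -> hat f xi = 0]; split.
- split; first by move=> f [].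
    split.
      have h0 := EM_character hM H1 MH (0 : freq); have := EM_linear hM H1 MH 0 0 h0 h0.
      by rewrite (_ : (fun x => _) = fun=> 0)//; apply/funext => x; rewrite !mul0r addr0.
    move=> xi _; rewrite /hat (_ : (fun x => _) = (fun=> 0)) ?torus_int0 ?mulr0//.
    by apply/funext => x; rewrite mulr0.
  move=> u v f g [hf f0] [hg g0]; split; first exact: (EM_linear hM H1 MH).
  move=> xi hx; rewrite hat_lin ?f0 ?g0 ?mulr0 ?addr0//; [exact: (EM_bl hf)|exact: (EM_bl hg)].
- exists (size (box n N)), (fun i => character (nth 0 (box n N) i)); split.
    by move=> i; exact: (EM_character hM H1 MH).
  move=> f hf; exists (fun i => hat f (nth 0 (box n N) i)).
  have e : (fun x => f x - \sum_(i < size (box n N))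
      hat f (nth 0 (box n N) i) * character (nth 0 (box n N) i) x) =
      (* Shaped for [fser_linear]; the sign is there because [fpartial_sum_tail] describes the
         partial sum minus [f]. *)
      fser (fun xi => -1 * (if (freq_size xi <= N)%N then 0 else - hat f xi) + 0 * hat f xi).
    have dr : decays (fun xi => if (freq_size xi <= N)%N then 0 else - hat f xi).
      apply: (@decays_split N (fun xi => -1 * hat f xi)).
        by move=> xi; rewrite ltnNge => /negbTE ->; rewrite mulN1r.
      exact: decaysZ (EM_decays hM hf).
    rewrite (fser_linear hM H1 MH _ _ dr (EM_decays hM hf)).
    rewrite -(fpartial_sum_tail hM H1 MH N hf); apply/funext => x.
    rewrite mul0r addr0 mulN1r opprB; congr (_ - _).
    by rewrite /fpartial_sum (big_nth 0) big_mkord.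
  have dr : decays (fun xi =>
      -1 * (if (freq_size xi <= N)%N then 0 else - hat f xi) + 0 * hat f xi).
    apply: (@decays_split N _ _ _ (EM_decays hM hf)) => xi.
    by rewrite ltnNge => /negbTE ->; rewrite mulN1r opprK mul0r addr0.
  rewrite e; split; first exact: (EM_fser hM H1 MH).
  move=> xi hx; rewrite hat_fser; last exact: (decays_fast hM H1 MH).
  by rewrite hx mulr0 mul0r addr0.
move=> f [hf f0]; have df := EM_decays hM hf.
have dU := decays_div dc (cofactor_decays df).
exists (fser (divide (hat f))); first exact: (EM_fser hM H1 MH).
rewrite (P_fct_fser hM H1 MH)// -[RHS](EM_fser_hat hM H1 MH hf); congr fser.
(* In the box [sigma] may vanish, but the numerators of [divide] at [xi] and at [- xi] are zero
   there, so both quotients are 0 in any case. *)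
apply/funext => xi; have [hx|hx] := leqP (freq_size xi) N; last exact/P_coef_divide/hN.
rewrite /P_coef /divide !opprK f0// f0 ?freq_sizeN//.
by rewrite conjc0 !(mulr0, addr0, mul0r) conjc0 mulr0 subr0.
Qed.

Lemma small_divisor_hypoelliptic : small_divisor_condition ->
  M_globally_hypoelliptic M (P_ultra c A B : (fct -> R[i]) -> (fct -> R[i])).
Proof.
move=> dc u hu [g hg Pu]; have [N hN] := sigma_neq0_outside dc.
have e : P_coef (ultra_hat u) = hat g.
  apply/funext => xi; apply: (mulfI (vol_neq0 R n)).
  rewrite -(P_ultra_hat hM H1 MH)// Pu; last exact: (EM_character hM H1 MH).
  rewrite (ultra_of_coef hM H1 MH)//; last exact: (EM_character hM H1 MH).
  by rewrite coef_ultra_character opprK.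
have dg := EM_decays hM hg.
have du : decays (ultra_hat u).
  (* Finitely many coefficients do not affect decay; outside the box [P_coef_cramer] identifies
     those of [u] with the quotient. *)
  apply: (@decays_split N _ _ _ (decays_div dc (cofactor_decays dg))) => xi /hN s0.
  by rewrite -e P_coef_cramer mulrC mulKf.
exists (fser (ultra_hat u)); first exact: (EM_fser hM H1 MH).
move=> f hf; have [K hK] := decays_bounded du.
rewrite (ultra_coef hM H1 MH hu hK hf).
exact: (ultra_of_fser hM H1 MH du).
Qed.

End SmallDivisors.

(** * Coefficients supported on a sparse sequence of frequencies *)

Section Lacunary.
Variables (R : realType) (n : nat) (x : nat -> 'rV[int]_n).
Hypothesis x_pos : forall i, (i < freq_size (x i))%N.
Hypothesis x_inc : forall i j, (i < j)%N -> (freq_size (x i) < freq_size (x j))%N.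
Implicit Types (xi : 'rV[int]_n) (al : nat -> R[i]).

Definition lacunary al xi : R[i] :=
  if pselect (exists i, x i = xi) is left e then al (projT1 (cid e)) else 0.

Lemma lacunary_size_inj i j : freq_size (x i) = freq_size (x j) -> i = j.
Proof.
by case: (ltngtP i j) => // /x_inc + e; rewrite e ltnn.
Qed.

Lemma lacunary_x al i : lacunary al (x i) = al i.
Proof.
rewrite /lacunary; case: pselect => [e|[]]; last by exists i.
by case: cid => j /= xj; congr al; apply: lacunary_size_inj; rewrite xj.
Qed.

(** The size of a frequency determines its index, so [x j = - x i] forces j = i and then x_i = 0,
    against the positive size. Values at x_i and at - x_i can thus be prescribed independently. *)
Lemma lacunary_neg al i : lacunary al (- x i) = 0.
Proof.
rewrite /lacunary; case: pselect => [[j e]|//]; exfalso.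
have ij : j = i by apply: lacunary_size_inj; rewrite e freq_sizeN.
move: e; rewrite ij => /rowP e; have := x_pos i.
rewrite ltnNge => /negP; apply; apply/bigmax_leqP => k _.
by have := e k; rewrite mxE; move: (x i 0 k) => w hw; have -> : w = 0 by lia.
Qed.

Lemma lacunary_out al xi : (forall i, x i != xi) -> lacunary al xi = 0.
Proof.
move=> h; rewrite /lacunary; case: pselect => [[i e]|//].
by have := h i; rewrite e eqxx.
Qed.

Lemma lacunary_dec M C h al : 0 <= C -> 0 <= h -> (forall k, 0 <= fact_weight M k) ->
  (forall i k, normc (al i) * (freq_size (x i))%:R ^+ k <= C * (h ^+ k * fact_weight M k)) ->
  dec M C h (lacunary al).
Proof.
move=> C0 h0 m0 hal xi k; rewrite {1}/lacunary; case: pselect => [e|_].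
  by case: cid => i /= <-.
by rewrite normc0 mul0r mulr_ge0// mulr_ge0// exprn_ge0.
Qed.

Lemma lacunary_bounded K al : 0 <= K -> (forall i, normc (al i) <= K) ->
  forall xi, normc (lacunary al xi) <= K.
Proof. by move=> K0 h xi; rewrite /lacunary; case: pselect => *; rewrite ?normc0. Qed.

(** Decay with k = 1 already bounds |b (xi)| |xi|, while the sizes along the subsequence are
    unbounded. The factor 2 in the choice of [i] accounts for the two frequencies. *)
Lemma lacunary_not_decays M (b : 'rV[int]_n -> R[i]) (e : R) (s : nat -> nat) :
  0 < e -> (forall i, (i <= s i)%N) ->
  (forall i, e <= normc (b (x (s i))) + normc (b (- x (s i)))) -> ~ decays M b.
Proof.
move=> e0 hs hb [C [h [C0 h0 hd]]].
set D := C * (h ^+ 1 * fact_weight M 1).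
pose i := Num.bound (2 * `|D| / e).
have hi : 2 * `|D| / e < i%:R by apply: archi_boundP; rewrite divr_ge0 ?mulr_ge0// ltW.
have h1 := hd (x (s i)) 1%N; have h2 := hd (- x (s i)) 1%N.
rewrite freq_sizeN -/D expr1 in h2; rewrite -/D expr1 in h1.
have zi : i%:R <= (freq_size (x (s i)))%:R :> R.
  by rewrite ler_nat (leq_trans (hs i))// ltnW.
have : e * i%:R <= 2 * `|D|.
  rewrite (@le_trans _ _ ((normc (b (x (s i))) + normc (b (- x (s i)))) *
      (freq_size (x (s i)))%:R))//.
    by rewrite ler_pM// ltW.
  have := ler_norm D; rewrite mulrDl; lra.
by rewrite ltr_pdivrMr// in hi; rewrite leNgt [e * _]mulrC hi.
Qed.

End Lacunary.

(** * Counterexamples when the lower bound fails *)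

Section SmallDivisorsFail.
Variables (R : realType) (n : nat) (M : nat -> R) (H : R).
Hypotheses (hM : weight_sequence M) (H1 : 1 <= H).
Hypothesis MH : forall j k, M (j + k)%N <= H ^+ (j + k) * M j * M k.
Variables (A B : R[i]) (m : nat) (c : {ffun 'I_n -> 'I_m.+1} -> R[i]).
Local Notation freq := 'rV[int]_n.
Local Notation fct := ('rV[R]_n -> R[i]).
Local Notation fm := (fact_weight M).
Local Notation EM := (@Defs.EM R n M).
Local Notation decays := (@decays R n M).
Local Notation z xi := ((freq_size xi)%:R : R).
Local Notation symbol := (symbol A c).
Local Notation P_coef := (P_coef A B c).
Local Notation sigma := (sigma A B c).
Local Notation cofactor := (cofactor A B c).
Implicit Types (xi eta : freq) (a b : freq -> R[i]) (f g : fct) (C h : R) (u : fct -> R[i]).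

Lemma small_divisor_sequence : ~ small_divisor_condition M A B c ->
  exists h (x : nat -> freq), [/\ 0 < h,
    forall i, (i < freq_size (x i))%N,
    forall i j, (i < j)%N -> (freq_size (x i) < freq_size (x j))%N &
    forall i k, normc (sigma (x i)) * z (x i) ^+ k <= h ^+ k * fm k].
Proof.
move=> /existsNP[h /not_implyP[h0 hN]].
have hg N : exists xi, (N < freq_size xi)%N /\
    forall k, normc (sigma xi) * z xi ^+ k <= h ^+ k * fm k.
  apply: contra_notP hN => hx; exists N => xi hxi; apply: contra_notP hx => hk.
  exists xi; split=> // k; rewrite leNgt; apply/negP => hlt; apply: hk.
  by exists k.
have /choice[g hg'] := hg.
(* Each bad frequency is chosen beyond the size of the previous one, which makes the sizes strictly
   increasing. *)
pose x := fix x i := if i is j.+1 then g (freq_size (x j)) else g 0%N.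
have xS i : (freq_size (x i) < freq_size (x i.+1))%N by case: (hg' (freq_size (x i))).
exists h, x; split => //.
- elim=> [|i ih]; first by case: (hg' 0%N).
  exact: leq_ltn_trans ih (xS i).
- exact: (homo_ltn ltn_trans xS).
- by case=> [|i] k; [case: (hg' 0%N)|case: (hg' (freq_size (x i)))].
Qed.

Lemma cofactor_pair_gt0 xi : 0 < normc (cofactor xi) + normc B.
Proof.
rewrite /cofactor; case: eqP => [_|/eqP B0].
  by rewrite normc1 ltr_wpDr// normc_ge0.
by rewrite ltr_wpDl ?normc_ge0// normc_gt0.
Qed.

(** A lower bound for |cofactor| + |B| uniform in the frequency. It is also the modulus of the
    factor in front of the datum in [P_coef_cramer] when the datum sits at x_i for B = 0 and at -
    x_i otherwise. *)
Definition pair_bound : R := if B == 0 then 1 else normc B.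

Lemma pair_bound_gt0 : 0 < pair_bound.
Proof. by rewrite /pair_bound; case: eqP => // /eqP B0; rewrite normc_gt0. Qed.

Lemma pair_bound_le xi : pair_bound <= normc (cofactor xi) + normc B.
Proof.
rewrite /pair_bound /cofactor; case: eqP => _.
  by rewrite normc1 lerDl normc_ge0.
by rewrite lerDr normc_ge0.
Qed.

(* On the pair of frequencies x_i, - x_i the coefficients (cofactor, B) are
   mapped to (sigma, 0) by P. *)
Lemma not_small_divisor_hypoelliptic : ~ small_divisor_condition M A B c ->
  ~ M_globally_hypoelliptic M (P_ultra c A B : (fct -> R[i]) -> (fct -> R[i])).
Proof.
move=> /small_divisor_sequence[h [x [h0 xp xi_inc hx]]] GH.
(* This normalisation makes the moduli at x_i and - x_i add up to 1, hence bounded without decay,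
   and costs at most a factor [pair_bound^-1] in the image. As [d i] is real, it commutes with
   conjugation. *)
pose d i := (normc (cofactor (x i)) + normc B)%:C%C.
have nd i : normc (d i) = normc (cofactor (x i)) + normc B.
  by rewrite normc_real ger0_norm// ltW// cofactor_pair_gt0.
have d0 i : d i != 0 by rewrite -normc_gt0 nd cofactor_pair_gt0.
have cd i : conjc (d i)^-1 = (d i)^-1 by rewrite conjc_inv /d conjc_real.
pose al i := cofactor (x i) / d i; pose be i := B / d i.
pose b xi := lacunary x al xi + lacunary x be (- xi).
have bx i : b (x i) = al i by rewrite /b lacunary_x// lacunary_neg// addr0.
have bxN i : b (- x i) = be i by rewrite /b opprK lacunary_x// lacunary_neg// add0r.
have al1 i : normc (al i) <= 1.
  by rewrite normcM normcV nd ler_pdivrMr ?cofactor_pair_gt0// mul1r lerDl normc_ge0.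
have be1 i : normc (be i) <= 1.
  by rewrite normcM normcV nd ler_pdivrMr ?cofactor_pair_gt0// mul1r lerDr normc_ge0.
have b2 xi : normc (b xi) <= 1 + 1.
  by rewrite (le_trans (normcD _ _))// lerD// lacunary_bounded.
have Pb : P_coef b = lacunary x (fun i => sigma (x i) / d i).
  apply/funext => xi; rewrite /P_coef.
  have [[i <-]|h1] := pselect (exists i, x i = xi).
    by rewrite bx bxN lacunary_x// /al /be conjcM cd /sigma; ring.
  rewrite [RHS]lacunary_out => [|i]; last by apply/eqP => e; apply: h1; exists i.
  have [[i e]|h2] := pselect (exists i, x i = - xi).
    have -> : xi = - x i by rewrite e opprK.
    rewrite opprK bx bxN /al /be conjcM cd.
    (* For nonzero B the conjugate of the cofactor at x_i is the symbol at - x_i, so the two terms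
       cancel; for B = 0 both vanish. *)
    have [B0|B0] := eqVneq B 0; first by rewrite B0; ring.
    by rewrite cofactorE// conjcK; ring.
  have o1 i : x i != xi by apply/eqP => e; apply: h1; exists i.
  have o2 i : x i != - xi by apply/eqP => e; apply: h2; exists i.
  by rewrite /b opprK !lacunary_out// addr0 conjc0; ring.
have dP : decays (P_coef b).
  rewrite Pb; exists (pair_bound^-1), h; split => //.
    by rewrite invr_ge0 ltW// pair_bound_gt0.
  apply: lacunary_dec => [||j|i k].
  - by rewrite invr_ge0 ltW// pair_bound_gt0.
  - exact: ltW.
  - exact: (fact_weight_ge0 hM).
  rewrite normcM normcV nd mulrAC mulrC.
  apply: ler_pM => //.
  - by rewrite invr_ge0 ltW// cofactor_pair_gt0.
  - by rewrite mulr_ge0 ?exprn_ge0 ?normc_ge0.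
  - by rewrite lef_pV2 ?posrE ?pair_bound_gt0 ?cofactor_pair_gt0 ?pair_bound_le.
have [v hv e] : exists2 v, EM v & ultra_eq M (coef_ultra b) (ultra_of v).
  apply: GH; first exact: (coef_ultraP hM H1 MH b2).
  exists (fser (P_coef b)); first exact: (EM_fser hM H1 MH).
  move=> f hf; rewrite (P_ultra_coef hM H1 MH A B c b2 hf).
  exact: (ultra_of_fser hM H1 MH dP).
have := ultra_of_decays hM H1 MH hv e.
apply: (@lacunary_not_decays _ _ x xp M b 1 id) => // i.
rewrite bx bxN !normcM normcV nd -mulrDl divff// gt_eqF//.
exact: cofactor_pair_gt0.
Qed.

(** A single term of the exponential series bounds exp y from below. As the weights are at least 1,
    exp (- |xi|) has the decay required by every weight sequence; it supplies nonzero data where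
    [sigma] vanishes. *)
Lemma expR_decay (y : R) k : 0 <= y -> expR (- y) * y ^+ k <= k`!%:R.
Proof.
move=> y0; rewrite expRN mulrC ler_pdivrMr ?expR_gt0//.
case: k => [|k].
  by rewrite expr0 mul1r -expR0 ler_expR.
have := expR_ge1Dxn k y0 => hk.
have f0 : 0 < k.+1`!%:R :> R by rewrite ltr0n fact_gt0.
rewrite mulrC -ler_pdivrMr//; apply: le_trans hk.
by rewrite lerDr.
Qed.

Lemma subspace_sum (F : set fct) (I : Type) (r : seq I) (la : I -> R[i]) (g : I -> fct) :
  subspace M F -> (forall i, F (g i)) -> F (fun t => \sum_(i <- r) la i * g i t).
Proof.
move=> [_ F0 FD] hg; elim: r => [|i r ih].
  by under eq_fun do rewrite big_nil.
have := FD (la i) 1 _ _ (hg i) ih; congr F; apply/funext => t.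
by rewrite big_cons mul1r.
Qed.

(** Modulo F the k+1 functions are combinations of k others; a nonzero row vector killed by the
    coefficient matrix gives the combination. *)
Lemma subspace_combination (F : set fct) k (f : 'I_k.+1 -> fct) :
  subspace M F -> (exists g : 'I_k -> fct, forall i, exists a : 'I_k -> R[i],
     F (fun t => f i t - \sum_(j < k) a j * g j t)) ->
  exists2 la : 'I_k.+1 -> R[i], (exists i, la i != 0) & F (fun t => \sum_i la i * f i t).
Proof.
move=> sF [g hg]; have /choice[a ha] := hg.
pose N : 'M[R[i]]_(k.+1, k) := \matrix_(i, j) a i j.
have : kermx N != 0.
  rewrite kermx_eq0 /row_free; apply/eqP => e.
  by have := rank_leq_col N; rewrite e ltnn.
case/rowV0Pn => v /sub_kermxP vN /rV0Pn[i0 vi0].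
exists (v 0); first by exists i0.
have := subspace_sum (index_enum 'I_k.+1) (v 0) sF ha; congr F; apply/funext => t.
have e : \sum_i v 0 i * (\sum_(j < k) a i j * g j t) = 0.
  under eq_bigr do rewrite mulr_sumr; rewrite exchange_big /= big1// => j _.
  have := congr1 (fun w : 'rV_k => w 0 j) vN; rewrite !mxE => e.
  transitivity ((\sum_i v 0 i * a i j) * g j t).
    by rewrite mulr_suml; apply: eq_bigr => i _; rewrite mulrA.
  rewrite (_ : \sum_i v 0 i * a i j = 0) ?mul0r//.
  by rewrite -[RHS]e; apply: eq_bigr => i _; rewrite mxE.
by under eq_bigr do rewrite mulrBr; rewrite sumrB e subr0.
Qed.

Lemma not_small_divisor_solvable : ~ small_divisor_condition M A B c ->
  ~ M_solvable M (P_fct c A B : fct -> fct).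
Proof.
move=> /small_divisor_sequence[h [x [h0 xp xi_inc hx]]].
move=> [F [sF [k [g [hg hFg]]] hF]].
(* At least |sigma|, so that dividing by [sigma] destroys decay, and strictly positive even where
   [sigma] vanishes. *)
pose w i : R := normc (sigma (x i)) + expR (- z (x i)).
have w0 i : 0 < w i by rewrite ltr_wpDl ?normc_ge0// expR_gt0.
(* Residue classes of the index give k+1 disjoint supports, one more than the number of functions
   spanning the quotient by F. *)
pose al (l : 'I_k.+1) i : R[i] := if (i %% k.+1 == l)%N then (w i)%:C%C else 0.
have dal l : decays (lacunary x (al l)).
  (* The two terms of [w] decay with radii h and 1 respectively; h + 1 dominates both and the
     constant 2 counts them. *)
  exists 2, (h + 1); split; rewrite ?addr_gt0//.
  apply: lacunary_dec => //; first by rewrite addr_ge0// ltW.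
    by move=> j; exact: (fact_weight_ge0 hM).
  move=> i j; rewrite (@le_trans _ _ (w i * z (x i) ^+ j))//.
    rewrite ler_wpM2r ?exprn_ge0// /al; case: ifP => _; rewrite ?normc0 ?(ltW (w0 i))//.
    by rewrite normc_real ger0_norm// ltW.
  have hj : h ^+ j * fm j <= (h + 1) ^+ j * fm j.
    rewrite ler_wpM2r ?(fact_weight_ge0 hM)// lerXn2r ?nnegrE ?addr_ge0 ?(ltW h0)//.
    by rewrite lerDl.
  have ej : expR (- z (x i)) * z (x i) ^+ j <= (h + 1) ^+ j * fm j.
    rewrite (le_trans (expR_decay j _))// (@le_trans _ _ (fm j))//.
      by rewrite ler_peMl// (weight_ge1 hM).
    by rewrite ler_peMl ?(fact_weight_ge0 hM)// exprn_ege1// lerDr ltW.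
  by rewrite /w mulrDl mulrDl !mul1r lerD// (le_trans (hx i j)).
(* For nonzero B the data are placed at - x_i: the term of [P_coef_cramer] with the cofactor, whose
   size is not controlled, then vanishes at x_i and only the constant factor B remains. *)
pose phi l xi : R[i] := if B == 0 then lacunary x (al l) xi else lacunary x (al l) (- xi).
have dphi l : decays (phi l).
  by rewrite /phi; case: eqP => _; [exact: dal|exact: decays_neg].
have [la [l0 hl0] hla] : exists2 la : 'I_k.+1 -> R[i], (exists i, la i != 0) &
    F (fun t => \sum_i la i * fser (phi i) t).
  apply: subspace_combination => //; exists g => i.
  by apply: hFg; exact: (EM_fser hM H1 MH).
have [u hu Pu] := hF _ hla.
have [_ esum] := @fser_sum _ _ _ _ hM H1 MH _ (index_enum 'I_k.+1) xpredT
   (fun l xi => la l * phi l xi) (fun l => decaysZ (la l) (dphi l)).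
have [dsum _] := @fser_sum _ _ _ _ hM H1 MH _ (index_enum 'I_k.+1) xpredT
   (fun l xi => la l * phi l xi) (fun l => decaysZ (la l) (dphi l)).
have ef : (fun t => \sum_i la i * fser (phi i) t) = fser (fun xi => \sum_l la l * phi l xi).
  rewrite esum; apply/funext => t; apply: eq_bigr => l _.
  have := fser_linear hM H1 MH (la l) 0 (dphi l) (dphi l).
  move/(congr1 (fun G : fct => G t)); rewrite /= mul0r addr0 => <-.
  by congr fser; apply/funext => xi; rewrite mul0r addr0.
have hP : P_coef (hat u) = (fun xi => \sum_l la l * phi l xi).
  rewrite (hat_P hM H1 MH hu Pu) ef; apply/funext => xi.
  by rewrite hat_fser//; exact: (decays_fast hM H1 MH).
(* On the residue class of an index with nonzero coefficient, the combination reduces to its single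
   term [l0]. *)
pose s i := (i * k.+1 + l0)%N.
have sl i (l : 'I_k.+1) : ((s i %% k.+1)%N == l) = (l == l0).
  by rewrite /s modnMDl modn_small// eq_sym.
have pick i : \sum_l la l * al l (s i) = la l0 * (w (s i))%:C%C.
  rewrite (bigD1 l0)//= /al sl eqxx big1 ?addr0// => l /negbTE ll.
  by rewrite sl ll mulr0.
have key i : normc (sigma (x (s i))) * normc (hat u (x (s i))) =
    pair_bound * normc (la l0) * w (s i).
  rewrite -normcM -P_coef_cramer hP /pair_bound /cofactor.
  have [B0|B0] := eqVneq B 0.
    rewrite B0 mul0r addr0 !mul1r -[w _]ger0_norm ?(ltW (w0 _))// -normc_real -normcM -pick.
    congr normc; apply: eq_bigr => l _; rewrite /phi B0 eqxx lacunary_x//.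
  rewrite [X in _ * X + _]big1 => [|l _]; last first.
    by rewrite /phi (negbTE B0) lacunary_neg// mulr0.
  rewrite mulr0 add0r -[w _]ger0_norm ?(ltW (w0 _))// -normc_real -mulrA -normcM -pick.
  rewrite normcM normc_conj; congr (_ * normc _); apply: eq_bigr => l _.
  by rewrite /phi (negbTE B0) opprK lacunary_x.
have la0 : 0 < normc (la l0) by rewrite normc_gt0.
have c0 : 0 < pair_bound * normc (la l0) by rewrite mulr_gt0// pair_bound_gt0.
have := EM_decays hM hu.
apply: (@lacunary_not_decays _ _ x xp M (hat u) (pair_bound * normc (la l0)) s) => //.
  by move=> i; rewrite /s; nia.
move=> i; rewrite (@le_trans _ _ (normc (hat u (x (s i)))))//; last first.
  by rewrite lerDl normc_ge0.
(* If [sigma] vanished here, the left side of [key] would be 0 while the right side is positive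
   because of the exponential in [w]. *)
have s0 : 0 < normc (sigma (x (s i))).
  rewrite lt_neqAle normc_ge0 andbT; apply/eqP => e0.
  have := key i; rewrite -e0 mul0r => /eqP; rewrite eq_sym mulf_eq0.
  by rewrite !gt_eqF.
rewrite -(ler_pM2l s0) key mulrC ler_pM2l// /w lerDl expR_ge0//.
Qed.

End SmallDivisorsFail.

Theorem corollary3p4 (R : realType) (n : nat) (M : nat -> R)
    (hM : weight_sequence M) (A B : R[i]) (m : nat)
    (c : {ffun 'I_n -> 'I_m.+1} -> R[i]) :
  M_solvable M (P_fct c A B) <->
  M_globally_hypoelliptic M (P_ultra c A B).
Proof.
have [_ _ _ _ [H H1 MH]] := hM.
have [dc|ndc] := pselect (small_divisor_condition M A B c).
  split=> _; first exact: (small_divisor_hypoelliptic hM H1 MH dc).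
  exact: (small_divisor_solvable hM H1 MH dc).
split=> h; exfalso; first exact: (not_small_divisor_solvable hM H1 MH ndc h).
exact: (not_small_divisor_hypoelliptic hM H1 MH ndc h).
Qed.
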